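(* Let $(P_t)_{t\ge 0}$ be the $m$-symmetric strongly continuous sub-Markovian semigroup on $L^2(m)$ of a symmetric Markov process. Let $\alpha>0$, $t>0$ and $g\in L^2(m)$. Then $g\in\mathscr D(P_t^{-1})$ if and only if $$\int_0^\infty I_0(2\sqrt{2ts})\,(\mathcal J^\alpha_s g,g)\,ds<\infty ,$$ where $I_0$ is the modified Bessel function of the first kind of order $0$. Moreover, if $g\in\mathscr D(P_t^{-1})$, then $P_t^{-1}g$ equals a Bochner integral as follows: $$P_t^{-1}g=e^{-\alpha t}\int_0^\infty I_0(2\sqrt{ts})\,\mathcal J^\alpha_s g\,ds .$$
   Context: Setting: $X$ is a Borel right Markov process whose state space $\mathbf E$ is a locally compact separable metric space with Borel $\sigma$-algebra $\mathscr E$; $m$ is a $\sigma$-finite measure on $\mathscr E$ with full support such that $(\mathbf E,\mathscr E,m)$ is a separable measure space, so $L^2(m):=L^2(\mathbf E,m)$ is a separable Hilbert space with inner product $(f,g)=\int_{\mathbf E} fg\,dm$ and norm $\|\cdot\|$. The transition semigroup of $X$ extends to a strongly continuous sub-Markovian semigroup $(P_t)_{t\ge0}$ on $L^2(m)$ that is symmetric: $(P_tf,g)=(f,P_tg)$ for all $f,g\in L^2(m)$. For $t>0$, $\mathscr D(P_t^{-1})$ is the set of $g\in L^2(m)$ for which there is $f\in L^2(m)$ with $P_tf=g$; such $f$ is unique and $P_t^{-1}g:=f$. For $\alpha>0$ and $s\ge 0$, $\mathcal J^\alpha_s$ is the bounded operator on $L^2(m)$ given by the Bochner integral $$\mathcal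 J^{\alpha}_s f=\int_0^\infty J_0(2\sqrt{sr})\,e^{-\alpha r}P_rf\,dr,$$ where $J_0$ is the Bessel function of the first kind of order $0$.
   Formalization: The Bochner integral over [0,∞) in the formula for P_t^{-1}g is read as the L²(m)-limit as N→∞ of Bochner integrals over [0,N], because the integrand need not be absolutely (Bochner) integrable on [0,∞) for every g in the domain of P_t^{-1}. *)

(* Defs.v *)
From HB Require Import structures.
From mathcomp Require Import all_boot all_order all_algebra.
From mathcomp Require Import generic_quotient ring_quotient.
From mathcomp Require Import all_classical all_reals all_analysis.
From mathcomp Require Import measurable_realfun.

Set Implicit Arguments.
Unset Strict Implicit.
Unset Printing Implicit Defensive.

Import Order.TTheory GRing.Theory Num.Theory.
Import numFieldNormedType.Exports.

Local Open Scope classical_set_scope.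
Local Open Scope ring_scope.

Section L2_space.
Context d (T : measurableType d) (R : realType).
Variable mu : {measure set T -> \bar R}.

Local Notation Lf := (LfunType mu (lee1n 2)).

Definition ae_null : {pred Lf} := fun f => `[< (f : T -> R) = cst 0 %[ae mu] >].

Lemma ae_nullP (f : Lf) :
  reflect ((f : T -> R) = cst 0 %[ae mu]) (f \in ae_null).
Proof. exact: asboolP. Qed.

Lemma ae_null_zmod_closed : zmod_closed ae_null.
Proof.
split; first by apply/ae_nullP/aeW.
move=> f g /ae_nullP f0 /ae_nullP g0; apply/ae_nullP.
apply: filterS2 f0 g0 => x /= f0 g0 Dx.
have /= -> : (f - g) x = f x - g x by [].
by rewrite f0// g0//= subrr.
Qed.

HB.instance Definition _ := GRing.isZmodClosed.Build Lf ae_null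
  ae_null_zmod_closed.

Lemma ae_nullZ a (f : Lf) : f \in ae_null -> a *: f \in ae_null.
Proof.
move=> /ae_nullP f0; apply/ae_nullP; apply: filterS f0 => x /= f0 Dx.
have /= -> : (a *: f) x = a * f x by [].
by rewrite f0//= mulr0.
Qed.

Definition L2 := Quotient.quot ae_null.

HB.instance Definition _ := GRing.Zmodule.on L2.
HB.instance Definition _ := ZmodQuotient.on L2.

Definition toL2 (f : Lf) : L2 := (\pi_L2 f)%qT.

Definition L2_fun (f : L2) : T -> R := (repr f : Lf).

Lemma toL2_eq (f g : Lf) : (f - g \in ae_null) = (toL2 f == toL2 g).
Proof. by rewrite Quotient.idealrBE. Qed.

Lemma toL2_surj (u : L2) : exists f, u = toL2 f.
Proof. by exists (repr u); rewrite /toL2 reprK. Qed.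

Lemma toL2D (f g : Lf) : toL2 (f + g) = toL2 f + toL2 g.
Proof. exact: Quotient.pi_add. Qed.

Lemma toL2_0 : toL2 0 = 0.
Proof. by rewrite /toL2 piE. Qed.

Definition L2_scale (a : R) (u : L2) : L2 := toL2 (a *: (repr u : Lf)).

Lemma toL2Z a (f : Lf) : toL2 (a *: f) = L2_scale a (toL2 f).
Proof.
apply/eqP; rewrite -toL2_eq -scalerBr; apply: ae_nullZ.
by rewrite toL2_eq /toL2 reprK.
Qed.

Lemma L2_scalerA a b (u : L2) : L2_scale a (L2_scale b u) = L2_scale (a * b) u.
Proof. by have [f ->] := toL2_surj u; rewrite -!toL2Z scalerA. Qed.

Lemma L2_scale1r : left_id 1 L2_scale.
Proof. by move=> u; have [f ->] := toL2_surj u; rewrite -!toL2Z scale1r. Qed.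

Lemma L2_scalerDr : right_distributive L2_scale +%R.
Proof.
move=> a u v; have [f ->] := toL2_surj u; have [g ->] := toL2_surj v.
by rewrite -toL2D -!toL2Z scalerDr toL2D.
Qed.

Lemma L2_scalerDl (u : L2) : {morph L2_scale^~ u : a b / a + b}.
Proof.
by move=> a b /=; have [f ->] := toL2_surj u; rewrite -!toL2Z scalerDl toL2D.
Qed.

HB.instance Definition _ := GRing.Zmodule_isLmodule.Build R L2
  L2_scalerA L2_scale1r L2_scalerDr L2_scalerDl.

Local Notation nm f := (fine ('N[mu]_2[EFin \o f]%E)).

Definition L2_norm (u : L2) : R := nm (L2_fun u).

Lemma ae_null_Lnorm0 (f : Lf) : f \in ae_null -> nm f = 0.
Proof.
move=> /ae_nullP f0; rewrite unlock /Lnorm.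
have -> : (\int[mu]_x (`|(EFin \o f) x| `^ 2) = 0)%E.
  transitivity (\int[mu]_(x in setT) (cst 0%E x))%E; last exact: integral0.
  apply: ae_eq_integral => //.
    have mf : measurable_fun setT (fun x => `|f x|) by exact: measurableT_comp.
    apply/measurable_EFinP.
    apply: (@measurableT_comp _ _ _ _ _ _ (fun x : R => x `^ 2)) mf.
    exact: measurable_powR.
  by apply: filterS f0 => x /= -> // _; rewrite normr0 powR0.
by rewrite poweR0r// invr_neq0.
Qed.

Lemma L2_norm_toL2 (f : Lf) : L2_norm (toL2 f) = nm f.
Proof.
have le_nm (h k : Lf) : h - k \in ae_null -> nm h <= nm k.
  move=> hk; have -> : h = (h - k) + k by rewrite subrK.
  by apply: (le_trans (ler_LnormD _ _)); rewrite (ae_null_Lnorm0 hk) add0r.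
by apply/eqP; rewrite eq_le !le_nm// toL2_eq /toL2 reprK.
Qed.

Lemma L2_ler_normD (u v : L2) : L2_norm (u + v) <= L2_norm u + L2_norm v.
Proof.
have [f ->] := toL2_surj u; have [g ->] := toL2_surj v.
by rewrite -toL2D !L2_norm_toL2; exact: ler_LnormD.
Qed.

Lemma L2_normrZ a (u : L2) : L2_norm (a *: u) = `|a| * L2_norm u.
Proof.
have [f ->] := toL2_surj u.
rewrite -[_ *: toL2 f]/(L2_scale _ _) -toL2Z !L2_norm_toL2.
by apply/EFin_inj; rewrite EFinM !finite_norm_fine LnormZ.
Qed.

Lemma L2_normr0_eq0 (u : L2) : L2_norm u = 0 -> u = 0.
Proof.
have [f ->] := toL2_surj u; rewrite L2_norm_toL2 => /fine_Lnormr_eq0 f0.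
by rewrite -toL2_0; apply/eqP; rewrite -toL2_eq subr0; apply/ae_nullP.
Qed.

HB.instance Definition _ := Lmodule_isNormed.Build R L2
  L2_ler_normD L2_normrZ L2_normr0_eq0.

Definition L2_inner (u v : L2) : R := \int[mu]_x (L2_fun u x * L2_fun v x).

End L2_space.

Section bochner_integral.
Context d (T : measurableType d) (R : realType) (V : normedModType R).
Variable mu : {measure set T -> \bar R}.
Implicit Types (D : set T) (f s : T -> V).

Definition bochner_simple D s : Prop :=
  finite_set (s @` D) /\
  forall v, measurable (D `&` s @^-1` [set v]) /\
    (v != 0 -> (mu (D `&` s @^-1` [set v]) < +oo)%E).

Definition bochner_simple_integral D s : V :=
  \sum_(v \in s @` D) fine (mu (D `&` s @^-1` [set v])) *: v.

Definition is_bochner_integral D f (v : V) : Prop :=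
  exists s : nat -> T -> V,
    [/\ forall n, bochner_simple D (s n),
        {ae mu, forall x, D x -> s n x @[n --> \oo] --> f x},
        (\int[mu]_(x in D) `|f x - s n x|%:E @[n --> \oo] --> 0)%E &
        bochner_simple_integral D (s n) @[n --> \oo] --> v].

Definition bochner_integrable D f : Prop := exists v, is_bochner_integral D f v.

(* junk value 0 if f is not integrable on D *)
Definition bochner_integral D f : V := xget 0 (is_bochner_integral D f).

End bochner_integral.

Section improper_bochner_integral.
Context (R : realType) (V : normedModType R).
Implicit Type f : R -> V.

Local Notation leb := (@lebesgue_measure R).

(* The integral over [0, oo[ as the norm limit of the Bochner integrals over
   [0, N]. This is weaker than Bochner integrability on [0, oo[, which requires
   `|f| to be integrable there. *)
Definition improper_bochner_integrable f : Prop :=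
  (forall N : R, 0 <= N -> bochner_integrable leb `[0, N]%classic f) /\
  cvg (bochner_integral leb `[0, N]%classic f @[N --> +oo]).

Definition improper_bochner_integral f : V :=
  lim (bochner_integral leb `[0, N]%classic f @[N --> +oo]).

End improper_bochner_integral.

Section bessel.
Variable R : realType.

Definition bessel_J0 (x : R) : R :=
  limn (series (fun k => (-1) ^+ k / (k`!%:R) ^+ 2 * (x / 2) ^+ (2 * k))).

Definition bessel_I0 (x : R) : R :=
  limn (series (fun k => 1 / (k`!%:R) ^+ 2 * (x / 2) ^+ (2 * k))).

End bessel.

Section semigroup.
Context d (T : measurableType d) (R : realType).
Variable m : {measure set T -> \bar R}.
Variable P : R -> L2 m -> L2 m.

(* Only the operators P t with 0 <= t are meaningful. *)
Record symmetric_submarkov_semigroup : Prop := {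
  sg_linear : forall t, 0 <= t -> linear (P t) ;
  sg_bounded : forall t, 0 <= t -> continuous (P t) ;
  sg_id : P 0 = id ;
  sg_add : forall s t, 0 <= s -> 0 <= t -> P (s + t) = P s \o P t ;
  sg_strongly_continuous : forall f, P t f @[t --> 0^'+] --> f ;
  sg_submarkov : forall t f, 0 <= t ->
    {ae m, forall x, 0 <= L2_fun f x <= 1} ->
    {ae m, forall x, 0 <= L2_fun (P t f) x <= 1} ;
  sg_symmetric : forall t f g, 0 <= t ->
    L2_inner (P t f) g = L2_inner f (P t g)
}.

Definition inv_domain (t : R) : set (L2 m) := range (P t).

Definition inv_semigroup (t : R) (g : L2 m) : L2 m :=
  xget 0 [set f | P t f = g].

Definition calJ (alpha s : R) (f : L2 m) : L2 m :=
  bochner_integral (@lebesgue_measure R) `[0, +oo[%classic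
    (fun r => (bessel_J0 (2 * Num.sqrt (s * r)) * expR (- (alpha * r))) *: P r f).

End semigroup.

#[short(type="pmetricType")]
HB.structure Definition PointedMetric (K : numDomainType) :=
  { M of Metric K M & Pointed M }.

Notation borel E := (g_sigma_algebraType (@open E)).

Definition separable (E : topologicalType) : Prop :=
  exists2 D : set E, countable D & dense D.

Definition full_support (R : realType) (E : ptopologicalType)
    (m : {measure set (borel E) -> \bar R}) : Prop :=
  forall U : set E, open U -> U !=set0 -> (0 < m U)%E.

Definition separable_measure d (T : measurableType d) (R : realType)
    (mu : {measure set T -> \bar R}) : Prop :=
  exists2 C : set (set T), countable C /\ C `<=` measurable &
    forall (A : set T) (e : R), measurable A -> (mu A < +oo)%E -> 0 < e ->
      exists2 B, C B & (mu ((A `\` B) `|` (B `\` A)) < e%:E)%E.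

Section right_process.
Context (R : realType) (E : pmetricType R) dO (Om : measurableType dO).

(* The cemetery is the point None at infinity. Its neighbourhoods play no role
   below, because None is absorbing. *)
Local Notation state := (one_point_compactification E).

Variable X : R -> Om -> state.
Variable theta : R -> Om -> Om.
Variable Pr : state -> probability Om R.

Definition visits (s : R) (B : set (borel E)) : set Om := X s @^-1` (Some @` B).

Definition natural_filtration (t : R) : set (set Om) :=
  <<s [set A | exists s B, [/\ 0 <= s <= t, measurable B & A = visits s B]] >>.

(* stopping times of the right-continuous filtration (F_{t+})_t; before tau is
   the sigma-algebra F_{tau+} *)
Definition optional_time (tau : Om -> \bar R) : Prop :=
  (forall w, (0 <= tau w)%E) /\
  forall t, 0 < t -> natural_filtration t [set w | (tau w < t%:E)%E].

Definition before (tau : Om -> \bar R) (A : set Om) : Prop :=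
  measurable A /\
  forall t, 0 < t -> natural_filtration t (A `&` [set w | (tau w < t%:E)%E]).

Definition finite_before (tau : Om -> \bar R) (A : set Om) : set Om :=
  A `&` [set w | (tau w < +oo)%E].

Record borel_right_process : Prop := {
  rp_measurable : forall t B, 0 <= t -> measurable B -> measurable (visits t B) ;
  rp_right_continuous : forall w t, 0 <= t -> X s w @[s --> t^'+] --> X t w ;
  rp_absorbing : forall w s t, 0 <= s <= t -> X s w = None -> X t w = None ;
  rp_shift : forall s t w, 0 <= s -> 0 <= t -> X s (theta t w) = X (t + s) w ;
  rp_normal : forall x, Pr x [set w | X 0 w = x] = 1%E ;
  rp_borel : forall t A, 0 <= t -> natural_filtration t A ->
    measurable_fun setT (fun x : borel E => Pr (Some x) A) ;
  rp_strong_markov : forall x tau A s B,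
    optional_time tau -> before tau A -> 0 <= s -> measurable B ->
    Pr x (finite_before tau A `&` [set w | visits (fine (tau w) + s) B w]) =
    (\int[Pr x]_(w in finite_before tau A)
       Pr (X (fine (tau w)) w) (visits s B))%E
}.

(* Functions on E are extended by 0 to the cemetery. *)
Definition transition (t : R) (f : E -> R) (x : E) : R :=
  \int[Pr (Some x)]_w oapp f 0 (X t w).

Definition extends_transition (m : {measure set (borel E) -> \bar R})
    (P : R -> L2 m -> L2 m) : Prop :=
  forall t (f : LfunType m (lee1n 2)), 0 <= t ->
    (exists M, forall x, `|f x| <= M) ->
    L2_fun (P t (toL2 f)) = transition t f %[ae m].

End right_process.

(* Main.v *)
(* Put Q_r = exp(- alpha r) P_r, A = int_0^oo Q_r dr and H(z) = sum_k z^k / k!^2, so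
   that I_0(2 sqrt z) = H(z) and J_0(2 sqrt z) = H(- z). Riemann's method for the
   equation u_sr = u, with u(s, r) = (A exp(- sA) Q_r f, w) and the kernels
   H((s - S) r), gives J^alpha_s = A exp(- sA). With the kernel H(s r), it shows that
   W_S(c) = int_0^S H(c s) J^alpha_s ds satisfies W_S(c) Q_c f = f - T_S f, where the
   operators T_S are nonnegative, nonincreasing in S, and (T_S A f, f) = O(1/S). As the
   range of A is dense, T_S -> 0 strongly: this is the inversion formula.

   If g = Q_t f, then (W_S(2t) g, g) = (W_S(2t) Q_2t f, f) <= |f|^2. Conversely
   |Q_t (W_S(2t) - W_s(2t)) g|^2 <= ((W_S(2t) - W_s(2t)) g, g), so that Q_t W_S(2t) g
   is Cauchy in S as soon as (W_S(2t) g, g) is bounded; its limit f satisfies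
   Q_t f = lim W_S(2t) Q_2t g = g.

   Contractivity of P_t in L^2 is not among the hypotheses: it follows from symmetry
   by iterating the Cauchy-Schwarz inequality on f = k (v - w) with v, w integrable and
   [0, 1]-valued, for which the sub-Markov property bounds (P_s f, f) uniformly in s. *)

From HB Require Import structures.
Require Import Defs.
From mathcomp Require Import all_boot all_order all_algebra finmap.
From mathcomp Require Import all_classical all_reals all_analysis.
From mathcomp Require Import measurable_realfun ring lra.

Set Implicit Arguments.
Unset Strict Implicit.
Unset Printing Implicit Defensive.

Import Order.TTheory GRing.Theory Num.Theory.
Import numFieldNormedType.Exports.

Local Open Scope classical_set_scope.
Local Open Scope ring_scope.

(** * Entire series and Bessel functions *)

(** In spectral terms Q_r is exp(- x r) with x >= alpha, A is 1/x and J^alpha_s is exp(- s/x)/x.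
    Since int_0^oo H(cs) exp(- ps) ds = exp(c/p)/p, the integral of H(cs) J^alpha_s over [0, oo[ has
    symbol exp(c x), the inverse of Q_c; as (Q_2t^-1 g, g) = |Q_t^-1 g|^2, the criterion has 2t
    where the inversion formula has t. The symbol of T_S is the tail beyond S of the probability
    density H(cs) exp(- s/x - c x)/x, whose mean x + c x^2 explains the rate 1/S on the range of A.
    No functional calculus is used: symbols become real functions (T f, w), and order relations
    between operators become inequalities of semidefinite forms. Two obstacles shape the proof. J_0
    oscillates, so that J^alpha_s is seen to be positive only once it is identified with A exp(-
    sA); and Q_c^-1 is unbounded, so that only the bounded W_S(c) are manipulated. The shift alpha >
    0 makes A bounded and leaves an exponential decay that absorbs the growth of the kernels in
    r. *)

Section entire_series.
Variable R : realType.
Implicit Types (c : R^nat) (x C K : R).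

(** An explicit majorant of exponential type: it is stable under termwise differentiation, and the
    same [C] and [K] bound the sum by C exp(K |x|). *)
Definition entire_coeffs c : Prop :=
  exists C K, [/\ 0 <= C, 0 <= K & forall k, `|c k| <= C * (K ^+ k / k`!%:R)].

Definition psum c x : R := limn (pseries c x).

Lemma entire_coeffs_diffs c : entire_coeffs c -> entire_coeffs (pseries_diffs c).
Proof.
move=> [C [K [C0 K0 cK]]]; exists (C * K), K; split => //; first exact: mulr_ge0.
move=> k; rewrite /pseries_diffs normrM normr_nat.
apply: (le_trans (ler_wpM2l _ (cK k.+1))) => //.
rewrite le_eqVlt; apply/orP; left; apply/eqP.
rewrite factS natrM exprS; field.
by rewrite nat1r !pnatr_eq0 -lt0n fact_gt0.
Qed.

Lemma entire_normed_cvg c x : entire_coeffs c ->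
  cvgn [normed series (fun k => c k * x ^+ k)].
Proof.
move=> [C [K [C0 K0 cK]]].
have h : cvgn (series (C *: exp_coeff (K * `|x|))).
  exact/is_cvg_seriesZ/is_cvg_series_exp_coeff.
apply: series_le_cvg h => n //=.
  by rewrite mulr_ge0// mulr_ge0 ?invr_ge0// exprn_ge0// mulr_ge0.
rewrite normrM normrX.
apply: (le_trans (ler_wpM2r _ (cK n))); first by rewrite exprn_ge0.
by rewrite /GRing.scale /= /exp_coeff /= exprMn -!mulrA [_^-1 * _]mulrC.
Qed.

Lemma entire_cvg c x : entire_coeffs c -> cvgn (pseries c x).
Proof. by move=> /entire_normed_cvg h; apply: normed_cvg; apply: h. Qed.

Lemma is_derive_psum c x : entire_coeffs c ->
  is_derive x 1 (psum c) (psum (pseries_diffs c) x).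
Proof.
move=> ec; have ed := entire_coeffs_diffs ec.
(* Any radius beyond |x| serves, since the series converge everywhere. *)
apply: (@pseries_snd_diffs _ c (`|x| + 1)).
- exact: entire_cvg.
- exact: entire_cvg.
- exact/entire_cvg/entire_coeffs_diffs.
- by rewrite [ `|_ + 1|]ger0_norm ?addr_ge0// ltrDl.
Qed.

Lemma continuous_psum c : entire_coeffs c -> continuous (psum c).
Proof.
move=> ec x; apply: differentiable_continuous; apply/derivable1_diffP.
exact: (@ex_derive _ _ _ _ _ _ _ (is_derive_psum x ec)).
Qed.

Lemma psum_ge0 c x : entire_coeffs c -> (forall k, 0 <= c k) -> 0 <= x ->
  0 <= psum c x.
Proof.
move=> ec c0 x0; apply: limr_ge; first exact: entire_cvg.
by apply: nearW => n; apply: sumr_ge0 => k _; rewrite mulr_ge0 ?exprn_ge0.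
Qed.

Lemma norm_psum_le_expR c x C K : 0 <= C -> 0 <= K ->
  (forall k, `|c k| <= C * (K ^+ k / k`!%:R)) ->
  `|psum c x| <= C * expR (K * `|x|).
Proof.
move=> C0 K0 cK; have ec : entire_coeffs c by exists C, K.
have cn := @entire_normed_cvg c x ec.
have ce := is_cvg_series_exp_coeff (K * `|x|).
apply: (le_trans (@lim_series_norm _ R^o _ cn)).
rewrite /expR -[leRHS](lim_seriesZ C ce).
apply: lim_series_le => //=; first exact: is_cvg_seriesZ.
move=> n; rewrite normrM normrX.
apply: (le_trans (ler_wpM2r _ (cK n))); first by rewrite exprn_ge0.
by rewrite /GRing.scale /= /exp_coeff /= exprMn -!mulrA [_^-1 * _]mulrC.
Qed.

Lemma psum0 c : psum c 0 = c 0%N.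
Proof.
apply/cvg_lim => //; apply: cvg_near_cst; exists 1%N => // -[//|n] _ /=.
rewrite /pseries /series/= big_nat_recl//= expr0 mulr1 big1 ?addr0// => i _.
by rewrite expr0n mulr0.
Qed.

End entire_series.

(** * The Bessel series H and its derivative *)

Section bessel_series.
Variable R : realType.
Implicit Types x y z : R.

Definition bessel_coeff (k : nat) : R := (k`!%:R ^+ 2)^-1.

(* Locked, as unification would otherwise unfold these series. *)
Fact besselH_key : unit. Proof. exact: tt. Qed.
Definition besselH : R -> R := locked_with besselH_key (psum bessel_coeff).
Definition besselH1 : R -> R :=
  locked_with besselH_key (psum (pseries_diffs bessel_coeff)).

Lemma besselHE : besselH = psum bessel_coeff.
Proof. by rewrite /besselH locked_withE. Qed.

Lemma besselH1E : besselH1 = psum (pseries_diffs bessel_coeff).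
Proof. by rewrite /besselH1 locked_withE. Qed.

Lemma bessel_coeff_ge0 k : 0 <= bessel_coeff k.
Proof. by rewrite invr_ge0 exprn_ge0. Qed.

Lemma bessel_coeff_diffs k :
  pseries_diffs bessel_coeff k = (k`!%:R * k.+1`!%:R)^-1.
Proof.
rewrite /pseries_diffs /bessel_coeff factS natrM; field.
by rewrite nat1r !pnatr_eq0 -lt0n fact_gt0.
Qed.

Lemma bessel_coeff_diffs_ge0 k : 0 <= pseries_diffs bessel_coeff k.
Proof. by rewrite bessel_coeff_diffs invr_ge0 mulr_ge0. Qed.

Lemma bessel_coeff_diffs_le k : pseries_diffs bessel_coeff k <= bessel_coeff k.
Proof.
rewrite bessel_coeff_diffs /bessel_coeff lef_pV2 ?posrE; last 2 first.
- by rewrite mulr_gt0// ltr0n fact_gt0.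
- by rewrite exprn_gt0// ltr0n fact_gt0.
rewrite expr2 ler_wpM2l// ler_nat.
by rewrite factS leq_pmull.
Qed.

Lemma entire_bessel_coeff : entire_coeffs bessel_coeff.
Proof.
exists 1, 1; split => // k; rewrite expr1n mul1r ger0_norm ?bessel_coeff_ge0//.
rewrite mul1r lef_pV2 ?posrE ?exprn_gt0 ?ltr0n ?fact_gt0//.
by rewrite -natrX ler_nat expnS leq_pmulr// expn_gt0 fact_gt0.
Qed.

Lemma besselH_ge0 z : 0 <= z -> 0 <= besselH z.
Proof.
by move=> z0; rewrite besselHE; apply: psum_ge0 => //; [exact: entire_bessel_coeff|exact: bessel_coeff_ge0].
Qed.

Lemma besselH1_ge0 z : 0 <= z -> 0 <= besselH1 z.
Proof.
move=> z0; rewrite besselH1E; apply: psum_ge0 => //; last exact: bessel_coeff_diffs_ge0.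
exact/entire_coeffs_diffs/entire_bessel_coeff.
Qed.

Lemma besselH0 : besselH 0 = 1.
Proof. by rewrite besselHE psum0 /bessel_coeff fact0 expr1n invr1. Qed.

Lemma is_derive_besselH z : is_derive z 1 besselH (besselH1 z).
Proof. by rewrite besselHE besselH1E; exact/is_derive_psum/entire_bessel_coeff. Qed.

Lemma continuous_besselH : continuous besselH.
Proof. by rewrite besselHE; exact/continuous_psum/entire_bessel_coeff. Qed.

Lemma continuous_besselH1 : continuous besselH1.
Proof.
by rewrite besselH1E; exact/continuous_psum/entire_coeffs_diffs/entire_bessel_coeff.
Qed.

(* The modified Bessel equation of order 0 in the variable z = x^2/4:
   (z H')' = H. *)
Lemma is_derive_mulr_besselH1 z :
  is_derive z 1 (fun x => x * besselH1 x) (besselH z).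
Proof.
(* The coefficients of z H'(z); termwise differentiation multiplies by k + 1 once more and returns
   those of H. *)
pose d (k : nat) : R := k%:R * bessel_coeff k.
have dd : pseries_diffs d = bessel_coeff.
  apply/funext => k; rewrite /pseries_diffs /d /bessel_coeff factS natrM; field.
  by rewrite nat1r !pnatr_eq0 -lt0n fact_gt0.
have ed : entire_coeffs d.
  (* The majorant 2^k / k! comes from k / k! <= 2^k. *)
  exists 1, 2; split => // k; rewrite mul1r ger0_norm ?mulr_ge0 ?bessel_coeff_ge0//.
  rewrite /d /bessel_coeff expr2 invfM mulrA ler_pM// ?mulr_ge0//.
    rewrite ler_pdivrMr ?ltr0n ?fact_gt0// -natrX -natrM ler_nat.
    apply: (@leq_trans (2 ^ k)%N); first exact/ltnW/ltn_expl.
    by rewrite leq_pmulr// fact_gt0.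
have e1 := entire_coeffs_diffs entire_bessel_coeff.
have -> : (fun x => x * besselH1 x) = psum d.
  apply/funext => x; rewrite besselH1E /psum.
  apply/esym/cvg_lim => //; rewrite -(cvg_shiftS _) /=.
  have -> : (fun n => pseries d x n.+1) =
      (fun n => x *: pseries (pseries_diffs bessel_coeff) x n).
    apply/funext => n; rewrite /pseries /series /= big_nat_recl//= {1}/d mul0r mul0r add0r.
    rewrite scaler_sumr; apply: eq_bigr => i _.
    by rewrite /d /pseries_diffs exprS /GRing.scale/= mulrCA.
  by apply: cvgZl_tmp; exact: entire_cvg.
by rewrite besselHE -dd; exact: is_derive_psum.
Qed.

(** Termwise, (xy)^k / k!^2 = (x^k / k!) (y^k / k!) with y^k / k! <= exp y. Splitting sr as (s / b)
    (b r) bounds the kernels by exp(s / b) exp(b r): growth in r at any chosen rate b > 0, to be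
    absorbed by the decay of the semigroup. *)
Lemma norm_psum_le c x y z : (forall k, `|c k| <= bessel_coeff k) ->
  0 <= x -> 0 <= y -> `|z| <= x * y -> `|psum c z| <= expR x * expR y.
Proof.
move=> cb x0 y0 zxy.
have ec : entire_coeffs c.
  have [C [K [C0 K0 h]]] := entire_bessel_coeff.
  exists C, K; split => // k; apply: (le_trans (cb k)).
  by apply: (le_trans _ (h k)); exact: ler_norm.
have cn := @entire_normed_cvg _ c z ec.
apply: (le_trans (@lim_series_norm _ R^o _ cn)).
have ce : cvgn (series (expR y *: exp_coeff x)).
  exact/is_cvg_seriesZ/is_cvg_series_exp_coeff.
have -> : expR x * expR y = limn (series (expR y *: exp_coeff x)).
  rewrite lim_seriesZ; last exact: is_cvg_series_exp_coeff.
  by rewrite mulrC.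
apply: lim_series_le => //= k.
rewrite normrM normrX.
apply: (@le_trans _ _ (bessel_coeff k * (x * y) ^+ k)).
  by rewrite ler_pM// ?exprn_ge0// lerXn2r// nnegrE mulr_ge0.
rewrite /bessel_coeff exprMn /exp_coeff /GRing.scale /= expr2 invfM.
have -> : (k`!%:R)^-1 / k`!%:R * (x ^+ k * y ^+ k) =
  (y ^+ k / k`!%:R) * (x ^+ k / k`!%:R) by ring.
rewrite ler_wpM2r//; first by rewrite mulr_ge0 ?exprn_ge0 ?invr_ge0.
case: k => [|k]; first by rewrite expr0 fact0 divr1 -[leLHS]expR0 ler_expR.
by apply: (le_trans _ (expR_ge1Dxn k y0)); rewrite lerDr.
Qed.

Lemma norm_besselH_le x y z : 0 <= x -> 0 <= y -> `|z| <= x * y ->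
  `|besselH z| <= expR x * expR y.
Proof.
by rewrite besselHE; apply: norm_psum_le => k; rewrite ger0_norm ?bessel_coeff_ge0.
Qed.

Lemma norm_besselH1_le x y z : 0 <= x -> 0 <= y -> `|z| <= x * y ->
  `|besselH1 z| <= expR x * expR y.
Proof.
rewrite besselH1E; apply: norm_psum_le => k.
by rewrite ger0_norm ?bessel_coeff_diffs_ge0 ?bessel_coeff_diffs_le.
Qed.

End bessel_series.

(** * Integrals of continuous functions *)

Section continuous_integrals.
Variable R : realType.
Local Notation leb := (@lebesgue_measure R).
Implicit Types (f g F : R -> R) (a b c x s r C S : R).

Lemma is_derive_continuous f (l x : R) : is_derive x 1 f l -> {for x, continuous f}.
Proof.
by move=> h; apply/differentiable_continuous/derivable1_diffP/ex_derive.
Qed.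

Lemma continuous_integrable f a b : continuous f -> leb.-integrable `[a, b] (EFin \o f).
Proof.
move=> cf; apply: continuous_compact_integrable; first exact: segment_compact.
exact: continuous_subspaceT.
Qed.

Lemma Rint_FTC2_within F f a b : a <= b -> continuous f ->
  {within `[a, b], continuous F} ->
  (forall x, a < x < b -> is_derive x 1 F (f x)) ->
  \int[leb]_(x in `[a, b]) f x = F b - F a.
Proof.
rewrite le_eqVlt => /predU1P[<- _ _ _|ab cf cF dF].
  by rewrite set_itv1 Rintegral_set1 subrr.
rewrite /Rintegral (@continuous_FTC2 _ f F)//.
- exact: continuous_subspaceT.
- have [_ c1 c2] := (continuous_within_itvP F ab).1 cF.
  by split => // x /[!in_itv]/= /dF /@ex_derive.
- move=> x /[!in_itv]/= /dF h; rewrite derive1E; exact: derive_val.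
Qed.

Lemma Rint_FTC2 F f a b : a <= b -> continuous f -> continuous F ->
  (forall x, a < x < b -> is_derive x 1 F (f x)) ->
  \int[leb]_(x in `[a, b]) f x = F b - F a.
Proof.
by move=> ab cf cF; apply: Rint_FTC2_within => //; exact: continuous_subspaceT.
Qed.

Lemma le_Rint f g a b : continuous f -> continuous g ->
  (forall x, a <= x <= b -> f x <= g x) ->
  \int[leb]_(x in `[a, b]) f x <= \int[leb]_(x in `[a, b]) g x.
Proof.
by move=> cf cg fg; apply: le_Rintegral => //; exact: continuous_integrable.
Qed.

Lemma RintD f g a b : continuous f -> continuous g ->
  \int[leb]_(x in `[a, b]) (f x + g x) =
  \int[leb]_(x in `[a, b]) f x + \int[leb]_(x in `[a, b]) g x.
Proof. by move=> cf cg; apply: RintegralD => //; exact: continuous_integrable. Qed.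

Lemma RintZ f c a b : continuous f ->
  \int[leb]_(x in `[a, b]) (c * f x) = c * \int[leb]_(x in `[a, b]) f x.
Proof. by move=> cf; apply: RintegralZl => //; exact: continuous_integrable. Qed.

Lemma Rint_ge0 f a b : (forall x, a <= x <= b -> 0 <= f x) ->
  0 <= \int[leb]_(x in `[a, b]) f x.
Proof.
by move=> f0; apply: Rintegral_ge0 => x /=; rewrite in_itv/= => /f0.
Qed.

Lemma norm_Rint_le f C a b : a <= b -> continuous f ->
  (forall x, a <= x <= b -> `|f x| <= C) ->
  `|\int[leb]_(x in `[a, b]) f x| <= C * (b - a).
Proof.
move=> ab cf fC.
apply: (le_trans (le_normr_Rintegral _ (continuous_integrable _ _ cf))) => //.
have -> : C * (b - a) = \int[leb]_(x in `[a, b]) C.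
  have := lebesgue_measure_itv `[a, b].
  rewrite Rintegral_cst//= => ->; rewrite /= lte_fin.
  case: ltP => [//|ba]; have -> : a = b by apply/eqP; rewrite eq_le ab.
  by rewrite subrr.
apply: le_Rint => //; last exact: cst_continuous.
by move=> x; apply: continuous_comp; [exact: cf|exact: norm_continuous].
Qed.

Lemma is_derive_Rint f x : continuous f -> 0 < x ->
  is_derive x 1 (fun y => \int[leb]_(t in `[0, y]) f t) (f x).
Proof.
move=> cf x0.
have [d e] := @continuous_FTC1_closed _ f 0 x (x + 1) (ltr_pwDr ltr01 (lexx x))
  (continuous_integrable _ _ cf) x0 (cf x).
by apply: DeriveDef => //; rewrite -derive1E.
Qed.

Lemma is_derive_Rint_param (F F' : R -> R -> R) c s :
  (forall s r, 0 <= r <= c -> is_derive s 1 (F^~ r) (F' s r)) ->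
  (forall s, continuous (F s)) ->
  (exists C, forall s' r, `|s' - s| < 1 -> 0 <= r <= c -> `|F' s' r| <= C) ->
  is_derive s 1 (fun s => \int[leb]_(r in `[0, c]) F s r)
                (\int[leb]_(r in `[0, c]) F' s r).
Proof.
move=> dF cF [C F'C].
have Is : `]s - 1, s + 1[%classic s.
  by rewrite /= in_itv/=; apply/andP; split; lra.
have near x : `]s - 1, s + 1[%classic x -> `|x - s| < 1.
  by rewrite /= in_itv/= => /andP[h1 h2]; rewrite ltr_norml; apply/andP; split; lra.
have d1E (x y : R) : `[0, c]%classic y -> partial1of2 F x y = F' x y.
  rewrite /= in_itv/= => /(dF x) h.
  by rewrite partial1of2E; exact: derive_val.
have mD : measurable (`[0, c]%classic : set R) by [].
have iF (x : R) : `]s - 1, s + 1[%classic x -> leb.-integrable `[0, c] (EFin \o F x).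
  by move=> _; exact: continuous_integrable.
have dF1 (x y : R) : `]s - 1, s + 1[%classic x -> `[0, c]%classic y -> derivable (F^~ y) x 1.
  by move=> _; rewrite /= in_itv/= => /(dF x) /@ex_derive.
(* The dominating constant must be nonnegative, which [C] need not be when the segment is empty. *)
have iC : leb.-integrable `[0, c] (EFin \o cst (Num.max C 0)).
  exact/continuous_integrable/cst_continuous.
have C0 (y : R) : 0 <= cst (Num.max C 0) y by rewrite /= le_max lexx orbT.
have FC (x y : R) : `]s - 1, s + 1[%classic x -> `[0, c]%classic y ->
    `|partial1of2 F x y| <= cst (Num.max C 0) y.
  move=> /near xs yc; rewrite d1E//= le_max F'C//.
have hd := @derivable_under_integral _ _ _ leb F `[0, c]%classic mD s _ _ Is iF dF1 _ C0 iC FC.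
have he := @differentiation_under_integral _ _ _ leb F `[0, c]%classic mD s _ _ Is iF dF1 _ C0 iC FC.
apply: DeriveDef => //; rewrite -derive1E he.
by apply: eq_Rintegral => y /set_mem yc; rewrite d1E.
Qed.

(* Riemann's method: the equations make u v_s ds + v u_r dr a closed form; it
   is integrated along the boundary of [0, S] x [0, c]. *)
Lemma rectangle_identity (u ur v vs : R -> R -> R) S c :
  0 <= S -> 0 <= c ->
  (forall s r, 0 <= r -> is_derive s 1 (ur^~ r) (u s r)) ->
  (forall s r, 0 <= r -> is_derive s 1 (v^~ r) (vs s r)) ->
  (forall s r, 0 < r -> is_derive r 1 (u s) (ur s r)) ->
  (forall s r, 0 < r -> is_derive r 1 (vs s) (v s r)) ->
  (forall s, [/\ continuous (u s), continuous (ur s), continuous (v s) &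
                 continuous (vs s)]) ->
  (forall r, continuous (u^~ r) /\ continuous (vs^~ r)) ->
  (forall S c, exists C, forall s r, `|s| <= S -> 0 <= r <= c ->
     [/\ `|u s r| <= C, `|ur s r| <= C, `|v s r| <= C & `|vs s r| <= C]) ->
  \int[leb]_(s in `[0, S]) (u s c * vs s c - u s 0 * vs s 0) =
  \int[leb]_(r in `[0, c]) (v S r * ur S r) -
  \int[leb]_(r in `[0, c]) (v 0 r * ur 0 r).
Proof.
move=> S0 c0 dur dv du dvs cont_r cont_s bnd.
have mc f g : continuous f -> continuous g -> continuous (fun x => f x * g x).
  by move=> cf cg x; apply: cvgM; [exact: cf|exact: cg].
(* As u is the s-derivative of u_r and v the r-derivative of v_s, the integrand v_s u_r + v u is the
   r-derivative of u v_s. *)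
have dG s : is_derive s 1 (fun s => \int[leb]_(r in `[0, c]) (v s r * ur s r))
    (u s c * vs s c - u s 0 * vs s 0).
  have [cu cur cv cvs] := cont_r s.
  have <- : \int[leb]_(r in `[0, c]) (vs s r * ur s r + v s r * u s r) =
      u s c * vs s c - u s 0 * vs s 0.
    apply: (@Rint_FTC2 (fun r => u s r * vs s r)) => //.
    - by move=> x; apply: cvgD; apply: mc.
    - exact: mc.
    - move=> r /andP[r0 _].
      have h1 := du s r r0; have h2 := dvs s r r0.
      apply: is_derive_eq; rewrite /GRing.scale /=; ring.
  apply: (@is_derive_Rint_param (fun s r => v s r * ur s r)
     (fun s r => vs s r * ur s r + v s r * u s r)).
  - move=> s' r /andP[r0 _].
    have h1 := dur s' r r0; have h2 := dv s' r r0.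
    apply: is_derive_eq; rewrite /GRing.scale /=; ring.
  - by move=> s'; have [? ? ? ?] := cont_r s'; exact: mc.
  - have [C hC] := bnd (`|s| + 1) c.
    exists (C * C + C * C) => s' r ss' r0c.
    have [||h1 h2 h3 h4] := hC s' r => //.
      rewrite -[s'](subrK s) addrC (le_trans (ler_normD _ _))//.
      by rewrite lerD2l ltW.
    apply: (le_trans (ler_normD _ _)); rewrite !normrM.
    by apply: lerD; apply: ler_pM.
apply: (@Rint_FTC2 (fun s => \int[leb]_(r in `[0, c]) (v s r * ur s r))) => //.
- move=> s; apply: cvgB; apply: mc; by have [] := cont_s c; have [] := cont_s 0.
- by move=> s; exact: is_derive_continuous (dG s).
Qed.

End continuous_integrals.

(** * Semidefinite forms and inner products *)

(** Kept separate from the operation itself, so that (T u, v) is an instance for every positive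
    symmetric operator T; Cauchy-Schwarz for such forms replaces square roots of operators. *)
Record semidefinite_form (R : realType) (V : lmodType R) (b : V -> V -> R) : Prop := {
  formC : forall u v, b u v = b v u ;
  formDl : forall u v w, b (u + v) w = b u w + b v w ;
  formZl : forall a u w, b (a *: u) w = a * b u w ;
  form_ge0 : forall u, 0 <= b u u
}.

Section semidefinite_form_theory.
Context (R : realType) (V : lmodType R) (b : V -> V -> R).
Hypothesis bP : semidefinite_form b.

Lemma formDr u v w : b u (v + w) = b u v + b u w.
Proof. by rewrite (formC bP) (formDl bP) !(formC bP u). Qed.

Lemma formZr a u w : b u (a *: w) = a * b u w.
Proof. by rewrite (formC bP) (formZl bP) !(formC bP u). Qed.

Lemma form0l w : b 0 w = 0.
Proof. by rewrite -(scale0r 0) (formZl bP) mul0r. Qed.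

Lemma formNl u w : b (- u) w = - b u w.
Proof. by rewrite -scaleN1r (formZl bP) mulN1r. Qed.

Lemma formNr u w : b u (- w) = - b u w.
Proof. by rewrite (formC bP) formNl (formC bP). Qed.

Lemma formBl u v w : b (u - v) w = b u w - b v w.
Proof. by rewrite (formDl bP) formNl. Qed.

Lemma formBr u v w : b u (v - w) = b u v - b u w.
Proof. by rewrite formDr formNr. Qed.

Lemma formB_sqr u v : b (u - v) (u - v) = b u u - 2 * b u v + b v v.
Proof. by rewrite formBl !formBr (formC bP v u); ring. Qed.

Lemma form_cauchy_schwarz u v : b u v ^+ 2 <= b u u * b v v.
Proof.
have h (x : R) : 0 <= b u u - 2 * x * b u v + x ^+ 2 * b v v.
  have := form_ge0 bP (u - x *: v).
  by rewrite formB_sqr (formZl bP) !formZr expr2 !mulrA.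
have [v0|v0] := eqVneq (b v v) 0.
  rewrite v0 mulr0.
  have [->|uv0] := eqVneq (b u v) 0; first by rewrite expr0n.
  (* With b v v = 0 the quadratic is affine in x, and this x gives it the value -1. *)
  have := h ((b u u + 1) / (2 * b u v)).
  rewrite v0 mulr0 addr0.
  have -> : b u u - 2 * ((b u u + 1) / (2 * b u v)) * b u v = -1 by field.
  by rewrite lerNr oppr0 ler10.
have vp : 0 < b v v by rewrite lt0r v0 (form_ge0 bP).
have := h (b u v / b v v).
have -> : b u u - 2 * (b u v / b v v) * b u v + (b u v / b v v) ^+ 2 * b v v =
  b u u - b u v ^+ 2 / b v v by field.
by rewrite subr_ge0 ler_pdivrMr.
Qed.

Lemma formD_le u v : b (u + v) (u + v) <= 2 * b u u + 2 * b v v.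
Proof.
have := form_ge0 bP (u - v); rewrite formB_sqr => h.
by rewrite (formDl bP) !formDr (formC bP v u); lra.
Qed.

End semidefinite_form_theory.

(** If y 0 exceeded c > 0, the ratios y n / c would at least square at each step; the lower bound 1
    + n e is enough to make them unbounded. For c = 0 the first inequality already forces y 0 =
    0. *)
Lemma le_of_sqr_doubling (R : realType) (y : R^nat) (c C : R) : 0 <= c ->
  (forall n, y n ^+ 2 <= y n.+1 * c) -> (forall n, y n <= C) -> y 0%N <= c.
Proof.
move=> c0 yc yC; rewrite leNgt; apply/negP => cy.
have [cE|cN] := eqVneq c 0.
  have := yc 0%N; rewrite cE mulr0 => h.
  have : 0 < y 0%N ^+ 2 by rewrite exprn_gt0// -cE.
  by rewrite ltNge h.
have cp : 0 < c by rewrite lt0r cN.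
pose e := y 0%N / c - 1.
have e0 : 0 < e by rewrite subr_gt0 ltr_pdivlMr// mul1r.
have h n : 1 + n%:R * e <= y n / c.
  elim: n => [|n ih]; first by rewrite mul0r addr0 ler_pdivlMr// mul1r ltW.
  have n0 : 0 <= n%:R * e by rewrite mulr_ge0// ltW.
  apply: (@le_trans _ _ ((y n / c) ^+ 2)).
    have e1 : 1 + e <= y n / c.
      case: n ih n0 => [_ _|n ih _]; first by rewrite /e addrC subrK.
      by apply: le_trans ih; rewrite lerD2l ler_peMl ?ler1n// ltW.
    rewrite expr2; apply: (@le_trans _ _ ((1 + n%:R * e) * (1 + e))).
      rewrite -natr1; nra.
    by apply: ler_pM => //; [exact: addr_ge0|rewrite addr_ge0// ltW].
  rewrite exprMn exprVn ler_pdivrMr ?exprn_gt0//.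
  apply: (le_trans (yc n)).
  by have -> : y n.+1 / c * c ^+ 2 = y n.+1 * c by field.
have [k hk] : exists k, C / c < k%:R * e.
  exists (Num.truncn (C / c / e)).+1.
  rewrite -ltr_pdivrMr//; exact: truncnS_gt.
have := h k; apply/negP; rewrite -ltNge.
apply: (@le_lt_trans _ _ (C / c)); first by rewrite ler_pM2r ?invr_gt0.
by apply: (lt_le_trans hk); rewrite lerDr.
Qed.

(* Iterating Cauchy-Schwarz, b (T u) u <= b (T^(2^n) u) u ^ (2^-n) * b u u ^ (1 - 2^-n). *)
Lemma form_contraction (R : realType) (V : lmodType R) (b : V -> V -> R)
    (T : V -> V) (u : V) (C : R) : semidefinite_form b ->
  (forall v w, b (T v) w = b v (T w)) ->
  (forall n, b (iter n T u) u <= C) -> b (T u) u <= b u u.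
Proof.
move=> bP sT bC.
have sTn n v w : b (iter n T v) w = b v (iter n T w).
  by elim: n v w => // n ih v w; rewrite iterSr iterS ih sT.
apply: (@le_of_sqr_doubling R (fun n => b (iter (2 ^ n) T u) u) _ C).
- exact: form_ge0.
- move=> n; apply: (le_trans (form_cauchy_schwarz bP _ _)).
  by rewrite sTn -iterD addnn -mul2n -expnS (formC bP u).
- by move=> n; exact: bC.
Qed.

Record inner_product (R : realType) (V : normedModType R) (ip : V -> V -> R) : Prop := {
  ip_form : semidefinite_form ip ;
  ip_norm : forall u, ip u u = `|u| ^+ 2
}.

Section inner_product_theory.
Context (R : realType) (V : normedModType R) (ip : V -> V -> R).
Hypothesis ipP : inner_product ip.
Let ipF := ip_form ipP.

Lemma norm_ip_le u v : `|ip u v| <= `|u| * `|v|.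
Proof.
rewrite -(@ler_pXn2r _ 2)// ?nnegrE ?mulr_ge0//.
rewrite real_normK ?num_real// exprMn -!(ip_norm ipP).
exact: form_cauchy_schwarz.
Qed.

Lemma ip_le u v : ip u v <= `|u| * `|v|.
Proof. exact: le_trans (ler_norm _) (norm_ip_le _ _). Qed.

Lemma norm_le_weak u C : 0 <= C -> (forall w, ip u w <= C * `|w|) -> `|u| <= C.
Proof.
move=> C0 /(_ u); rewrite (ip_norm ipP) expr2.
have [->|u0] := eqVneq `|u| 0 => //.
by rewrite ler_pM2r// lt0r u0 normr_ge0.
Qed.

Lemma ip_inj u v : (forall w, ip u w = ip v w) -> u = v.
Proof.
move=> h; apply/eqP; rewrite -subr_eq0 -normr_le0; apply: norm_le_weak => // w.
by rewrite (formBl ipF) h subrr mul0r.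
Qed.

Lemma cvg_ip (T : Type) (F : set_system T) {FF : Filter F} (f : T -> V) l w :
  f x @[x --> F] --> l -> ip (f x) w @[x --> F] --> ip l w.
Proof.
move=> fl; apply/cvgrPdist_le => e e0.
have d0 : 0 < e / (`|w| + 1) by rewrite divr_gt0// ltr_wpDl.
move/cvgrPdist_le: fl => /(_ _ d0); apply: filterS => x fx.
rewrite -(formBl ipF) (le_trans (norm_ip_le _ _))//.
apply: (@le_trans _ _ (e / (`|w| + 1) * `|w|)); first by rewrite ler_wpM2r.
by rewrite -mulrA ler_piMr ?(ltW e0)// mulrC ler_pdivrMr ?ltr_wpDl// mul1r lerDl.
Qed.

Lemma continuous_ip (f : R -> V) w : continuous f -> continuous (fun x => ip (f x) w).
Proof. by move=> cf x; apply: cvg_ip; exact: cf. Qed.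

(* Cauchy-Schwarz for the form ip (T u) v. *)
Lemma norm_sqr_le_form (T : V -> V) :
  semidefinite_form (fun u v => ip (T u) v) ->
  (forall u, ip (T u) u <= `|u| ^+ 2) -> forall u, `|T u| ^+ 2 <= ip (T u) u.
Proof.
move=> TP T1 u.
(* With v = T u this reads |T u|^4 <= (T u, u) (T T u, T u) <= (T u, u) |T u|^2. *)
have := form_cauchy_schwarz TP u (T u); rewrite (ip_norm ipP).
have [->|Tu0] := eqVneq `|T u| 0; first by rewrite expr0n/= => _; exact: (form_ge0 TP).
have Tp : 0 < `|T u| ^+ 2 by rewrite exprn_gt0// lt0r Tu0 normr_ge0.
move=> h; rewrite -(ler_pM2r Tp) -expr2; apply: (le_trans h).
by rewrite ler_wpM2l//; exact: (form_ge0 TP).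
Qed.

End inner_product_theory.

Lemma integrable_mulrl d (T : measurableType d) (R : realType)
    (mu : {measure set T -> \bar R}) (D : set T) (k : R) (f : T -> R) :
  measurable D -> mu.-integrable D (EFin \o f) ->
  mu.-integrable D (EFin \o (fun x => k * f x)).
Proof.
move=> mD fi; apply: (eq_integrable mD _ _ _ (integrableZl mD k fi)) => x _ /=.
by rewrite EFinM.
Qed.

(** * Bochner integrals *)

Section bochner_weak.
Context (R : realType) (V : normedModType R) (ip : V -> V -> R).
Hypothesis ipP : inner_product ip.
Let ipF := ip_form ipP.
Context (d : measure_display) (T : measurableType d).
Variable mu : {measure set T -> \bar R}.
Variable D : set T.
Hypothesis mD : measurable D.

Let fiber (s : T -> V) v := D `&` s @^-1` [set v].

Lemma bochner_simple_sum (s : T -> V) (phi : V -> R) x :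
  bochner_simple mu D s -> D x ->
  phi (s x) = \sum_(v <- fset_set (s @` D)) phi v * \1_(fiber s v) x.
Proof.
move=> [fs ms] Dx.
have sx : s x \in fset_set (s @` D).
  by rewrite in_fset_set// inE; exists x.
rewrite (bigD1_seq (s x) sx (fset_uniq _))/= indicE mem_set; last by split.
rewrite mulr1 big1 ?addr0// => v vs.
rewrite indicE memNset ?mulr0// => -[_ /= sv].
by rewrite sv eqxx in vs.
Qed.

(** On each of the finitely many fibres of [s] the first argument of [phi] is constant, so that no
    measurable structure on V is involved. *)
Lemma bochner_simple_measurable (s : T -> V) (phi : V -> T -> R) :
  bochner_simple mu D s -> (forall v, measurable_fun D (phi v)) ->
  measurable_fun D (fun x => phi (s x) x).
Proof.
move=> hs mphi.
apply: (@eq_measurable_fun _ _ _ _ _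
  (fun x => \sum_(v <- fset_set (s @` D)) phi v x * \1_(fiber s v) x)).
  move=> x /set_mem Dx.
  by rewrite -(@bochner_simple_sum s (phi^~ x) x hs Dx).
apply: measurable_sum => v; apply: measurable_funM => //.
by apply: measurable_indic; have [_ /(_ v)[]] := hs.
Qed.

Lemma bochner_simple_weak (s : T -> V) w : bochner_simple mu D s ->
  mu.-integrable D (EFin \o (fun x => ip (s x) w)) /\
  ip (bochner_simple_integral mu D s) w = \int[mu]_(x in D) ip (s x) w.
Proof.
move=> hs; have [fs ms] := hs.
have hI v : mu.-integrable D (EFin \o (fun x => ip v w * \1_(fiber s v) x)) /\
    \int[mu]_(x in D) (ip v w * \1_(fiber s v) x) = ip v w * fine (mu (fiber s v)).
  (* The fibre over 0 may have infinite measure; both sides carry the factor (0, w) = 0. *)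
  have [->|v0] := eqVneq v 0.
    rewrite (form0l ipF) mul0r; split.
      apply: (eq_integrable mD (cst 0%E)); last exact: integrable0.
      by move=> x _; rewrite /= mul0r.
    under eq_Rintegral do rewrite mul0r.
    by rewrite Rintegral_cst// mul0r.
  have [mv /(_ v0) fv] := ms v.
  have iv : mu.-integrable D (EFin \o \1_(fiber s v)).
    apply/integrableP; split; first exact/measurable_EFinP/measurable_indic.
    under eq_integral do rewrite /= ger0_norm//.
    by rewrite integral_indic// (le_lt_trans _ fv)// le_measure ?inE//; exact: measurableI.
  split; first exact: integrable_mulrl.
  rewrite RintegralZl//; congr (_ * fine _).
  rewrite integral_indic//; congr (mu _).
  by rewrite /fiber setIC setIA setIid.
have hE x : D x -> ip (s x) w =
    \sum_(v <- fset_set (s @` D)) ip v w * \1_(fiber s v) x.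
  exact: (@bochner_simple_sum s (ip^~ w) x hs).
have hsum (r : seq V) : mu.-integrable D
     (EFin \o (fun x => \sum_(v <- r) ip v w * \1_(fiber s v) x)) /\
   \int[mu]_(x in D) (\sum_(v <- r) ip v w * \1_(fiber s v) x) =
   ip (\sum_(v <- r) fine (mu (fiber s v)) *: v) w.
  elim: r => [|v r [ih1 ih2]].
    rewrite big_nil (form0l ipF); split.
      apply: (eq_integrable mD (cst 0%E)); last exact: integrable0.
      by move=> x _; rewrite /= big_nil.
    under eq_Rintegral do rewrite big_nil.
    by rewrite Rintegral_cst// mul0r.
  have [v1 v2] := hI v; split.
    apply: (eq_integrable mD _ _ _ (integrableD mD v1 ih1)) => x _ /=.
    by rewrite big_cons EFinD.
  under eq_Rintegral do rewrite big_cons.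
  rewrite RintegralD// v2 ih2 big_cons (formDl ipF) (formZl ipF).
  by rewrite [_ * ip v w]mulrC.
have [h1 h2] := hsum (fset_set (s @` D)).
split.
  apply: (eq_integrable mD _ _ _ h1) => x /set_mem Dx /=.
  by rewrite -hE.
rewrite /bochner_simple_integral fsbig_finite//= -h2.
by apply: eq_Rintegral => x /set_mem Dx; rewrite -hE.
Qed.

Section weak_limit.
Variables (f : T -> V) (v : V).
Hypothesis mfB : forall c, measurable_fun D (fun x => `|f x - c|).
Hypothesis mfip : forall w, measurable_fun D (fun x => ip (f x) w).

Let dist (s : T -> V) := (\int[mu]_(x in D) `|f x - s x|%:E)%E.

(** By Cauchy-Schwarz |(s - f, w)| <= |w| |f - s|, which is integrable. Integrability of (f, w)
    follows from that of (s, w), and the bound is linear in |w|, as [norm_le_weak] requires. *)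
Lemma bochner_simple_dist (s : T -> V) w : bochner_simple mu D s ->
  (dist s < +oo)%E ->
  mu.-integrable D (EFin \o (fun x => ip (f x) w)) /\
  `|ip (bochner_simple_integral mu D s) w - \int[mu]_(x in D) ip (f x) w|
    <= fine (dist s) * `|w|.
Proof.
move=> hs ds.
have [i1 e1] := bochner_simple_weak w hs.
have mn : measurable_fun D (fun x => `|f x - s x|).
  exact: (@bochner_simple_measurable s (fun c x => `|f x - c|) hs mfB).
have in' : mu.-integrable D (EFin \o (fun x => `|f x - s x|)).
  apply/integrableP; split; first exact/measurable_EFinP.
  by under eq_integral do rewrite /= normr_id.
have inw : mu.-integrable D (EFin \o (fun x => `|w| * `|f x - s x|)).
  exact: integrable_mulrl.
have mi : measurable_fun D (fun x => ip (s x) w - ip (f x) w).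
  apply: measurable_funB => //.
  by apply: (bochner_simple_measurable (phi := fun c _ => ip c w) hs) => c.
have idf : mu.-integrable D (EFin \o (fun x => ip (s x) w - ip (f x) w)).
  apply: (le_integrable mD _ _ inw); first exact/measurable_EFinP.
  move=> x Dx /=; rewrite lee_fin [leRHS]ger0_norm ?mulr_ge0//.
  by rewrite -(formBl ipF) (le_trans (norm_ip_le ipP _ _))// mulrC distrC.
have i2 : mu.-integrable D (EFin \o (fun x => ip (f x) w)).
  apply: (eq_integrable mD _ _ _ (integrableB mD i1 idf)) => x _ /=.
  by rewrite -EFinB; congr EFin; ring.
split => //; rewrite e1 -RintegralB//.
apply: (le_trans (le_normr_Rintegral mD idf)).
rewrite mulrC -RintegralZl//; apply: le_Rintegral => //.
- apply: (le_integrable mD _ _ idf).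
  + by apply/measurable_EFinP; exact: measurableT_comp.
  + by move=> x _ /=; rewrite lee_fin normr_id.
- move=> x Dx; rewrite -(formBl ipF) (le_trans (norm_ip_le ipP _ _))//.
  by rewrite mulrC distrC.
Qed.

Lemma bochner_integral_weak w : is_bochner_integral mu D f v ->
  mu.-integrable D (EFin \o (fun x => ip (f x) w)) /\
  ip v w = \int[mu]_(x in D) ip (f x) w.
Proof.
move=> [s [hs _ ds sv]].
have dfin : \forall n \near \oo, (dist (s n) < +oo)%E.
  move/fine_cvgP : ds => [h _]; apply: filterS h => n.
  by rewrite fin_numE => /andP[_]; rewrite ltey.
have h : \forall n \near \oo, mu.-integrable D (EFin \o (fun x => ip (f x) w)) /\
  `|ip (bochner_simple_integral mu D (s n)) w - \int[mu]_(x in D) ip (f x) w|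
    <= fine (dist (s n)) * `|w|.
  by apply: filterS dfin => n; exact: bochner_simple_dist.
split; first by have [n _ /(_ n (leqnn _))[]] := h.
have c1 : ip (bochner_simple_integral mu D (s n)) w @[n --> \oo] --> ip v w.
  exact: cvg_ip.
have c2 : ip (bochner_simple_integral mu D (s n)) w @[n --> \oo] -->
    \int[mu]_(x in D) ip (f x) w.
  apply/subr_cvg0; apply: norm_cvg0.
  apply: (@squeeze_cvgr _ _ _ _ (cst 0) (fun n => fine (dist (s n)) * `|w|)).
  - by apply: filterS h => n [_ ->]; rewrite normr_ge0.
  - exact: cvg_cst.
  - have h2 : fine (dist (s n)) @[n --> \oo] --> (0 : R).
      by move/fine_cvgP : ds => [].
    have := cvgM h2 (cvg_cst `|w|); rewrite mul0r; exact.
exact: (cvg_unique _ c1 c2).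
Qed.

End weak_limit.
End bochner_weak.

Lemma cvgn_dist_le (R : realType) (V : completeNormedModType R) (u : V^nat)
    (e : R^nat) N : e n @[n --> \oo] --> 0 ->
  (forall n m, (N <= n)%N -> (N <= m)%N -> `|u m - u n| <= e m + e n) ->
  cvgn u.
Proof.
move=> e0 key; apply/cauchy_cvgP/cauchy_ballP => r r0.
have r2 : 0 < r / 2 by rewrite divr_gt0.
have [M _ hM] : \forall n \near \oo, e n < r / 2 by exact: (cvgr_lt 0 e0).
pose K := maxn N M.
exists (u @` [set n | K <= n]%N, u @` [set n | K <= n]%N).
  by split; exists K => // n /= Nn; exists n.
move=> [x y] [[n /= Nn <-] [m /= Nm <-]].
rewrite -ball_normE /=; move: Nn Nm; rewrite !geq_max => /andP[Nn Mn] /andP[Nm Mm].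
apply: (le_lt_trans (key _ _ Nm Nn)).
have := hM n Mn; have := hM m Mm; rewrite /=; lra.
Qed.

(** * Existence of Bochner integrals of continuous functions *)

Section bochner_exists.
Context (R : realType) (V : completeNormedModType R) (ip : V -> V -> R).
Hypothesis ipP : inner_product ip.
Let ipF := ip_form ipP.

(** Each simple integral is within [e n] of one and the same functional, w |-> int (f, w), so that
    these integrals form a Cauchy sequence. *)
Lemma bochner_integrable_approx d (T : measurableType d)
    (mu : {measure set T -> \bar R}) (D : set T) (f : T -> V) (s : nat -> T -> V) :
  measurable D ->
  (forall c, measurable_fun D (fun x => `|f x - c|)) ->
  (forall w, measurable_fun D (fun x => ip (f x) w)) ->
  (forall n, bochner_simple mu D (s n)) ->
  {ae mu, forall x, D x -> s n x @[n --> \oo] --> f x} ->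
  (\int[mu]_(x in D) `|f x - s n x|%:E @[n --> \oo] --> 0)%E ->
  bochner_integrable mu D f.
Proof.
move=> mD mfB mfip hs sf ds.
suff /cvg_ex[v hv] : cvgn (fun n => bochner_simple_integral mu D (s n)).
  by exists v, s.
pose e n := fine (\int[mu]_(x in D) `|f x - s n x|%:E)%E.
have e0 : e n @[n --> \oo] --> 0 by move/fine_cvgP : ds => [].
have ege n : 0 <= e n by apply/fine_ge0/integral_ge0 => x _; rewrite lee_fin.
have dfin : \forall n \near \oo, (\int[mu]_(x in D) `|f x - s n x|%:E < +oo)%E.
  move/fine_cvgP : ds => [h _]; apply: filterS h => n.
  by rewrite fin_numE => /andP[_]; rewrite ltey.
have [N _ hN] := dfin.
have hw n w : (N <= n)%N ->
  `|ip (bochner_simple_integral mu D (s n)) w - \int[mu]_(x in D) ip (f x) w|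
    <= e n * `|w|.
  by move=> Nn; have [] := bochner_simple_dist ipP mD mfB mfip w (hs n) (hN n Nn).
apply: (cvgn_dist_le (N := N) e0) => n m Nn Nm.
apply: (norm_le_weak ipP) => [|w]; first exact: addr_ge0.
rewrite (formBl ipF) mulrDl.
have := hw n w Nn; have := hw m w Nm.
by rewrite !ler_norml => /andP[a1 a2] /andP[b1 b2]; lra.
Qed.

Local Notation leb := (@lebesgue_measure R).

(** The left-endpoint step function of mesh 1/(n+1), set to 0 from n+1 on, so that it takes finitely
    many values, the nonzero ones on sets of finite measure. *)
Let grid (f : R -> V) (n : nat) (x : R) : V :=
  let k := Num.truncn (x * n.+1%:R) in
  if (k < n.+1 * n.+1)%N then f (k%:R / n.+1%:R) else 0.

Let bochner_simple_grid f n (D : set R) : measurable D ->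
  (forall x, D x -> 0 <= x) -> bochner_simple leb D (grid f n).
Proof.
move=> mD D0.
pose F k : V := if (k < n.+1 * n.+1)%N then f (k%:R / n.+1%:R) else 0.
have n0 : 0 < n.+1%:R :> R by [].
split.
  apply: (@sub_finite_set _ _ (F @` `I_(n.+1 * n.+1).+1)); last first.
    exact/finite_image/finite_II.
  move=> _ [x Dx <-]; rewrite /grid.
  case: ltnP => h; last by exists (n.+1 * n.+1)%N => //=; rewrite /F ltnn.
  exists (Num.truncn (x * n.+1%:R)); last by rewrite /F h.
  exact: ltnW.
have fib v : D `&` grid f n @^-1` [set v] = D `&` \bigcup_(k in [set k | F k = v])
    `[k%:R / n.+1%:R, k.+1%:R / n.+1%:R[%classic.
  apply/seteqP; split => x [Dx].
    move=> /= gv; split=> //; exists (Num.truncn (x * n.+1%:R)) => //=.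
    rewrite in_itv/= ler_pdivrMr// ltr_pdivlMr//.
    by apply: truncn_itv; apply: mulr_ge0 => //; exact: D0.
  move=> [k /= Fk]; rewrite in_itv/= ler_pdivrMr// ltr_pdivlMr// => kx.
  by split => //=; rewrite /grid (truncn_def kx).
move=> v; split.
  by rewrite fib; apply: measurableI => //; apply: bigcup_measurable => k _.
move=> v0; apply: (@le_lt_trans _ _ (leb `[0, n.+1%:R]%classic)).
  rewrite le_measure ?inE//; first by rewrite fib; apply: measurableI => //; apply: bigcup_measurable => k _.
  move=> x [Dx /= gv]; rewrite in_itv/= D0//=.
  move: gv; rewrite /grid; case: ltnP => [h _|_ v00]; last by rewrite -v00 eqxx in v0.
  rewrite -(ler_pM2r n0) -natrM ltW// (lt_le_trans (truncnS_gt _))//.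
  by rewrite ler_nat.
have := lebesgue_measure_itv `[0%R, n.+1%:R : R].
by move=> /= ->; case: ifP => _; rewrite -?EFinD ltry.
Qed.

Let cvg_grid (f : R -> V) (x : R) : continuous f -> 0 <= x -> grid f n x @[n --> \oo] --> f x.
Proof.
move=> cf x0.
have h : (Num.truncn (x * n.+1%:R))%:R / n.+1%:R @[n --> \oo] --> x.
  apply/cvgrPdist_le => e e0; near=> n.
  have n0 : 0 < n.+1%:R :> R by [].
  have k1 : (Num.truncn (x * n.+1%:R))%:R <= x * n.+1%:R by rewrite truncn_le mulr_ge0.
  have k2 : x * n.+1%:R < (Num.truncn (x * n.+1%:R)).+1%:R by exact: truncnS_gt.
  rewrite ger0_norm; last by rewrite subr_ge0 ler_pdivrMr.
  rewrite -(ler_pM2r n0) mulrBl divfK ?gt_eqF//.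
  apply: (@le_trans _ _ 1); first by rewrite lerBlDl natr1 ltW.
  rewrite -ler_pdivrMl// mulr1; apply/ltW; apply: (lt_le_trans (truncnS_gt _)).
  rewrite ler_nat ltnS; near: n; exact: nbhs_infty_ge.
have fh := cvg_comp _ _ h (cf x).
apply: cvg_trans fh; apply: near_eq_cvg; near=> n.
rewrite /grid ifT// -(ltr_nat R) natrM.
apply: (@le_lt_trans _ _ (x * n.+1%:R)); first by rewrite truncn_le mulr_ge0.
rewrite ltr_pM2r//; apply: (lt_le_trans (truncnS_gt _)).
rewrite ler_nat ltnS; near: n; exact: nbhs_infty_ge.
Unshelve. all: by end_near. Qed.

(** Dominated convergence for the step functions [grid]. The set D is closed downwards because the
    bound on f is used at grid points, which lie to the left of x. *)
Lemma bochner_integrable_continuous (D : set R) (f : R -> V) (C b : R) :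
  measurable D -> (forall x, D x -> 0 <= x) ->
  (forall x y, D x -> 0 <= y <= x -> D y) ->
  0 < b -> 0 <= C -> continuous f -> (forall x, D x -> `|f x| <= C * expR (- (b * x))) ->
  leb.-integrable D (EFin \o (fun x => expR (- (b * x)))) ->
  bochner_integrable leb D f.
Proof.
move=> mD D0 Ddown b0 C0 cf fC ie.
have cn (g : R -> V) : continuous g -> measurable_fun D (fun x => `|g x|).
  move=> cg; apply: (measurable_funS _ (@subsetT _ D)) => //.
  apply: continuous_measurable_fun => x.
  by apply: continuous_comp; [exact: cg|exact: norm_continuous].
have mfB c : measurable_fun D (fun x => `|f x - c|).
  by apply: (cn (fun x => f x - c)) => x; apply: cvgB; [exact: cf|exact: cvg_cst].
(* The grid point lies at most 1/(n+1) <= 1 to the left of x, hence the factor exp b. *)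
have gle n x : D x -> `|grid f n x| <= C * expR b * expR (- (b * x)).
  move=> Dx; have x0 := D0 x Dx.
  rewrite /grid; case: ifP => _; last by rewrite normr0 !mulr_ge0 ?expR_ge0.
  have n0 : 0 < n.+1%:R :> R by [].
  set k := Num.truncn _.
  have k1 : k%:R <= x * n.+1%:R by rewrite truncn_le mulr_ge0.
  have k2 : x * n.+1%:R < k.+1%:R by exact: truncnS_gt.
  apply: (le_trans (fC _ _)).
    by apply: (Ddown x) => //; rewrite divr_ge0//= ler_pdivrMr.
  rewrite -mulrA -expRD ler_wpM2l// ler_expR -[leRHS]opprB lerN2.
  rewrite -[X in _ - X]mulr1 -mulrBr ler_pM2l// lerBlDr.
  rewrite -[X in _ <= _ + X](@divff _ n.+1%:R)// -mulrDl ler_pdivlMr//.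
  apply: (le_trans (ltW k2)); rewrite -natr1 lerD2l ler1n//.
apply: (@bochner_integrable_approx _ _ leb D f (grid f)) => //.
- move=> w; apply: (measurable_funS _ (@subsetT _ D)) => //.
  apply: continuous_measurable_fun; exact: continuous_ip.
- by move=> n; exact: bochner_simple_grid.
- by apply: aeW => x Dx; apply: cvg_grid => //; exact: D0.
have ig : leb.-integrable D (EFin \o (fun x => (C + C * expR b) * expR (- (b * x)))).
  exact: integrable_mulrl.
have mg n : measurable_fun D (fun x => `|f x - grid f n x|).
  exact: (@bochner_simple_measurable _ _ _ _ leb D (grid f n)
    (fun c x => `|f x - c|) (bochner_simple_grid f n mD D0) mfB).
have ff : {ae leb, forall x, D x ->
    (`|f x - grid f n x|%:E : \bar R) @[n --> \oo] --> (cst 0 x)%E}.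
  apply: aeW => x Dx; apply/fine_cvgP; split; first exact: nearW.
  have := cvg_grid cf (D0 _ Dx) => /(cvgB (cvg_cst (f x))) /cvg_norm.
  by rewrite subrr normr0.
have fg : {ae leb, forall x n, D x -> (`|(`|f x - grid f n x|%:E : \bar R)| <=
    ((C + C * expR b) * expR (- (b * x)))%R%:E)%E}.
  apply: aeW => x n Dx; rewrite /= lee_fin normr_id (le_trans (ler_normB _ _))//.
  by rewrite mulrDl lerD ?fC ?gle.
have mg' n : measurable_fun D (fun x => `|f x - grid f n x|%:E).
  exact/measurable_EFinP.
have [_ _ h] := @dominated_convergence _ _ _ leb D mD
  (fun n x => `|f x - grid f n x|%:E) (cst 0%E)
  (EFin \o (fun x => (C + C * expR b) * expR (- (b * x))))
  mg' (measurable_cst _) ff ig fg.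
by rewrite integral0 in h.
Qed.

End bochner_exists.

Section continuous_bochner.
Context (R : realType) (V : normedModType R) (ip : V -> V -> R).
Hypothesis ipP : inner_product ip.
Local Notation leb := (@lebesgue_measure R).

Lemma bochner_integral_ip (D : set R) (f : R -> V) w : measurable D ->
  continuous f -> bochner_integrable leb D f ->
  leb.-integrable D (EFin \o (fun x => ip (f x) w)) /\
  ip (bochner_integral leb D f) w = \int[leb]_(x in D) ip (f x) w.
Proof.
move=> mD cf [v hv].
have mc (g : R -> R) : continuous g -> measurable_fun D g.
  move=> cg; apply: (measurable_funS _ (@subsetT _ D)) => //.
  exact: continuous_measurable_fun.
apply: (@bochner_integral_weak _ _ _ ipP _ _ leb D mD).
- move=> c; apply: mc => x; apply: (@continuous_comp _ _ _ (fun x => f x - c) _ x).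
    by apply: cvgB; [exact: cf|exact: cvg_cst].
  exact: norm_continuous.
- by move=> u; apply: mc; exact: continuous_ip.
- by rewrite /bochner_integral; case: xgetP => // /(_ v).
Qed.

End continuous_bochner.

(** * Integrals over [0, oo[ of exponentially decaying functions *)

Section exponential_decay.
Variable R : realType.
Local Notation leb := (@lebesgue_measure R).
Variable b : R.
Hypothesis b0 : 0 < b.

Let is_derive_exp (x : R) :
  is_derive x 1 (fun x => - (expR (- (b * x)) / b)) (expR (- (b * x))).
Proof.
have h : is_derive (- (b * x)) 1 (@expR R) (expR (- (b * x))) by exact: is_derive_expR.
have h2 : is_derive x 1 (fun x => - (b * x)) (- b).
  by apply: is_derive_eq; rewrite /GRing.scale /=; ring.
have h3 := @is_derive1_comp _ (@expR R) (fun x => - (b * x)) x _ _ h h2.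
have -> : (fun x => - (expR (- (b * x)) / b)) =
    (fun x => (- b^-1) * (expR \o (fun x => - (b * x))) x).
  by apply/funext => y /=; rewrite mulNr mulrC.
by apply: is_derive_eq; rewrite /GRing.scale /=; field; rewrite gt_eqF.
Qed.

Lemma continuous_exp_decay : continuous (fun x : R => expR (- (b * x))).
Proof.
move=> x; apply: continuous_comp; last exact: continuous_expR.
by apply: cvgN; apply: cvgM; [exact: cvg_cst|exact: cvg_id].
Qed.

Lemma cvg_exp_decay : expR (- (b * x)) @[x --> +oo] --> (0 : R).
Proof.
apply: (@cvg_comp _ _ _ (fun x => b * x) (fun z => expR (- z)) _ (pinfty_nbhs R)).
  exact: gt0_cvgMry.
exact: cvgr_expR.
Qed.

Lemma integral_exp_decay (N : R) :
  (\int[leb]_(x in `[N, +oo[) (expR (- (b * x)))%:E = (expR (- (b * N)) / b)%:E)%E.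
Proof.
rewrite (@ge0_continuous_FTC2y _ _ (fun x => - (expR (- (b * x)) / b)) N 0).
- by rewrite -EFinB sub0r opprK.
- by move=> x _; exact: expR_ge0.
- exact: continuous_subspaceT continuous_exp_decay.
- have := cvgN (cvgM cvg_exp_decay (cvg_cst b^-1)).
  by rewrite mul0r oppr0; exact.
- by move=> x _; exact: (@ex_derive _ _ _ _ _ _ _ (is_derive_exp x)).
- apply: cvg_at_right_filter; exact: is_derive_continuous (is_derive_exp N).
- by move=> x _; rewrite derive1E; exact: (@derive_val _ _ _ _ _ _ _ (is_derive_exp x)).
Qed.

Lemma integrable_exp_decay (N : R) :
  leb.-integrable `[N, +oo[ (EFin \o (fun x => expR (- (b * x)))).
Proof.
apply/integrableP; split.
  apply/measurable_EFinP; apply: (measurable_funS _ (@subsetT _ _)) => //.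
  exact: continuous_measurable_fun continuous_exp_decay.
under eq_integral do rewrite /= ger0_norm ?expR_ge0//.
by rewrite integral_exp_decay ltry.
Qed.

Section decaying_function.
Variables (f : R -> R) (C : R).
Hypothesis cf : continuous f.
Hypothesis C0 : 0 <= C.
Hypothesis fC : forall x, 0 <= x -> `|f x| <= C * expR (- (b * x)).

Lemma integrable_decay (N : R) : 0 <= N -> leb.-integrable `[N, +oo[ (EFin \o f).
Proof.
move=> N0.
have h : leb.-integrable `[N, +oo[ (EFin \o (fun x => C * expR (- (b * x)))).
  by apply: integrable_mulrl => //; exact: integrable_exp_decay.
apply: (le_integrable _ _ _ h) => //.
  apply/measurable_EFinP; apply: (measurable_funS _ (@subsetT _ _)) => //.
  exact: continuous_measurable_fun.
move=> x /=; rewrite in_itv/= andbT => Nx.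
by rewrite lee_fin [leRHS]ger0_norm ?mulr_ge0 ?expR_ge0// fC// (le_trans N0).
Qed.

Lemma norm_Rint_decay_le (N : R) : 0 <= N ->
  `|\int[leb]_(x in `[N, +oo[) f x| <= C * (expR (- (b * N)) / b).
Proof.
move=> N0.
have h : leb.-integrable `[N, +oo[ (EFin \o (fun x => C * expR (- (b * x)))).
  by apply: integrable_mulrl => //; exact: integrable_exp_decay.
apply: (le_trans (le_normr_Rintegral _ (integrable_decay N0))) => //.
have -> : C * (expR (- (b * N)) / b) = \int[leb]_(x in `[N, +oo[) (C * expR (- (b * x))).
  rewrite RintegralZl//; last exact: integrable_exp_decay.
  by rewrite /Rintegral integral_exp_decay.
apply: le_Rintegral => //.
  apply: (le_integrable _ _ _ (integrable_decay N0)) => //.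
    apply/measurable_EFinP; apply: measurableT_comp => //.
    apply: (measurable_funS _ (@subsetT _ _)) => //.
    exact: continuous_measurable_fun.
  by move=> x _ /=; rewrite lee_fin normr_id.
move=> x /=; rewrite in_itv/= andbT => Nx; apply: fC; exact: le_trans Nx.
Qed.

Lemma Rint_decay_split (N : R) : 0 <= N ->
  \int[leb]_(x in `[0, +oo[) f x =
  \int[leb]_(x in `[0, N]) f x + \int[leb]_(x in `[N, +oo[) f x.
Proof.
move=> N0; have h0 := @integrable_decay 0 (lexx _).
have := @Rintegral_itvB R f (BLeft 0) (BInfty _ false) N h0.
rewrite !bnd_simp => /(_ N0 isT) h.
rewrite -(Rintegral_itv_obnd_cbnd (integrableS _ _ _ (integrable_decay N0))) //; last first.
  by apply: subset_itvr; rewrite bnd_simp.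
by rewrite -h addrC subrK.
Qed.

Lemma norm_Rint_decay_tail_le (N : R) : 0 <= N ->
  `|\int[leb]_(x in `[0, +oo[) f x - \int[leb]_(x in `[0, N]) f x| <=
  C * (expR (- (b * N)) / b).
Proof. by move=> N0; rewrite (Rint_decay_split N0) addrC addKr norm_Rint_decay_le. Qed.

End decaying_function.

(** Compares two infinite integrals through their truncations at N: only the error at each finite N
    has to be estimated. *)
Lemma eq_of_decay (x y K : R) :
  (forall N, 0 <= N -> `|x - y| <= K * expR (- (b * N))) -> x = y.
Proof.
move=> h; apply/eqP; rewrite -subr_eq0 -normr_le0.
have hc : K * expR (- (b * N)) @[N --> +oo] --> (0 : R).
  by have := cvgM (cvg_cst K) cvg_exp_decay; rewrite mulr0; exact.
apply: (cvgr_to_ge hc); exists 0; split => // N /ltW; exact: h.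
Qed.

Lemma Rint_decay_shift (f : R -> R) (C r : R) : continuous f -> 0 <= C -> 0 <= r ->
  (forall x, 0 <= x -> `|f x| <= C * expR (- (b * x))) ->
  \int[leb]_(x in `[0, +oo[) f (x + r) =
  \int[leb]_(x in `[0, +oo[) f x - \int[leb]_(x in `[0, r]) f x.
Proof.
move=> cf C0; rewrite le_eqVlt => /predU1P[<- fC|r0 fC].
  by rewrite set_itv1 Rintegral_set1 subr0; apply: eq_Rintegral => x _; rewrite addr0.
have cfr : continuous (fun x => f (x + r)).
  move=> x; apply: continuous_comp; last exact: cf.
  by apply: cvgD; [exact: cvg_id|exact: cvg_cst].
have fCr x : 0 <= x -> `|f (x + r)| <= C * expR (- (b * x)).
  move=> x0; apply: (le_trans (fC _ _)); first by rewrite addr_ge0// ltW.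
  rewrite ler_wpM2l// ler_expR lerN2 ler_pM2l// lerDl ltW//.
(* One C / b for each discarded tail, beyond N and beyond N + r. *)
apply: (eq_of_decay (K := 2 * (C / b))) => N N0.
have t1 := norm_Rint_decay_tail_le cfr C0 fCr N0.
have N0r : 0 <= N + r by rewrite addr_ge0// ltW.
have t2 := norm_Rint_decay_tail_le cf C0 fC N0r.
pose Phi y := \int[leb]_(x in `[0, y]) f x.
have dPhi (y : R) : 0 < y -> is_derive y 1 Phi (f y) by exact: is_derive_Rint.
have dPhir (y : R) : 0 <= y -> is_derive y 1 (fun y => Phi (y + r)) (f (y + r)).
  move=> y0; have h1 : is_derive (y + r) 1 Phi (f (y + r)).
    by apply: dPhi; rewrite ltr_wpDl.
  have h2 : is_derive y 1 (fun y : R => y + r) 1.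
    by apply: is_derive_eq; rewrite addr0.
  have := @is_derive1_comp _ Phi (fun y : R => y + r) y _ _ h1 h2.
  by rewrite mulr1.
(* [Phi] is known to be differentiable on ]0, oo[ only; r > 0 keeps y + r inside, even at y = 0. *)
have E : \int[leb]_(x in `[0, N]) f (x + r) = Phi (N + r) - Phi (0 + r).
  apply: (@Rint_FTC2_within _ (fun y => Phi (y + r))) => //.
    apply: derivable_within_continuous => x; rewrite in_itv/= => /andP[x0 _].
    exact: (@ex_derive _ _ _ _ _ _ _ (dPhir x x0)).
  by move=> x /andP[/ltW x0 _]; exact: dPhir.
rewrite E add0r in t1.
have t3 : C * (expR (- (b * (N + r))) / b) <= C * (expR (- (b * N)) / b).
  rewrite ler_wpM2l// ler_wpM2r ?invr_ge0 ?(ltW b0)// ler_expR lerN2 ler_pM2l//.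
  by rewrite lerDl ltW.
have -> : 2 * (C / b) * expR (- (b * N)) = C * (expR (- (b * N)) / b) + C * (expR (- (b * N)) / b) by ring.
rewrite -/(Phi r); move: t1 t2 t3; rewrite -/(Phi (N + r)).
by rewrite !ler_norml => /andP[? ?] /andP[? ?] ?; apply/andP; split; lra.
Qed.

End exponential_decay.

(** * Resolvents of decaying semigroups *)

(* Indexed by the whole line through |r|, so that r |-> Q r f is continuous on R. *)
Record decaying_semigroup (R : realType) (V : normedModType R) (ip : V -> V -> R)
    (a : R) (Q : R -> V -> V) : Prop := {
  ds_lin : forall r b f g, Q r (b *: f + g) = b *: Q r f + Q r g ;
  ds_sym : forall r f g, ip (Q r f) g = ip f (Q r g) ;
  ds_norm : forall r f, `|Q r f| <= expR (- (a * `|r|)) * `|f| ;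
  ds_cont : forall f, continuous (fun r => Q r f) ;
  ds_add : forall r s f, 0 <= r -> 0 <= s -> Q (r + s) f = Q r (Q s f) ;
  ds_id : forall f, Q 0 f = f ;
  ds_abs : forall r f, Q `|r| f = Q r f
}.

Lemma linear_scaleB (R : pzRingType) (U W : lmodType R) (T : U -> W) :
  (forall b f g, T (b *: f + g) = b *: T f + T g) ->
  forall b f g, T (b *: f - g) = b *: T f - T g.
Proof.
move=> h b f g; have T0 : T 0 = 0.
  by apply: (addrI (1 *: T 0)); rewrite -h scaler0 !addr0 scale1r.
by rewrite h -[- g]addr0 -scaleN1r h T0 addr0 scaleN1r.
Qed.

(** * Derivatives of the kernels of Riemann's method *)

Section kernel.
Variable R : realType.
Implicit Types (x y c s r : R).

(* The solutions h of h_sr = h used in Riemann's method: with J0 (2 sqrt z) = H(-z)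
   and I0 (2 sqrt z) = H z, they are h = H((s - c) r). *)
Lemma is_derive_kernel x y : is_derive x 1 (fun x => x * besselH1 (x * y)) (besselH (x * y)).
Proof.
(* The chain rule is applied to y^-1 (z H'(z)) at z = xy, so that y = 0 is treated apart; there
   H'(0) = H(0) = 1. *)
have [->|y0] := eqVneq y 0.
  have -> : (fun x => x * besselH1 (x * 0)) = (fun x => x * 1 : R).
    apply/funext => z; rewrite mulr0 besselH1E psum0 bessel_coeff_diffs.
    by rewrite -natrM (_ : (0`! * 1`!)%N = 1%N)// divr1 mulr1.
  rewrite mulr0 besselH0; apply: is_derive_eq; rewrite /GRing.scale/=; ring.
have h := is_derive_mulr_besselH1 (x * y).
have h2 : is_derive x 1 (fun x => x * y) y.
  by apply: is_derive_eq; rewrite /GRing.scale/=; ring.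
have h3 := @is_derive1_comp _ (fun z => z * besselH1 z) (fun x => x * y) x _ _ h h2.
have -> : (fun x => x * besselH1 (x * y)) =
    (fun x => y^-1 * ((fun z => z * besselH1 z) \o (fun x => x * y)) x).
  by apply/funext => z /=; field.
by apply: is_derive_eq; rewrite /GRing.scale/=; field.
Qed.

Lemma is_derive_besselHl x y :
  is_derive x 1 (fun x => besselH (x * y)) (y * besselH1 (x * y)).
Proof.
have h := is_derive_besselH (x * y).
have h2 : is_derive x 1 (fun x => x * y) y.
  by apply: is_derive_eq; rewrite /GRing.scale/=; ring.
have h3 := @is_derive1_comp _ (@besselH R) (fun x => x * y) x _ _ h h2.
by apply: is_derive_eq; rewrite mulrC.
Qed.

Lemma is_derive_shift (f : R -> R) (c x l : R) : is_derive (x - c) 1 f l ->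
  is_derive x 1 (fun x => f (x - c)) l.
Proof.
move=> h; have h2 : is_derive x 1 (fun x => x - c) 1.
  by apply: is_derive_eq; rewrite subr0.
have := @is_derive1_comp _ f (fun x => x - c) x _ _ h h2.
by rewrite mulr1.
Qed.

Lemma continuous_besselHr y : continuous (fun x => besselH (y * x)).
Proof.
move=> x; apply: (@continuous_comp _ _ _ (fun x => y * x) (@besselH R)); last exact: continuous_besselH.
by apply: cvgM; [exact: cvg_cst|exact: cvg_id].
Qed.

Lemma continuous_besselH1r y : continuous (fun x => besselH1 (y * x)).
Proof.
move=> x; apply: (@continuous_comp _ _ _ (fun x => y * x) (@besselH1 R)); last exact: continuous_besselH1.
by apply: cvgM; [exact: cvg_cst|exact: cvg_id].
Qed.

Lemma continuous_besselH1l y c : continuous (fun x => besselH1 ((x - c) * y)).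
Proof.
move=> x; apply: (@continuous_comp _ _ _ (fun x => (x - c) * y) (@besselH1 R)); last exact: continuous_besselH1.
by apply: cvgM; [apply: cvgB; [exact: cvg_id|exact: cvg_cst]|exact: cvg_cst].
Qed.

End kernel.

(** * The resolvent A and the operators exp(- sA) *)

Section semigroup.
Context (R : realType) (V : completeNormedModType R) (ip : V -> V -> R).
Hypothesis ipP : inner_product ip.
Let ipF := ip_form ipP.
Variables (a : R) (Q : R -> V -> V).
Hypothesis a0 : 0 < a.
Hypothesis QP : decaying_semigroup ip a Q.
Local Notation leb := (@lebesgue_measure R).
Implicit Types (f g w : V) (r s : R).

Let M := a^-1.
Let M0 : 0 < M. Proof. by rewrite invr_gt0. Qed.

Let phi f w r := ip (Q r f) w.

Let cphi f w : continuous (phi f w).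
Proof. by apply: (continuous_ip ipP); exact: (ds_cont QP). Qed.

Let phi_le f w r : 0 <= r -> `|phi f w r| <= `|f| * `|w| * expR (- (a * r)).
Proof.
move=> r0; rewrite (le_trans (norm_ip_le ipP _ _))//.
have := ds_norm QP r f; rewrite (ger0_norm r0) => h.
by rewrite mulrAC ler_wpM2r// mulrC.
Qed.

Let fw0 f w : 0 <= `|f| * `|w|. Proof. by rewrite mulr_ge0. Qed.

(** The weight may grow at any rate below [a]: the integrand keeps the decay exp(- b r). It serves
    both for the weight 1 and for the oscillating Bessel weight. *)
Lemma weighted_bochner (c : R -> R) (K b : R) f : continuous c -> 0 < b -> 0 <= K ->
  (forall r, 0 <= r -> `|c r| <= K * expR ((a - b) * r)) ->
  bochner_integrable leb `[0, +oo[ (fun r => c r *: Q r f) /\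
  forall w, ip (bochner_integral leb `[0, +oo[ (fun r => c r *: Q r f)) w =
    \int[leb]_(r in `[0, +oo[) (c r * phi f w r).
Proof.
move=> cc b0 K0 cK.
have cf : continuous (fun r => c r *: Q r f).
  by move=> r; apply: cvgZ; [exact: cc|exact: (ds_cont QP)].
have h : bochner_integrable leb `[0, +oo[ (fun r => c r *: Q r f).
  apply: (bochner_integrable_continuous ipP (C := K * `|f|) (b := b)) => //.
  - by move=> x /=; rewrite in_itv/= andbT.
  - by move=> x y /= _ /andP[y0 _]; rewrite in_itv/= y0.
  - by rewrite mulr_ge0.
  - move=> r /=; rewrite in_itv/= andbT => r0; rewrite normrZ.
    have h := ds_norm QP r f; rewrite (ger0_norm r0) in h.
    apply: (le_trans (ler_pM _ _ (cK r r0) h)) => //.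
    rewrite mulrA -[X in X * _]mulrA -expRD mulrAC ler_wpM2l ?mulr_ge0// ler_expR.
    by rewrite mulrBl addrAC subrr add0r.
  - exact: integrable_exp_decay.
split=> // w.
have [_ ->] := bochner_integral_ip ipP w (measurable_itv _) cf h.
by apply: eq_Rintegral => r _; rewrite (formZl ipF).
Qed.

Fact resolvent_key : unit. Proof. exact: tt. Qed.
(** For Q_r = exp(- alpha r) P_r this is the alpha-resolvent of P, that is (alpha - L)^-1 with L the
    generator. *)
Definition resolvent := locked_with resolvent_key
  (fun f => bochner_integral leb `[0, +oo[ (fun r => Q r f)).
Local Notation A := resolvent.

Lemma ip_resolvent f w : ip (A f) w = \int[leb]_(r in `[0, +oo[) phi f w r.
Proof.
have c1 : continuous (cst 1 : R -> R) by exact: cst_continuous.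
have b1 : forall r, 0 <= r -> `|cst 1 r : R| <= 1 * expR ((a - a) * r).
  by move=> r _; rewrite /= normr1 subrr mul0r expR0 mulr1.
have [_ h] := @weighted_bochner (cst 1) 1 a f c1 a0 ler01 b1.
have e : (fun r => cst 1 r *: Q r f) = (fun r => Q r f).
  by apply/funext => r; rewrite /= scale1r.
rewrite e in h; rewrite /A locked_withE h.
by apply: eq_Rintegral => r _; rewrite mul1r.
Qed.

Let iphi f w : leb.-integrable `[0, +oo[ (EFin \o phi f w).
Proof.
exact: (integrable_decay a0 (@cphi f w) (fw0 f w) (@phi_le f w) (lexx 0)).
Qed.

Lemma resolvent_lin b f g : A (b *: f + g) = b *: A f + A g.
Proof.
apply: (ip_inj ipP) => w; rewrite (formDl ipF) (formZl ipF) !ip_resolvent.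
rewrite -RintegralZl ?iphi// -RintegralD ?iphi//; last exact: integrable_mulrl (iphi _ _).
apply: eq_Rintegral => r _; rewrite /phi (ds_lin QP) (formDl ipF) (formZl ipF)//.
Qed.

Lemma resolvent_sym f g : ip (A f) g = ip f (A g).
Proof.
rewrite (formC ipF f) !ip_resolvent; apply: eq_Rintegral => r _.
by rewrite /phi (ds_sym QP) (formC ipF).
Qed.

(** Q_{r/2} is a symmetric square root of Q_r. The positivity of A, and of exp(- sA) multiplied by
    Q_r or by A, rests on it. *)
Lemma ds_form_half r f g : 0 <= r ->
  ip (Q r f) g = ip (Q (r / 2) f) (Q (r / 2) g).
Proof.
move=> r0; rewrite -(ds_sym QP) -(ds_add QP) ?divr_ge0//.
by rewrite -splitr.
Qed.

Lemma resolvent_ge0 f : 0 <= ip (A f) f.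
Proof.
rewrite ip_resolvent; apply: Rintegral_ge0 => r /=; rewrite in_itv/= andbT => r0.
by rewrite /phi ds_form_half// (form_ge0 ipF).
Qed.

Lemma norm_ip_resolvent_le f w : `|ip (A f) w| <= M * `|f| * `|w|.
Proof.
rewrite ip_resolvent.
apply: (le_trans (norm_Rint_decay_le a0 (@cphi f w) (fw0 f w) (@phi_le f w) (lexx 0))).
by rewrite mulr0 oppr0 expR0 mul1r mulrC mulrA.
Qed.

Lemma norm_resolvent_le f : `|A f| <= M * `|f|.
Proof.
apply: (norm_le_weak ipP); first by rewrite mulr_ge0// ltW.
by move=> w; rewrite (le_trans (ler_norm _))// norm_ip_resolvent_le.
Qed.

Lemma dsC r s f : Q s (Q r f) = Q r (Q s f).
Proof.
by rewrite -![Q s _](ds_abs QP) -![Q r _](ds_abs QP) -!(ds_add QP)// addrC.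
Qed.

Lemma resolvent_ds r f : A (Q r f) = Q r (A f).
Proof.
apply: (ip_inj ipP) => w; rewrite (ds_sym QP) !ip_resolvent.
by apply: eq_Rintegral => s _; rewrite /phi dsC (ds_sym QP).
Qed.

Lemma ip_resolvent_ds f w r : 0 <= r ->
  ip (A (Q r f)) w = ip (A f) w - \int[leb]_(t in `[0, r]) ip (Q t f) w.
Proof.
move=> r0; rewrite !ip_resolvent.
rewrite -(Rint_decay_shift a0 (@cphi f w) (fw0 f w) r0 (@phi_le f w)).
apply: eq_Rintegral => y /set_mem /=; rewrite in_itv/= andbT => y0.
by rewrite /phi (ds_add QP).
Qed.

Lemma is_derive_resolvent_ds f w r : 0 < r ->
  is_derive r 1 (fun r => ip (A (Q r f)) w) (- ip (Q r f) w).
Proof.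
move=> r0.
pose G x := \int[leb]_(t in `[0, x]) phi f w t.
have h : is_derive r 1 G (phi f w r) by exact: is_derive_Rint.
have h2 : is_derive r 1 (fun x => ip (A f) w - G x) (- phi f w r).
  by apply: is_derive_eq; rewrite add0r mul1r.
rewrite -[- ip _ _]/(- phi f w r).
apply: (@near_eq_is_derive _ _ _ (fun x => ip (A f) w - G x)) => //.
by near=> x; rewrite ip_resolvent_ds// ltW//; near: x; exact: lt_nbhsr.
Unshelve. all: by end_near. Qed.

(** Positive because |A| <= M. Its powers are positive too, so that exp(- sA) = exp(- sM) sum_k s^k
    B^k / k! is visibly positive for s >= 0, which the alternating series in A would not show. *)
Let B f := M *: f - A f.

Let B_sym f g : ip (B f) g = ip f (B g).
Proof.
by rewrite /B (formBl ipF) (formBr ipF) (formZl ipF) (formZr ipF) resolvent_sym.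
Qed.

Let B_ge0 f : 0 <= ip (B f) f.
Proof.
rewrite /B (formBl ipF) (formZl ipF) subr_ge0 (le_trans (ler_norm _))//.
by rewrite (le_trans (norm_ip_resolvent_le _ _))// (ip_norm ipP) expr2 mulrA.
Qed.

Let norm_B_le f : `|B f| <= 2 * M * `|f|.
Proof.
rewrite /B (le_trans (ler_normB _ _))// normrZ (gtr0_norm M0).
by have := norm_resolvent_le f; lra.
Qed.

Let Bk_sym k f g : ip (iter k B f) g = ip f (iter k B g).
Proof. by elim: k f g => // k ih f g; rewrite iterSr iterS ih B_sym. Qed.

(** An even power is B^j B^j and an odd one B^j B B^j, with B^j symmetric. *)
Let Bk_ge0 k f : 0 <= ip (iter k B f) f.
Proof.
rewrite -[k]odd_double_half -addnn addnCA iterD Bk_sym iterD.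
by case: odd => /=; rewrite ?B_ge0 ?(form_ge0 ipF).
Qed.

Let norm_Bk_le k f : `|iter k B f| <= (2 * M) ^+ k * `|f|.
Proof.
elim: k => [|k ih] /=; first by rewrite expr0 mul1r.
by rewrite (le_trans (norm_B_le _))// exprS -[leRHS]mulrA ler_wpM2l// mulr_ge0// ltW.
Qed.

Let Ecoeff f w (k : nat) : R := ip (iter k B f) w / k`!%:R.

Let Ecoeff_le f w k :
  `|Ecoeff f w k| <= `|f| * `|w| * ((2 * M) ^+ k / k`!%:R).
Proof.
rewrite /Ecoeff normrM (ger0_norm (x := _^-1)) ?invr_ge0// mulrA ler_wpM2r ?invr_ge0//.
rewrite (le_trans (norm_ip_le ipP _ _))// mulrAC ler_wpM2r// mulrC norm_Bk_le//.
Qed.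

Let M2_ge0 : 0 <= 2 * M. Proof. by rewrite mulr_ge0// ltW. Qed.

Let entire_Ecoeff f w : entire_coeffs (Ecoeff f w).
Proof. by exists (`|f| * `|w|), (2 * M); split. Qed.

(* exp(-sA), expanded in the positive operator B = a^-1 - A *)
Fact rexp_key : unit. Proof. exact: tt. Qed.
Definition rexp := locked_with rexp_key (fun s f =>
  expR (- (s * M)) *: limn (series (fun k => (s ^+ k / k`!%:R) *: iter k B f)) : V).
Local Notation E := rexp.

Let cvg_rexp s f : cvgn (series (fun k => (s ^+ k / k`!%:R) *: iter k B f)).
Proof.
apply: normed_cvg.
have h : cvgn (series (`|f| *: exp_coeff (2 * M * `|s|))).
  exact/is_cvg_seriesZ/is_cvg_series_exp_coeff.
apply: series_le_cvg h => k //=.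
  by rewrite mulr_ge0// divr_ge0// exprn_ge0// mulr_ge0.
rewrite normrZ normrM normrX (ger0_norm (x := _^-1)) ?invr_ge0//.
apply: (le_trans (ler_wpM2l _ (norm_Bk_le _ _))).
  by rewrite mulr_ge0 ?exprn_ge0 ?invr_ge0.
rewrite -[leRHS]/(`|f| * ((2 * M * `|s|) ^+ k / k`!%:R)) !exprMn.
by rewrite le_eqVlt; apply/orP; left; apply/eqP; ring.
Qed.

Lemma ip_rexp s f w : ip (E s f) w = expR (- (s * M)) * psum (Ecoeff f w) s.
Proof.
rewrite /E locked_withE (formZl ipF); congr (_ * _); apply/esym/cvg_lim => //.
apply: cvg_trans (cvg_ip ipP (w := w) (@cvg_rexp s f)); apply: near_eq_cvg; apply: nearW => n /=.
rewrite /pseries /series /=.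
elim: n => [|n ih]; first by rewrite !big_nil (form0l ipF).
rewrite !big_nat_recr//= (formDl ipF) ih (formZl ipF) /Ecoeff; congr (_ + _).
by ring.
Qed.

Lemma rexp_comm s (T : V -> V) f : (forall f g, ip (T f) g = ip f (T g)) ->
  (forall f, B (T f) = T (B f)) -> E s (T f) = T (E s f).
Proof.
move=> sT BT; apply: (ip_inj ipP) => w; rewrite sT !ip_rexp; congr (_ * psum _ _).
apply/funext => k; rewrite /Ecoeff -sT; congr (ip _ _ / _).
by elim: k => //= k ->.
Qed.

Lemma rexp_resolvent s f : E s (A f) = A (E s f).
Proof.
apply: rexp_comm; first exact: resolvent_sym.
by move=> g; rewrite /B (linear_scaleB resolvent_lin).
Qed.

Lemma rexp_ds s r f : E s (Q r f) = Q r (E s f).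
Proof.
apply: rexp_comm; first exact: (ds_sym QP).
by move=> g; rewrite /B resolvent_ds (linear_scaleB (ds_lin QP r)).
Qed.

Lemma rexp_sym s f g : ip (E s f) g = ip f (E s g).
Proof.
rewrite (formC ipF f) !ip_rexp; congr (_ * psum _ _).
by apply/funext => k; rewrite /Ecoeff Bk_sym (formC ipF).
Qed.

Lemma rexp0 f : E 0 f = f.
Proof.
apply: (ip_inj ipP) => w; rewrite ip_rexp mul0r oppr0 expR0 mul1r psum0.
by rewrite /Ecoeff fact0 divr1.
Qed.

Lemma rexp_ge0 s f : 0 <= s -> 0 <= ip (E s f) f.
Proof.
move=> s0; rewrite ip_rexp mulr_ge0 ?expR_ge0// psum_ge0//.
by move=> k; rewrite /Ecoeff divr_ge0 ?Bk_ge0.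
Qed.

Lemma is_derive_rexp f w s :
  is_derive s 1 (fun s => ip (E s f) w) (- ip (A (E s f)) w).
Proof.
have -> : (fun s => ip (E s f) w) =
    (fun s => expR (- (s * M)) * psum (Ecoeff f w) s).
  by apply/funext => x; rewrite ip_rexp.
have h1 := is_derive_psum s (entire_Ecoeff f w).
have h2 : is_derive (- (s * M)) 1 (@expR R) (expR (- (s * M))) by exact: is_derive_expR.
have h3 : is_derive s 1 (fun s => - (s * M)) (- M).
  by apply: is_derive_eq; rewrite /GRing.scale/=; ring.
have h4 := @is_derive1_comp _ (@expR R) (fun s => - (s * M)) s _ _ h2 h3.
(* Termwise differentiation shifts B^k to B^(k+1), that is, replaces w by B w; the product rule then
   gives - M E + B E = - A E. *)
have d : pseries_diffs (Ecoeff f w) = Ecoeff f (B w).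
  apply/funext => k; rewrite /pseries_diffs /Ecoeff -B_sym -iterS factS natrM.
  by field; rewrite nat1r !pnatr_eq0 -lt0n fact_gt0.
rewrite d in h1.
have -> : - ip (A (E s f)) w = - M * ip (E s f) w + ip (E s f) (B w).
  by rewrite -B_sym /B (formBl ipF) (formZl ipF M (E s f) w) mulNr addKr.
rewrite !ip_rexp.
apply: is_derive_eq; rewrite /GRing.scale/=; ring.
Qed.

(** Crude, but valid for every real s, as two-sided derivatives at s = 0 require. The constant 3 M =
    M + 2 M adds the exponents of exp(- sM) and of the series in B, where |B| <= 2 M. *)
Lemma norm_rexp_le s f : `|E s f| <= expR (3 * M * `|s|) * `|f|.
Proof.
apply: (norm_le_weak ipP); first by rewrite mulr_ge0// expR_ge0.
move=> w; rewrite ip_rexp (le_trans (ler_norm _))// normrM.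
have h1 := norm_psum_le_expR s (fw0 f w) M2_ge0 (@Ecoeff_le f w).
rewrite ger0_norm ?expR_ge0//.
apply: (le_trans (ler_wpM2l (expR_ge0 _) h1)).
have -> : expR (3 * M * `|s|) * `|f| * `|w| =
  (`|f| * `|w|) * (expR (M * `|s|) * expR (2 * M * `|s|)).
  rewrite -expRD -mulrDl; have -> : M + 2 * M = 3 * M by ring.
  ring.
rewrite mulrCA ler_wpM2l// ler_wpM2r ?expR_ge0// ler_expR.
by rewrite mulrC -mulrN ler_wpM2l ?(ltW M0)// -normrN ler_norm.
Qed.

(** A is the integral of the Q_r, and Q_r exp(- sA) = Q_{r/2} exp(- sA) Q_{r/2}. *)
Lemma resolvent_rexp_ge0 s f : 0 <= s -> 0 <= ip (A (E s f)) f.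
Proof.
move=> s0; rewrite ip_resolvent; apply: Rintegral_ge0 => r /=; rewrite in_itv/= andbT => r0.
by rewrite /phi ds_form_half// -rexp_ds rexp_ge0.
Qed.

Lemma rexp_ds_ge0 s r f : 0 <= s -> 0 <= r -> 0 <= ip (E s (Q r f)) f.
Proof. by move=> s0 r0; rewrite rexp_ds ds_form_half// -rexp_ds rexp_ge0. Qed.

Lemma resolvent_rexp_ds_ge0 s r f : 0 <= s -> 0 <= r -> 0 <= ip (A (E s (Q r f))) f.
Proof.
move=> s0 r0; rewrite rexp_ds resolvent_ds ds_form_half//.
by rewrite -resolvent_ds -rexp_ds resolvent_rexp_ge0.
Qed.

End semigroup.

(** * Bessel integrals of decaying semigroups *)

Section kernel_bounds.
Variable R : realType.
Implicit Types (x y c s r S k : R).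

Lemma norm_kernel_le s r S c k : `|s| <= S -> 0 <= r <= c ->
  `|besselH ((s - k) * r)| <= expR (S + `|k|) * expR c /\
  `|besselH1 ((s - k) * r)| <= expR (S + `|k|) * expR c.
Proof.
move=> sS /andP[r0 rc].
have h : `|(s - k) * r| <= (S + `|k|) * c.
  rewrite normrM (ger0_norm r0) ler_pM//.
  by rewrite (le_trans (ler_normB _ _))// lerD2r.
have S0 : 0 <= S + `|k| by rewrite addr_ge0// (le_trans _ sS).
have c0 : 0 <= c by exact: le_trans rc.
by split; [apply: norm_besselH_le|apply: norm_besselH1_le].
Qed.

Lemma continuous_mul (f g : R -> R) : continuous f -> continuous g ->
  continuous (fun x => f x * g x).
Proof. by move=> cf cg x; apply: cvgM; [exact: cf|exact: cg]. Qed.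

Lemma subr_mul0 x y z : x - y * (0 * z) = x.
Proof. by rewrite mul0r mulr0 subr0. Qed.

Lemma besselH_subrr s r x : besselH ((s - s) * r) * x = x.
Proof. by rewrite subrr mul0r besselH0 mul1r. Qed.

Lemma besselH_sub0r s r x : besselH ((0 - s) * r) * x = besselH (- (s * r)) * x.
Proof. by rewrite sub0r mulNr. Qed.

End kernel_bounds.

Section bessel_integrals.
Context (R : realType) (V : completeNormedModType R) (ip : V -> V -> R).
Hypothesis ipP : inner_product ip.
Let ipF := ip_form ipP.
Variables (a : R) (Q : R -> V -> V).
Hypothesis a0 : 0 < a.
Hypothesis QP : decaying_semigroup ip a Q.
Local Notation leb := (@lebesgue_measure R).
Local Notation A := (resolvent Q).
Local Notation E := (rexp a Q).
Implicit Types (f g w : V) (r s S c N : R).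

Let M := a^-1.
Let M0 : 0 < M. Proof. by rewrite invr_gt0. Qed.

(* Both solve u_sr = u, as d/ds E s = - A (E s) and d/dr A (Q r) = - Q r. *)
Definition wave f w s r := ip (E s (Q r f)) w.
Definition wave1 f w s r := ip (A (E s (Q r f))) w.

Lemma waveE f w s r : wave f w s r = ip (Q r (E s f)) w.
Proof. by rewrite /wave (rexp_ds ipP a0 QP). Qed.

Lemma wave1E f w s r : wave1 f w s r = ip (A (Q r (E s f))) w.
Proof. by rewrite /wave1 (rexp_ds ipP a0 QP). Qed.

Lemma wave1_wave f w s r : wave1 f w s r = wave f (A w) s r.
Proof. by rewrite /wave1 /wave (resolvent_sym ipP a0 QP). Qed.

Lemma is_derive_waves f w s r : is_derive s 1 ((wave f w)^~ r) (- wave1 f w s r).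
Proof. exact: (is_derive_rexp ipP a0 QP). Qed.

Lemma is_derive_wave1s f w s r : is_derive s 1 ((wave1 f w)^~ r) (- wave1 f (A w) s r).
Proof.
have -> : (wave1 f w)^~ r = (wave f (A w))^~ r by apply/funext => x; exact: wave1_wave.
exact: is_derive_waves.
Qed.

Lemma is_derive_wave1r f w s r : 0 < r -> is_derive r 1 (wave1 f w s) (- wave f w s r).
Proof.
move=> r0; have -> : wave1 f w s = (fun r => ip (A (Q r (E s f))) w).
  by apply/funext => x; exact: wave1E.
by rewrite waveE; exact: (is_derive_resolvent_ds ipP a0 QP).
Qed.

Lemma continuous_waver f w s : continuous (wave f w s).
Proof.
have -> : wave f w s = (fun r => ip (Q r (E s f)) w) by apply/funext => x; exact: waveE.
by apply: (continuous_ip ipP); exact: (ds_cont QP).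
Qed.

Lemma continuous_wave1r f w s : continuous (wave1 f w s).
Proof.
have -> : wave1 f w s = wave f (A w) s by apply/funext => x; exact: wave1_wave.
exact: continuous_waver.
Qed.

Lemma continuous_waves f w r : continuous ((wave f w)^~ r).
Proof. by move=> s; exact: is_derive_continuous (is_derive_waves f w s r). Qed.

Lemma continuous_wave1s f w r : continuous ((wave1 f w)^~ r).
Proof. by move=> s; exact: is_derive_continuous (is_derive_wave1s f w s r). Qed.

Lemma norm_wave_le f w s r : 0 <= r ->
  `|wave f w s r| <= expR (3 * M * `|s|) * (`|f| * `|w|) * expR (- (a * r)).
Proof.
move=> r0; rewrite (le_trans (norm_ip_le ipP _ _))// mulrA mulrAC ler_wpM2r//.
rewrite (le_trans (norm_rexp_le ipP a0 QP _ _))// -[leRHS]mulrA ler_wpM2l ?expR_ge0//.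
by have := ds_norm QP r f; rewrite (ger0_norm r0) mulrC.
Qed.

Lemma norm_wave1_le f w s r : 0 <= r ->
  `|wave1 f w s r| <= expR (3 * M * `|s|) * (`|f| * (M * `|w|)) * expR (- (a * r)).
Proof.
move=> r0; rewrite wave1_wave (le_trans (norm_wave_le _ _ _ r0))// ler_wpM2r ?expR_ge0//.
rewrite ler_wpM2l ?expR_ge0// ler_wpM2l//; exact: (norm_resolvent_le ipP a0 QP).
Qed.

Lemma wave_bounded f w S : exists C, forall s r, `|s| <= S -> 0 <= r ->
  `|wave f w s r| <= C /\ `|wave1 f w s r| <= C.
Proof.
exists (expR (3 * M * S) * (`|f| * `|w|) + expR (3 * M * S) * (`|f| * (M * `|w|))).
move=> s r sS r0.
have h (C : R) : 0 <= C -> expR (3 * M * `|s|) * C * expR (- (a * r)) <= expR (3 * M * S) * C.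
  move=> C0; rewrite -[leRHS]mulr1; apply: ler_pM.
  - by rewrite mulr_ge0 ?expR_ge0.
  - by rewrite expR_ge0.
  - by rewrite ler_wpM2r// ler_expR ler_wpM2l// mulr_ge0// ltW.
  - by rewrite -[leRHS]expR0 ler_expR oppr_le0 mulr_ge0// ltW.
have p1 : 0 <= `|f| * `|w| by rewrite mulr_ge0.
have p2 : 0 <= `|f| * (M * `|w|) by rewrite mulr_ge0// mulr_ge0// ltW.
split.
  rewrite (le_trans (norm_wave_le _ _ _ r0))// (le_trans (h _ p1))// lerDl.
  by rewrite mulr_ge0// expR_ge0.
rewrite (le_trans (norm_wave1_le _ _ _ r0))// (le_trans (h _ p2))// lerDr.
by rewrite mulr_ge0// expR_ge0.
Qed.

(** The kernel v = H((s - S) r) is 1 on the edge s = S, and v_s = r H'((s - S) r) vanishes on the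
    edge r = 0; the three remaining edges are the three integrals. *)
Let rectangle1 f w S N : 0 <= S -> 0 <= N ->
  \int[leb]_(s in `[0, S]) (wave1 f w s N * (N * besselH1 ((s - S) * N))) =
  \int[leb]_(r in `[0, N]) (- wave f w S r) -
  \int[leb]_(r in `[0, N]) (besselH (- (S * r)) * - wave f w 0 r).
Proof.
move=> S0 N0.
transitivity (\int[leb]_(s in `[0, S]) (wave1 f w s N * (N * besselH1 ((s - S) * N)) -
    wave1 f w s 0 * (0 * besselH1 ((s - S) * 0)))).
  by apply: eq_Rintegral => s _; exact/esym/subr_mul0.
transitivity (\int[leb]_(r in `[0, N]) (besselH ((S - S) * r) * - wave f w S r) -
    \int[leb]_(r in `[0, N]) (besselH ((0 - S) * r) * - wave f w 0 r)); last first.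
  congr (_ - _); apply: eq_Rintegral => r _; first exact: besselH_subrr.
  exact: besselH_sub0r.
apply: (@rectangle_identity R (wave1 f w) (fun s r => - wave f w s r)
  (fun s r => besselH ((s - S) * r)) (fun s r => r * besselH1 ((s - S) * r))) => //.
- move=> s r _; rewrite -[X in is_derive _ _ _ X]opprK.
  exact: (is_deriveN (is_derive_waves f w s r)).
- move=> s r _; apply: (is_derive_shift (f := fun x => besselH (x * r))).
  exact: is_derive_besselHl.
- by move=> s r r0; exact: is_derive_wave1r.
- move=> s r _; rewrite [(s - S) * r]mulrC.
  have -> : (fun r => r * besselH1 ((s - S) * r)) = (fun r => r * besselH1 (r * (s - S))).
    by apply/funext => x; rewrite [(s - S) * x]mulrC.
  exact: is_derive_kernel.
- move=> s; split.
  + exact: continuous_wave1r.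
  + by move=> r; apply: cvgN; exact: continuous_waver.
  + exact: continuous_besselHr.
  + by apply: continuous_mul; [move=> x; exact: cvg_id|exact: continuous_besselH1r].
- move=> r; split; first exact: continuous_wave1s.
  apply: continuous_mul; first exact: cst_continuous.
  exact: continuous_besselH1l.
- move=> S' c; have [C hC] := wave_bounded f w S'.
  exists (`|C| + (1 + c) * (expR (S' + `|S|) * expR c)) => s r sS rc.
  have /andP[r0 rlec] := rc.
  have [h1 h2] := hC s r sS r0; have [h3 h4] := norm_kernel_le S sS rc.
  have c0 : 0 <= c by exact: le_trans rlec.
  have p0 : 0 <= expR (S' + `|S|) * expR c by rewrite mulr_ge0 ?expR_ge0.
  have q0 : 0 <= c * (expR (S' + `|S|) * expR c) by rewrite mulr_ge0.
  have n0 := normr_ge0 C; have cC := ler_norm C.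
  rewrite normrN normrM (ger0_norm r0); split; try lra.
  have : r * `|besselH1 ((s - S) * r)| <= c * (expR (S' + `|S|) * expR c) by apply: ler_pM.
  lra.
Qed.

Definition besselJ s f :=
  bochner_integral leb `[0, +oo[ (fun r => besselH (- (s * r)) *: Q r f).
Local Notation J := besselJ.

(** Here sr = (s / (a/2)) ((a/2) r): half of the decay rate [a] is spent on the kernel and half
    remains. *)
Let norm_besselH_decay s r : 0 <= s -> 0 <= r ->
  `|besselH (- (s * r))| <= expR (s / (a / 2)) * expR ((a - a / 2) * r).
Proof.
move=> s0 r0; have a2 : 0 < a / 2 by rewrite divr_gt0.
apply: norm_besselH_le.
- by rewrite divr_ge0// ltW.
- by rewrite mulr_ge0// subr_ge0 ler_pdivrMr// ler_peMr ?ler1n// ltW.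
rewrite normrN normrM !ger0_norm//.
have -> : a - a / 2 = a / 2 by rewrite [X in X - _]splitr addrK.
by rewrite mulrA divfK// gt_eqF.
Qed.

Let continuous_HN s : continuous (fun r => besselH (- (s * r))).
Proof.
have -> : (fun r => besselH (- (s * r))) = (fun r => besselH (- s * r)).
  by apply/funext => x; rewrite mulNr.
exact: continuous_besselHr.
Qed.

Lemma ip_besselJ s f w : 0 <= s ->
  ip (J s f) w = \int[leb]_(r in `[0, +oo[) (besselH (- (s * r)) * ip (Q r f) w).
Proof.
move=> s0; have a2 : 0 < a / 2 by rewrite divr_gt0.
have [_ h] := @weighted_bochner _ _ _ ipP _ _ QP (fun r => besselH (- (s * r)))
  (expR (s / (a / 2))) (a / 2) f (@continuous_HN s) a2 (expR_ge0 _)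
  (fun r => norm_besselH_decay s0).
exact: h.
Qed.

(** In [rectangle1] on [0, s] x [0, N], two edges carry the integrals over [0, N] to be compared,
    and the edge r = N is O(exp(- aN/2)), because the wave decays there like exp(- aN) and the
    kernel grows more slowly. *)
Lemma besselJE s f : 0 <= s -> J s f = A (E s f).
Proof.
move=> s0; apply: (ip_inj ipP) => w; rewrite ip_besselJ// (ip_resolvent ipP a0 QP).
have a2 : 0 < a / 2 by rewrite divr_gt0.
pose psi r := besselH (- (s * r)) * ip (Q r f) w.
have cpsi : continuous psi.
  apply: continuous_mul; first exact: continuous_HN.
  by apply: (continuous_ip ipP); exact: (ds_cont QP).
have ip_le g r : 0 <= r -> `|ip (Q r g) w| <= expR (- (a * r)) * (`|g| * `|w|).
  move=> r0; rewrite (le_trans (norm_ip_le ipP _ _))// mulrA ler_wpM2r//.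
  by have := ds_norm QP r g; rewrite (ger0_norm r0).
pose K1 := expR (s / (a / 2)) * (`|f| * `|w|).
have K10 : 0 <= K1 by rewrite mulr_ge0 ?expR_ge0// mulr_ge0.
have psi_le r : 0 <= r -> `|psi r| <= K1 * expR (- (a / 2 * r)).
  move=> r0; rewrite normrM.
  apply: (le_trans (ler_pM _ _ (norm_besselH_decay s0 r0) (ip_le f r r0))) => //.
  have <- : expR ((a - a / 2) * r) * expR (- (a * r)) = expR (- (a / 2 * r)).
    by rewrite -expRD; congr expR; ring.
  by rewrite le_eqVlt; apply/orP; left; apply/eqP; rewrite /K1; ring.
pose K2 := `|E s f| * `|w|.
have K20 : 0 <= K2 by rewrite mulr_ge0.
have ce : continuous (fun r => ip (Q r (E s f)) w).
  by apply: (continuous_ip ipP); exact: (ds_cont QP).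
have e_le2 r : 0 <= r -> `|ip (Q r (E s f)) w| <= K2 * expR (- (a / 2 * r)).
  move=> r0; rewrite (le_trans (ip_le _ _ r0))// mulrC ler_wpM2l// ler_expR lerN2.
  by rewrite ler_wpM2r// ler_pdivrMr// ler_peMr ?ler1n// ltW.
(* From N <= (4/a) exp(aN/4) and |H'| <= exp(4s/a) exp(aN/4): the kernel costs exp(aN/2) out of the
   decay exp(- aN). *)
pose K3 := expR (3 * M * s) * (`|f| * (M * `|w|)) * (4 / a * expR (s / (a / 4))).
have K30 : 0 <= K3.
  rewrite !mulr_ge0 ?expR_ge0//; first exact: ltW.
  by rewrite invr_ge0 ltW.
apply: (@eq_of_decay _ (a / 2) a2 _ _ (K1 / (a / 2) + K2 / (a / 2) + K3 * s)) => N N0.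
have t1 := norm_Rint_decay_tail_le a2 cpsi K10 psi_le N0.
have t2 := norm_Rint_decay_tail_le a2 ce K20 e_le2 N0.
have t3 := rectangle1 f w s0 N0.
have eN (h : R -> R) : continuous h ->
    \int[leb]_(r in `[0, N]) (- h r) = - \int[leb]_(r in `[0, N]) h r.
  move=> ch; rewrite -mulN1r -RintZ//.
  by apply: eq_Rintegral => r _; rewrite mulN1r.
have t4 : \int[leb]_(r in `[0, N]) (- wave f w s r) = - \int[leb]_(r in `[0, N]) ip (Q r (E s f)) w.
  by rewrite -eN//; apply: eq_Rintegral => r _; rewrite waveE.
have t5 : \int[leb]_(r in `[0, N]) (besselH (- (s * r)) * - wave f w 0 r) =
    - \int[leb]_(r in `[0, N]) psi r.
  rewrite -eN//; apply: eq_Rintegral => r _.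
  by rewrite mulrN waveE (rexp0 ipP a0 QP).
rewrite t4 t5 in t3.
have t6 : `|\int[leb]_(x in `[0, s]) (wave1 f w x N * (N * besselH1 ((x - s) * N)))| <=
    K3 * expR (- (a / 2 * N)) * (s - 0).
  apply: norm_Rint_le => //.
    apply: continuous_mul; first exact: continuous_wave1s.
    by apply: continuous_mul; [exact: cst_continuous|exact: continuous_besselH1l].
  move=> x /andP[x0 xs]; rewrite normrM.
  have h1 : `|wave1 f w x N| <= expR (3 * M * s) * (`|f| * (M * `|w|)) * expR (- (a * N)).
    rewrite (le_trans (norm_wave1_le _ _ _ N0))// ler_wpM2r ?expR_ge0// ler_wpM2r//.
      by rewrite !mulr_ge0// ltW.
    by rewrite ler_expR ger0_norm// ler_wpM2l// mulr_ge0// ltW.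
  have h2 : `|N * besselH1 ((x - s) * N)| <=
      4 / a * expR (a / 4 * N) * (expR (s / (a / 4)) * expR (a / 4 * N)).
    rewrite normrM (ger0_norm N0); apply: ler_pM => //.
      have {1}-> : N = 4 / a * (a / 4 * N) by field; rewrite gt_eqF.
      apply: ler_wpM2l; first by rewrite divr_ge0// ltW.
      by rewrite (le_trans _ (expR_ge1Dx _))// lerDr.
    apply: norm_besselH1_le.
    - by rewrite !mulr_ge0// invr_ge0 divr_ge0// ltW.
    - by rewrite !mulr_ge0// ltW.
    rewrite mulrA divfK ?gt_eqF ?divr_gt0//.
    rewrite normrM (ger0_norm N0) ler_wpM2r// ler_norml; apply/andP; split; lra.
  apply: (le_trans (ler_pM _ _ h1 h2)) => //.
  have -> : expR (- (a / 2 * N)) = expR (- (a * N)) * (expR (a / 4 * N) * expR (a / 4 * N)).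
    by rewrite -!expRD; congr expR; field.
  by rewrite le_eqVlt; apply/orP; left; apply/eqP; rewrite /K3; ring.
rewrite t3 subr0 in t6.
have -> : (K1 / (a / 2) + K2 / (a / 2) + K3 * s) * expR (- (a / 2 * N)) =
  K1 * (expR (- (a / 2 * N)) / (a / 2)) + K2 * (expR (- (a / 2 * N)) / (a / 2)) +
  K3 * expR (- (a / 2 * N)) * s by ring.
rewrite -/(psi _); move: t1 t2 t6; rewrite !ler_norml.
by move=> /andP[? ?] /andP[? ?] /andP[? ?]; apply/andP; split; lra.
Qed.

End bessel_integrals.

Lemma is_derive_mul_affine (R : realType) (h k u : R -> R) (s h' k' u' d : R) :
  is_derive s 1 h h' -> is_derive s 1 k k' -> is_derive s 1 u u' ->
  is_derive s 1 (fun x => h x * (k x + d * u x))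
    (h' * (k s + d * u s) + h s * (k' + d * u')).
Proof.
by move=> hh hk hu; apply: is_derive_eq; rewrite /GRing.scale/=; ring.
Qed.

Lemma is_derive_mul3 (R : realType) (h k u : R -> R) (s h' k' u' : R) :
  is_derive s 1 h h' -> is_derive s 1 k k' -> is_derive s 1 u u' ->
  is_derive s 1 (fun x => h x * (k x * u x))
    (h' * (k s * u s) + h s * (k' * u s + k s * u')).
Proof.
by move=> hh hk hu; apply: is_derive_eq; rewrite /GRing.scale/=; ring.
Qed.

Lemma is_derive_add3 (R : realType) (h k u : R -> R) (s h' k' u' d : R) :
  is_derive s 1 h h' -> is_derive s 1 k k' -> is_derive s 1 u u' ->
  is_derive s 1 (fun x => h x + d * k x + u x) (h' + d * k' + u').
Proof.
by move=> hh hk hu; apply: is_derive_eq; rewrite /GRing.scale/=; ring.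
Qed.

Lemma besselH_mulr0_eq (R : realType) (s h x y : R) :
  -1 * (h * x) + -1 * - y = h * - x - besselH (s * 0) * - y.
Proof. by rewrite mulr0 besselH0; ring. Qed.

(** * The operators T_S: positivity, monotonicity and decay on the range of A *)

Section tail.
Context (R : realType) (V : completeNormedModType R) (ip : V -> V -> R).
Hypothesis ipP : inner_product ip.
Let ipF := ip_form ipP.
Variables (a : R) (Q : R -> V -> V).
Hypothesis a0 : 0 < a.
Hypothesis QP : decaying_semigroup ip a Q.
Local Notation leb := (@lebesgue_measure R).
Local Notation A := (resolvent Q).
Local Notation E := (rexp a Q).
Local Notation wave := (wave ip a Q).
Local Notation wave1 := (wave1 ip a Q).
Implicit Types (f g w : V) (r s S c N : R).

Let cw_r := continuous_waver ipP a0 QP.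
Let cw1_r := continuous_wave1r ipP a0 QP.
Let cw_s := continuous_waves ipP a0 QP.
Let cw1_s := continuous_wave1s ipP a0 QP.

Let wave0 f w s : wave f w s 0 = ip (E s f) w.
Proof. by rewrite /wave (ds_id QP). Qed.

Let wave10 f w s : wave1 f w s 0 = ip (A (E s f)) w.
Proof. by rewrite /wave1 (ds_id QP). Qed.

Let wave_ge0 f s r : 0 <= s -> 0 <= r -> 0 <= wave f f s r.
Proof. exact: (rexp_ds_ge0 ipP a0 QP). Qed.

Let wave1_ge0 f s r : 0 <= s -> 0 <= r -> 0 <= wave1 f f s r.
Proof. exact: (resolvent_rexp_ds_ge0 ipP a0 QP). Qed.

(** The weak form of T_S. All its terms are nonnegative for w = f, while [tailE] exhibits it as the
    identity minus a nondecreasing integral; together the two expressions give 0 <= T_S <= I. *)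
Definition tail f w S c :=
  ip (E S f) w + \int[leb]_(r in `[0, c]) (wave f w S r * (S * besselH1 (S * r))).

Let continuous_h1 S : continuous (fun r => S * besselH1 (S * r)).
Proof. by apply: continuous_mul; [exact: cst_continuous|exact: continuous_besselH1r]. Qed.

Let continuous_hs c : continuous (fun s => besselH (s * c)).
Proof.
have -> : (fun s => besselH (s * c)) = (fun s => besselH (c * s)).
  by apply/funext => s; rewrite mulrC.
exact: continuous_besselHr.
Qed.

(** Riemann's method with u = H(sr) and v = (exp(- sA) Q_r f, w): the edge s = 0 drops out since u_r
    = s H'(sr), and the edge r = 0, where H = 1, integrates to exp(- SA) - I. *)
Lemma tailE f w S c : 0 <= S -> 0 <= c ->
  tail f w S c = ip f w - \int[leb]_(s in `[0, S]) (besselH (s * c) * wave1 f w s c).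
Proof.
move=> S0 c0.
have h : \int[leb]_(s in `[0, S]) (besselH (s * c) * - wave1 f w s c -
      besselH (s * 0) * - wave1 f w s 0) =
    \int[leb]_(r in `[0, c]) (wave f w S r * (S * besselH1 (S * r))) -
    \int[leb]_(r in `[0, c]) (wave f w 0 r * (0 * besselH1 (0 * r))).
  apply: (@rectangle_identity R (fun s r => besselH (s * r))
    (fun s r => s * besselH1 (s * r)) (wave f w) (fun s r => - wave1 f w s r)) => //.
  - by move=> s r _; exact: is_derive_kernel.
  - by move=> s r _; exact: (is_derive_waves ipP a0 QP).
  - move=> s r _.
    have -> : (fun r => besselH (s * r)) = (fun r => besselH (r * s)).
      by apply/funext => x; rewrite mulrC.
    by rewrite [s * r]mulrC; exact: is_derive_besselHl.
  - move=> s r r0; rewrite -[X in is_derive _ _ _ X]opprK.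
    exact: (is_deriveN (is_derive_wave1r ipP a0 QP f w s r0)).
  - move=> s; split.
    + exact: continuous_besselHr.
    + exact: continuous_h1.
    + exact: cw_r.
    + by move=> r; apply: cvgN; exact: cw1_r.
  - move=> r; split; first exact: continuous_hs.
    by move=> s; apply: cvgN; exact: cw1_s.
  - move=> S' d; have [C hC] := wave_bounded ipP a0 QP f w S'.
    exists (`|C| + (1 + `|S'|) * (expR (S' + `|0 : R|) * expR d)) => s r sS rd.
    have /andP[r0 rled] := rd.
    have [h1 h2] := hC s r sS r0; have [h3 h4] := norm_kernel_le 0 sS rd.
    rewrite subr0 in h3 h4.
    set X := _ * expR d in h3 h4 *.
    have X0 : 0 <= X by rewrite mulr_ge0 ?expR_ge0.
    have q0 : 0 <= `|S'| * X by rewrite mulr_ge0.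
    have n0 := normr_ge0 C; have cC := ler_norm C.
    rewrite normrN normrM.
    have : `|s| * `|besselH1 (s * r)| <= `|S'| * X.
      by apply: ler_pM => //; rewrite (le_trans sS)// ler_norm.
    by split; lra.
have z : \int[leb]_(r in `[0, c]) (wave f w 0 r * (0 * besselH1 (0 * r))) = 0.
  rewrite -[RHS](mul0r (\int[leb]_(r in `[0, c]) cst (0 : R) r)) -RintZ; last exact: cst_continuous.
  by apply: eq_Rintegral => r _; rewrite (mul0r (besselH1 _)) mulr0 mul0r.
rewrite z subr0 in h; rewrite /tail -h.
have e1 : \int[leb]_(s in `[0, S]) (- wave1 f w s 0) = ip (E S f) w - ip f w.
  have -> : ip (E S f) w - ip f w = wave f w S 0 - wave f w 0 0.
    by rewrite !wave0 (rexp0 ipP a0 QP).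
  apply: (@Rint_FTC2 _ ((wave f w)^~ 0)) => //.
  - by move=> s; apply: cvgN; exact: cw1_s.
  - by move=> s _; exact: (is_derive_waves ipP a0 QP).
have c1 : continuous (fun s => besselH (s * c) * wave1 f w s c).
  by apply: continuous_mul; [exact: continuous_hs|exact: cw1_s].
have c2 : continuous (fun s => - wave1 f w s 0).
  by move=> s; apply: cvgN; exact: cw1_s.
transitivity (ip (E S f) w + (-1 * \int[leb]_(s in `[0, S]) (besselH (s * c) * wave1 f w s c) +
   -1 * \int[leb]_(s in `[0, S]) (- wave1 f w s 0))); last first.
  rewrite e1; ring.
congr (_ + _); rewrite -RintZ// -RintZ// -RintD//; last 2 first.
- by apply: continuous_mul => //; exact: cst_continuous.
- by apply: continuous_mul => //; exact: cst_continuous.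
by apply: eq_Rintegral => s _; exact/esym/besselH_mulr0_eq.
Qed.

Lemma tail_ge0 f S c : 0 <= S -> 0 <= c -> 0 <= tail f f S c.
Proof.
move=> S0 c0; rewrite addr_ge0 ?(rexp_ge0 ipP a0 QP)//.
apply: Rint_ge0 => r /andP[r0 _].
by rewrite mulr_ge0 ?wave_ge0// mulr_ge0// besselH1_ge0// mulr_ge0.
Qed.

Lemma Rint_nondecreasing (h : R -> R) s S : continuous h -> 0 <= s -> s <= S ->
  (forall x, 0 <= x -> 0 <= h x) ->
  \int[leb]_(x in `[0, s]) h x <= \int[leb]_(x in `[0, S]) h x.
Proof.
move=> ch s0 sS h0.
have := @Rintegral_itvB R h (BLeft 0) (BRight S) s (continuous_integrable _ _ ch).
rewrite !bnd_simp => /(_ s0 sS) e; rewrite -subr_ge0 e.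
apply: Rintegral_ge0 => x /=; rewrite in_itv/= => /andP[sx _].
by apply: h0; rewrite (le_trans s0)// ltW.
Qed.

(** In [tailE] the parameter S is only the upper limit of an integral whose integrand is
    nonnegative. *)
Lemma tail_nonincreasing f s S c : 0 <= c -> 0 <= s -> s <= S ->
  tail f f S c <= tail f f s c.
Proof.
move=> c0 s0 sS; have S0 := le_trans s0 sS; rewrite !tailE//.
rewrite lerD2l lerN2; apply: Rint_nondecreasing => //.
  by apply: continuous_mul; [exact: continuous_hs|exact: cw1_s].
by move=> x x0; rewrite mulr_ge0 ?wave1_ge0 ?besselH_ge0 ?mulr_ge0.
Qed.

Lemma tail_le f S c : 0 <= S -> 0 <= c -> tail f f S c <= `|f| ^+ 2.
Proof.
move=> S0 c0; rewrite (le_trans (tail_nonincreasing f c0 (lexx 0) S0))//.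
by rewrite tailE// set_itv1 Rintegral_set1 subr0 (ip_norm ipP).
Qed.

(* Markov's inequality: G is, in spectral terms, the truncated first moment. *)
Lemma tail_resolvent_le f S c : 0 < S -> 0 <= c ->
  S * tail (A f) (A f) S c <= ip (A f) f + c * `|f| ^+ 2.
Proof.
move=> S0 c0.
(* This is (A^2 exp(- sA) Q_r f, f), the wave that enters [tail] when both arguments are A f. *)
pose w2 s r := wave1 f (A f) s r.
have w2E s r : wave (A f) (A f) s r = w2 s r.
  by rewrite /w2 /wave1 /wave -(resolvent_ds ipP a0 QP) (rexp_resolvent ipP a0 QP).
have ts s : tail (A f) (A f) s c =
    w2 s 0 + \int[leb]_(r in `[0, c]) (w2 s r * (s * besselH1 (s * r))).
  rewrite /tail -wave0 w2E; congr (_ + _).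
  by apply: eq_Rintegral => r _; rewrite w2E.
pose F s r := (s * besselH1 (s * r)) * (wave1 f f s r + (c - r) * wave f f s r).
pose F' s r := besselH (s * r) * (wave1 f f s r + (c - r) * wave f f s r) +
  (s * besselH1 (s * r)) * (- w2 s r + (c - r) * - wave1 f f s r).
(* Chosen so that G' is minus the tail on A f. Then G 0 - G S is the integral of that tail over
   [0, S], bounded by G 0 because G S >= 0. *)
pose G s := wave1 f f s 0 + c * wave f f s 0 + \int[leb]_(r in `[0, c]) F s r.
have ccr : continuous (fun r => c - r).
  by move=> r; apply: cvgB; [exact: cvg_cst|exact: cvg_id].
have cD (h k : R -> R) : continuous h -> continuous k -> continuous (fun x => h x + k x).
  by move=> ch ck x; apply: cvgD; [exact: ch|exact: ck].
have cB (h k : R -> R) : continuous h -> continuous k -> continuous (fun x => h x - k x).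
  by move=> ch ck x; apply: cvgB; [exact: ch|exact: ck].
have cF s : continuous (F s).
  apply: continuous_mul; first exact: continuous_h1.
  by apply: (cD); [exact: cw1_r|apply: continuous_mul => //; exact: cw_r].
have dF s r : is_derive s 1 (F^~ r) (F' s r).
  have h1 := is_derive_kernel s r.
  have h2 : is_derive s 1 ((wave f f)^~ r) (- wave1 f f s r).
    exact: (is_derive_waves ipP a0 QP).
  have h3 : is_derive s 1 ((wave1 f f)^~ r) (- w2 s r).
    exact: (is_derive_wave1s ipP a0 QP).
  exact: is_derive_mul_affine.
have cF1 s : continuous (fun r => besselH (s * r) * wave1 f f s r + (c - r) *
    (besselH (s * r) * wave f f s r - s * besselH1 (s * r) * wave1 f f s r)).
  apply: cD.
    by apply: continuous_mul; [exact: continuous_besselHr|exact: cw1_r].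
  apply: continuous_mul => //; apply: cB.
    by apply: continuous_mul; [exact: continuous_besselHr|exact: cw_r].
  by apply: continuous_mul; [exact: continuous_h1|exact: cw1_r].
(* Apart from the term in [w2], F' is the r-derivative of (r - c) H(sr) [wave1], which vanishes at r
   = c and is - c [wave1] at r = 0. *)
have F'E s : \int[leb]_(r in `[0, c]) F' s r = c * wave1 f f s 0 -
    \int[leb]_(r in `[0, c]) (w2 s r * (s * besselH1 (s * r))).
  have i1 : \int[leb]_(r in `[0, c]) (besselH (s * r) * wave1 f f s r + (c - r) *
    (besselH (s * r) * wave f f s r - s * besselH1 (s * r) * wave1 f f s r)) =
    c * wave1 f f s 0.
    have -> : c * wave1 f f s 0 = wave1 f f s c * ((c - c) * besselH (s * c)) -
        wave1 f f s 0 * ((0 - c) * besselH (s * 0)).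
      by rewrite mulr0 besselH0; ring.
    apply: (@Rint_FTC2 _ (fun r => wave1 f f s r * ((r - c) * besselH (s * r)))) => //.
    - apply: continuous_mul; first exact: cw1_r.
      apply: continuous_mul; last exact: continuous_besselHr.
      by move=> r; apply: cvgB; [exact: cvg_id|exact: cvg_cst].
    - move=> r /andP[r0 _].
      have h1 := is_derive_wave1r ipP a0 QP f f s r0.
      have h2 : is_derive r 1 (fun r => besselH (s * r)) (s * besselH1 (s * r)).
        have -> : (fun r => besselH (s * r)) = (fun r => besselH (r * s)).
          by apply/funext => x; rewrite mulrC.
        by rewrite [s * r]mulrC; exact: is_derive_besselHl.
      have h3 : is_derive r 1 (fun r => r - c) 1 by apply: is_derive_eq; rewrite subr0.
      have := is_derive_mul3 h1 h3 h2; move/is_derive_eq; apply; ring.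
  rewrite -i1 -[X in _ - X]mul1r -mulNr -RintZ; last first.
    by apply: continuous_mul; [exact: cw1_r|exact: continuous_h1].
  rewrite -RintD//; last first.
    apply: continuous_mul; first exact: cst_continuous.
    by apply: continuous_mul; [exact: cw1_r|exact: continuous_h1].
  by apply: eq_Rintegral => r _; rewrite /F'; ring.
have dG s : is_derive s 1 G (- tail (A f) (A f) s c).
  have h2 : is_derive s 1 ((wave f f)^~ 0) (- wave1 f f s 0).
    exact: (is_derive_waves ipP a0 QP).
  have h3 : is_derive s 1 ((wave1 f f)^~ 0) (- w2 s 0).
    exact: (is_derive_wave1s ipP a0 QP).
  have h4 : is_derive s 1 (fun s => \int[leb]_(r in `[0, c]) F s r)
      (\int[leb]_(r in `[0, c]) F' s r).
    apply: is_derive_Rint_param => //.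
    have [C1 hC1] := wave_bounded ipP a0 QP f f (`|s| + 1).
    have [C2 hC2] := wave_bounded ipP a0 QP f (A f) (`|s| + 1).
    exists (expR (`|s| + 1 + `|0 : R|) * expR c * (C1 + c * C1) +
      (`|s| + 1) * (expR (`|s| + 1 + `|0 : R|) * expR c) * (C2 + c * C1)).
    move=> s' r ss' rc; have /andP[r0 rlec] := rc.
    have s's : `|s'| <= `|s| + 1.
      by rewrite -[s'](subrK s) addrC (le_trans (ler_normD _ _))// lerD2l ltW.
    have [k1 k2] := norm_kernel_le 0 s's rc; rewrite subr0 in k1 k2.
    have [l1 l2] := hC1 s' r s's r0; have [_ l3] := hC2 s' r s's r0.
    have cr : `|c - r| <= c by rewrite ger0_norm ?subr_ge0// lerBlDr lerDl.
    rewrite /F' (le_trans (ler_normD _ _))//; apply: lerD; rewrite normrM; apply: ler_pM => //.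
    - by rewrite (le_trans (ler_normD _ _))// lerD// normrM ler_pM.
    - by rewrite normrM ler_pM.
    - by rewrite (le_trans (ler_normD _ _))// normrN lerD// normrM normrN ler_pM.
  have := is_derive_add3 c h3 h2 h4; move/is_derive_eq; apply.
  by rewrite F'E ts; ring.
have G0 : G 0 = ip (A f) f + c * `|f| ^+ 2.
  rewrite /G wave0 wave10 (rexp0 ipP a0 QP) (ip_norm ipP) -[RHS]addr0; congr (_ + _).
  rewrite -[RHS](mul0r (\int[leb]_(r in `[0, c]) cst (0 : R) r)) -RintZ; last exact: cst_continuous.
  by apply: eq_Rintegral => r _; rewrite /F (mul0r (besselH1 _)) !mul0r.
have GS : 0 <= G S.
  rewrite /G !addr_ge0 ?wave1_ge0 ?(ltW S0)//.
    by rewrite mulr_ge0// wave_ge0// ltW.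
  apply: Rint_ge0 => r /andP[r0 rc].
  rewrite /F mulr_ge0//.
    by rewrite mulr_ge0 ?besselH1_ge0 ?mulr_ge0// ltW.
  by rewrite addr_ge0 ?wave1_ge0 ?(ltW S0)// mulr_ge0 ?subr_ge0// wave_ge0// ltW.
have cG : {within `[0, S], continuous G}.
  by apply: continuous_subspaceT => x; exact: is_derive_continuous (dG x).
(* The intermediate point x lies below S, where the tail is at least as large as at S. *)
have [x] := MVT S0 (fun x _ => dG x) cG.
rewrite in_itv/= => /andP[x0 xS] GG.
have := tail_nonincreasing (A f) c0 (ltW x0) (ltW xS).
rewrite -G0 => h; rewrite subr0 in GG.
have := ler_wpM2l (ltW S0) h; lra.
Qed.

End tail.

Lemma eq_is_bochner_integral d (T : measurableType d) (R : realType)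
    (V : normedModType R) (mu : {measure set T -> \bar R}) (D : set T)
    (f g : T -> V) v : (forall x, D x -> f x = g x) ->
  is_bochner_integral mu D f v -> is_bochner_integral mu D g v.
Proof.
move=> fg [s [hs sf ds sv]]; exists s; split => //.
  by apply: filterS sf => x /[swap] Dx /(_ Dx); rewrite fg.
have -> : (fun n => \int[mu]_(x in D) `|g x - s n x|%:E)%E =
    (fun n => \int[mu]_(x in D) `|f x - s n x|%:E)%E => //.
by apply/funext => n; apply: eq_integral => x /set_mem Dx; rewrite fg.
Qed.

Lemma eq_bochner d (T : measurableType d) (R : realType)
    (V : normedModType R) (mu : {measure set T -> \bar R}) (D : set T)
    (f g : T -> V) : (forall x, D x -> f x = g x) ->
  (bochner_integrable mu D f -> bochner_integrable mu D g) /\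
  bochner_integral mu D f = bochner_integral mu D g.
Proof.
move=> fg; split.
  by move=> [v hv]; exists v; exact: eq_is_bochner_integral hv.
rewrite /bochner_integral; congr xget; apply/funext => v; apply/propext.
by split; apply: eq_is_bochner_integral => x Dx; rewrite fg.
Qed.

(** * The inversion formula *)

Section inversion.
Context (R : realType) (V : completeNormedModType R) (ip : V -> V -> R).
Hypothesis ipP : inner_product ip.
Let ipF := ip_form ipP.
Variables (a : R) (Q : R -> V -> V).
Hypothesis a0 : 0 < a.
Hypothesis QP : decaying_semigroup ip a Q.
Local Notation leb := (@lebesgue_measure R).
Local Notation A := (resolvent Q).
Local Notation E := (rexp a Q).
Local Notation wave1 := (wave1 ip a Q).
Local Notation tail := (tail ip a Q).
Implicit Types (f g w : V) (r s S c N : R).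

Let M := a^-1.
Let M0 : 0 < M. Proof. by rewrite invr_gt0. Qed.

(** The derivative in s is available only for the pairings. The mean value theorem gives each of
    them a Lipschitz bound proportional to |w|, since [K s] bounds |A exp(- xA) A f| for |x| <= |s|
    + 1; this is continuity in norm. *)
Lemma continuous_resolvent_rexp f : continuous (fun s => A (E s f)).
Proof.
pose K s := M * (expR (3 * M * (`|s| + 1)) * (M * `|f|)).
have K0 s : 0 <= K s by rewrite !mulr_ge0 ?expR_ge0// ltW.
have lip s t : `|t - s| <= 1 -> `|A (E t f) - A (E s f)| <= K s * `|t - s|.
  move=> ts; apply: (norm_le_weak ipP); first by rewrite mulr_ge0.
  move=> w; rewrite (formBl ipF).
  have D (x : R) : is_derive x 1 (fun x => ip (A (E x f)) w) (- ip (A (E x (A f))) w).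
    have -> : (fun x => ip (A (E x f)) w) = (fun x => ip (E x (A f)) w).
      by apply/funext => y; rewrite (rexp_resolvent ipP a0 QP).
    exact: (is_derive_rexp ipP a0 QP).
  have dle (x : R) : `|x| <= `|s| + 1 -> `|- ip (A (E x (A f))) w| <= K s * `|w|.
    move=> xs; rewrite normrN (le_trans (norm_ip_le ipP _ _))// ler_wpM2r//.
    rewrite (le_trans (norm_resolvent_le ipP a0 QP _))// ler_wpM2l ?(ltW M0)//.
    rewrite (le_trans (norm_rexp_le ipP a0 QP _ _))// ler_pM ?expR_ge0//.
      by rewrite ler_expR ler_wpM2l// mulr_ge0// ltW.
    exact: (norm_resolvent_le ipP a0 QP).
  have cD (x y : R) : {within `[x, y], continuous (fun x => ip (A (E x f)) w)}.
    by apply: continuous_subspaceT => z; exact: is_derive_continuous (D z).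
  have bnd (x : R) : `|x - s| <= `|t - s| -> `|x| <= `|s| + 1.
    move=> h; rewrite -[x](subrK s) addrC (le_trans (ler_normD _ _))// lerD2l.
    exact: le_trans ts.
  apply: (le_trans (ler_norm _)).
  have /orP[st|st] := le_total s t.
    have [x] := MVT_segment st (fun x _ => D x) (cD s t).
    rewrite in_itv/= => /andP[sx xt] ->; rewrite normrM mulrAC ler_wpM2r// dle// bnd//.
    by rewrite !ger0_norm ?subr_ge0// lerD2r.
  have [x] := MVT_segment st (fun x _ => D x) (cD t s).
  rewrite in_itv/= => /andP[tx xs] h.
  rewrite distrC h normrM mulrAC [X in _ * X <= _]distrC ler_wpM2r// dle// bnd//.
  by rewrite ler0_norm ?subr_le0// ler0_norm ?subr_le0// lerN2 lerD2r.
move=> s; have nb (x : R) : 0 < x -> \forall t \near s, `|t - s| <= x.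
  move=> x0; have /cvgrPdist_le/(_ _ x0) : t @[t --> s] --> s by exact: cvg_id.
  by apply: filterS => t; rewrite distrC.
apply/cvgrPdist_le => e e0; near=> t.
have ts1 : `|t - s| <= 1 by near: t; exact: nb.
rewrite distrC (le_trans (lip _ _ ts1))//.
have : `|t - s| <= e / (K s + 1).
  by near: t; apply: nb; rewrite divr_gt0// ltr_wpDl.
move=> h; apply: (le_trans (ler_wpM2l (K0 s) h)).
by rewrite mulrCA ler_piMr ?(ltW e0)// ler_pdivrMr ?ltr_wpDl// mul1r lerDl.
Unshelve. all: by end_near. Qed.

Fact truncation_key : unit. Proof. exact: tt. Qed.
Definition truncation := locked_with truncation_key (fun S c g =>
  bochner_integral leb `[0, S] (fun s => besselH (s * c) *: A (E s g))).
Local Notation W := truncation.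

Let cH c : continuous (fun s => besselH (s * c)).
Proof.
have -> : (fun s => besselH (s * c)) = (fun s => besselH (c * s)).
  by apply/funext => s; rewrite mulrC.
exact: continuous_besselHr.
Qed.

Let ctrunc c g : continuous (fun s => besselH (s * c) *: A (E s g)).
Proof. by move=> s; apply: cvgZ; [exact: cH|exact: continuous_resolvent_rexp]. Qed.

Lemma truncation_integrable S c g : 0 <= S -> 0 <= c ->
  bochner_integrable leb `[0, S] (fun s => besselH (s * c) *: A (E s g)).
Proof.
move=> S0 c0; have cf := @ctrunc c g.
pose K := expR (S + `|0 : R|) * expR c * (M * (expR (3 * M * S) * `|g|)).
have K0 : 0 <= K by rewrite !mulr_ge0 ?expR_ge0// ltW.
apply: (bochner_integrable_continuous ipP (C := K * expR S) (b := 1)) => //.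
- by move=> x /=; rewrite in_itv/= => /andP[].
- move=> x y /=; rewrite !in_itv/= => /andP[_ xS] /andP[y0 yx].
  by rewrite y0 (le_trans yx).
- by rewrite mulr_ge0 ?expR_ge0.
- move=> s /=; rewrite in_itv/= => /andP[s0 sS]; rewrite normrZ -mulrA -expRD.
  rewrite -[leLHS]mulr1; apply: ler_pM => //.
  + apply: ler_pM => //.
      have sS' : `|s| <= S by rewrite ger0_norm.
      have cc : 0 <= c <= c by rewrite c0 lexx.
      by have [] := norm_kernel_le 0 sS' cc; rewrite subr0.
    rewrite (le_trans (norm_resolvent_le ipP a0 QP _))// ler_wpM2l ?(ltW M0)//.
    rewrite (le_trans (norm_rexp_le ipP a0 QP _ _))// ler_wpM2r// ler_expR.
    by rewrite ger0_norm// ler_wpM2l// mulr_ge0// ltW.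
  + by rewrite -[leLHS]expR0 ler_expR mul1r subr_ge0.
- apply: continuous_integrable; exact: continuous_exp_decay.
Qed.

Lemma ip_truncation S c g w : 0 <= S -> 0 <= c ->
  ip (W S c g) w = \int[leb]_(s in `[0, S]) (besselH (s * c) * ip (A (E s g)) w).
Proof.
move=> S0 c0; have h := truncation_integrable g S0 c0.
have [_ e] := bochner_integral_ip ipP w (measurable_itv _) (@ctrunc c g) h.
rewrite /W locked_withE e; apply: eq_Rintegral => s _; exact: (formZl ipF).
Qed.

Lemma truncation_sym S c f g : 0 <= S -> 0 <= c -> ip (W S c f) g = ip f (W S c g).
Proof.
move=> S0 c0; rewrite (formC ipF f); apply: (etrans (ip_truncation _ _ S0 c0)).
apply: (etrans _ (esym (ip_truncation _ _ S0 c0))).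
apply: eq_Rintegral => s _; congr (_ * _).
by rewrite (resolvent_sym ipP a0 QP) (rexp_sym ipP a0 QP) (rexp_resolvent ipP a0 QP) (formC ipF).
Qed.

(** Read off from symmetry, with the other argument held fixed. *)
Lemma truncation_lin S c b f g : 0 <= S -> 0 <= c ->
  W S c (b *: f + g) = b *: W S c f + W S c g.
Proof.
move=> S0 c0; apply: (ip_inj ipP) => w.
by rewrite (formDl ipF) (formZl ipF) !truncation_sym// (formDl ipF) (formZl ipF).
Qed.

Lemma truncation_ds S c r f : 0 <= S -> 0 <= c -> W S c (Q r f) = Q r (W S c f).
Proof.
move=> S0 c0; apply: (ip_inj ipP) => w.
rewrite (ds_sym QP); apply: (etrans (ip_truncation _ _ S0 c0)).
apply: (etrans _ (esym (ip_truncation _ _ S0 c0))).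
apply: eq_Rintegral => s _; congr (_ * _).
by rewrite (rexp_ds ipP a0 QP) (resolvent_ds ipP a0 QP) (ds_sym QP).
Qed.

Lemma ip_truncation_ds S c f w : 0 <= S -> 0 <= c ->
  ip (W S c (Q c f)) w = ip f w - tail f w S c.
Proof.
move=> S0 c0; rewrite (tailE ipP a0 QP)// subKr.
exact: ip_truncation.
Qed.

Lemma truncation_nondecreasing s S c f : 0 <= s -> s <= S -> 0 <= c ->
  ip (W s c f) f <= ip (W S c f) f.
Proof.
move=> s0 sS c0; have S0 := le_trans s0 sS.
rewrite (ip_truncation f f s0 c0) (ip_truncation f f S0 c0).
apply: Rint_nondecreasing => //.
  apply: continuous_mul; first exact: cH.
  by apply: (continuous_ip ipP); exact: continuous_resolvent_rexp.
move=> x x0; rewrite mulr_ge0 ?besselH_ge0 ?mulr_ge0//.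
exact: (resolvent_rexp_ge0 ipP a0 QP).
Qed.

(** The witness y = (f - Q_h f) / h satisfies A y = (1/h) int_0^h Q_r f dr, an average close to f by
    strong continuity. *)
Lemma resolvent_dense f e : 0 < e -> exists y, `|f - A y| <= e.
Proof.
move=> e0; have cQ : continuous (fun r => Q r f) by exact: (ds_cont QP).
have /cvgrPdist_le/(_ _ e0)/nbhs_ballP[d /= d0 hd] := cQ 0.
pose h := d / 2; have h0 : 0 < h by rewrite divr_gt0.
exists (h^-1 *: (f - Q h f)).
apply: (norm_le_weak ipP) => [|w]; first exact: ltW.
have cq : continuous (fun r => ip (Q r f) w).
  by apply: (continuous_ip ipP); exact: (ds_cont QP).
have ccst : continuous (fun _ : R => ip f w) by exact: cst_continuous.
have i0 : \int[leb]_(r in `[0, h]) ip f w = h * ip f w.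
  rewrite -[RHS]subr0 -{2}(mul0r (ip f w)).
  apply: (@Rint_FTC2 _ (fun r => r * ip f w)) => //; first exact: ltW.
    by apply: continuous_mul => //; move=> x; exact: cvg_id.
  by move=> x _; apply: is_derive_eq; rewrite /GRing.scale/= mulr1 mulr0 ?add0r ?addr0.
have -> : ip (f - A (h^-1 *: (f - Q h f))) w =
    h^-1 * \int[leb]_(r in `[0, h]) (ip f w + -1 * ip (Q r f) w).
  rewrite (formBl ipF) (resolvent_sym ipP a0 QP) (formZl ipF) (formBl ipF).
  rewrite -!(resolvent_sym ipP a0 QP) (ip_resolvent_ds ipP a0 QP) ?(ltW h0)//.
  rewrite RintD//; last by apply: continuous_mul => //; exact: cst_continuous.
  rewrite RintZ// i0; field; exact: lt0r_neq0.
rewrite ler_pdivrMl// [leRHS]mulrC.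
have := @norm_Rint_le R (fun r => ip f w + -1 * ip (Q r f) w) (e * `|w|) 0 h (ltW h0).
rewrite subr0 => H; rewrite (le_trans (ler_norm _))// H//.
  move=> x; apply: cvgD; first exact: cvg_cst.
  by apply: cvgM; [exact: cvg_cst|exact: cq].
move=> r /andP[r0 rh]; rewrite mulN1r -(formBl ipF) (le_trans (norm_ip_le ipP _ _))//.
rewrite ler_wpM2r// -[f in `|f - _|](ds_id QP) hd//= /ball/= sub0r normrN ger0_norm//.
by rewrite (le_lt_trans rh)// /h ltr_pdivrMr// ltr_pMr// ltr1n.
Qed.

(** The form of T_S is O(1/S) on the range of A, this range is dense, and 0 <= T_S <= I carries the
    decay over to every f. *)
Lemma tail_cvg0 f c e : 0 <= c -> 0 < e -> exists2 S0, 0 < S0 &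
  forall S, S0 <= S -> tail f f S c <= e.
Proof.
move=> c0 e0.
have e1 : 0 < Num.sqrt (e / 4) by rewrite sqrtr_gt0 divr_gt0.
have [y fy] := resolvent_dense f e1.
pose L := ip (A y) y + c * `|y| ^+ 2.
have L0 : 0 <= L by rewrite addr_ge0 ?(resolvent_ge0 ipP a0 QP)// mulr_ge0 ?exprn_ge0.
(* Makes L / S0 at most e/4: both the form at A y and |f - A y|^2 are allotted e/4, and [formD_le]
   doubles each. The summand 1 keeps S0 positive when L = 0. *)
pose S0 := 4 * L / e + 1.
have S00 : 0 < S0 by rewrite ltr_wpDl// divr_ge0 ?mulr_ge0// ltW.
exists S0 => // S SS0.
rewrite (le_trans (tail_nonincreasing ipP a0 QP f c0 (ltW S00) SS0))//.
have S0e : 0 <= S0 by exact: ltW.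
have tF : semidefinite_form (fun u v => tail u v S0 c).
  have tE u v : tail u v S0 c = ip u v - ip (W S0 c (Q c u)) v.
    by rewrite ip_truncation_ds// subKr.
  split=> [u v|u v z|b u z|u].
  - rewrite !tE (formC ipF u v); congr (_ - _).
    by rewrite truncation_sym// (ds_sym QP) truncation_ds// (formC ipF).
  - rewrite !tE (formDl ipF) -[u]scale1r (ds_lin QP) truncation_lin// !scale1r (formDl ipF); ring.
  - rewrite !tE (formZl ipF) -[b *: u]addr0 (ds_lin QP) truncation_lin// (formDl ipF) (formZl ipF).
    have -> : ip (W S0 c (Q c 0)) z = 0 by rewrite truncation_sym// (ds_sym QP) (form0l ipF).
    ring.
  - exact: (tail_ge0 ipP a0 QP).
have h1 := formD_le tF (A y) (f - A y); rewrite addrC subrK in h1.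
have h2 := tail_le ipP a0 QP (f - A y) S0e c0.
have h3 := tail_resolvent_le ipP a0 QP y S00 c0.
have h4 : `|f - A y| ^+ 2 <= e / 4.
  by rewrite -(sqr_sqrtr (a := e / 4)) ?divr_ge0 ?(ltW e0)// lerXn2r ?nnegrE ?sqrtr_ge0.
have h5 : tail (A y) (A y) S0 c <= e / 4.
  rewrite -(ler_pM2l S00) (le_trans h3)// -/L mulrC -ler_pdivrMl ?divr_gt0//.
  by rewrite /S0 invf_div mulrAC lerDl.
lra.
Qed.

(** Passes from the quadratic form to the norm: 0 <= T <= I gives |T f|^2 <= (T f, f). *)
Lemma norm_sub_truncation S c f : 0 <= S -> 0 <= c ->
  `|f - W S c (Q c f)| ^+ 2 <= tail f f S c.
Proof.
move=> S0 c0.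
have tE u v : ip (u - W S c (Q c u)) v = tail u v S c.
  by rewrite (formBl ipF) ip_truncation_ds// subKr.
rewrite -tE; apply: (norm_sqr_le_form ipP (T := fun u => u - W S c (Q c u))).
  split=> [u v|u v z|b u z|u].
  - rewrite (formC ipF _ u) (formBl ipF) (formBr ipF); congr (_ - _).
    by rewrite truncation_sym// (ds_sym QP) truncation_ds.
  - rewrite !(formBl ipF) (formDl ipF) -[u]scale1r (ds_lin QP) truncation_lin// !scale1r (formDl ipF); ring.
  - rewrite !(formBl ipF) (formZl ipF) -[b *: u in LHS]addr0 (ds_lin QP) truncation_lin// (formDl ipF) (formZl ipF).
    have -> : ip (W S c (Q c 0)) z = 0 by rewrite truncation_sym// (ds_sym QP) (form0l ipF).
    ring.
  - by rewrite tE; exact: (tail_ge0 ipP a0 QP).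
by move=> u; rewrite tE; exact: (tail_le ipP a0 QP).
Qed.

Theorem cvg_truncation c f : 0 <= c -> W N c (Q c f) @[N --> +oo] --> f.
Proof.
move=> c0; apply/cvgrPdist_le => e e0.
have [S0 S00 h] := tail_cvg0 f c0 (exprn_gt0 2 e0).
exists S0; split; first exact: num_real.
move=> S /ltW SS0; have S0' : 0 <= S by rewrite (le_trans _ SS0)// ltW.
rewrite -(@ler_pXn2r _ 2)// ?nnegrE ?(ltW e0)//.
exact: (le_trans (norm_sub_truncation f S0' c0) (h _ SS0)).
Qed.

Lemma ds_double t f : 0 <= t -> Q (2 * t) f = Q t (Q t f).
Proof. by move=> t0; rewrite -(ds_add QP)// mulr_natl mulr2n. Qed.

Lemma truncation_range_le S t f : 0 <= S -> 0 <= t ->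
  ip (W S (2 * t) (Q t f)) (Q t f) <= `|f| ^+ 2.
Proof.
move=> S0 t0; have t2 : 0 <= 2 * t by rewrite mulr_ge0.
have -> : ip (W S (2 * t) (Q t f)) (Q t f) = ip (W S (2 * t) (Q (2 * t) f)) f.
  by rewrite ds_double// !truncation_ds// [RHS](ds_sym QP).
rewrite ip_truncation_ds// (ip_norm ipP) lerBlDr lerDl.
exact: (tail_ge0 ipP a0 QP).
Qed.

Lemma norm_ds_le r f : `|Q r f| <= `|f|.
Proof.
rewrite (le_trans (ds_norm QP r f))// ler_piMl// -[leRHS]expR0 ler_expR.
by rewrite oppr_le0 mulr_ge0// ltW.
Qed.

(* With D = W S - W s and T = Q (2 t) D, this is (D (T g), g) <= (D g, g). *)
Lemma norm_truncation_increment_le s S t g : 0 <= s -> s <= S -> 0 <= t ->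
  `|Q t (W S (2 * t) g - W s (2 * t) g)| ^+ 2 <=
  ip (W S (2 * t) g) g - ip (W s (2 * t) g) g.
Proof.
move=> s0 sS t0; have S0 := le_trans s0 sS.
have t2 : 0 <= 2 * t by rewrite mulr_ge0.
pose D u := W S (2 * t) u - W s (2 * t) u.
pose T u := Q (2 * t) (D u).
have DE u v : ip (D u) v = ip (W S (2 * t) u) v - ip (W s (2 * t) u) v.
  by rewrite /D (formBl ipF).
have Dsym u v : ip (D u) v = ip u (D v).
  by rewrite /D (formBl ipF) (formBr ipF) !truncation_sym.
have bF : semidefinite_form (fun u v => ip (D u) v).
  split=> [u v|u v z|b u z|u].
  - by rewrite Dsym (formC ipF).
  - by rewrite !Dsym (formDl ipF).
  - by rewrite !Dsym (formZl ipF).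
  - by rewrite DE subr_ge0 truncation_nondecreasing.
have TE u : T u = W S (2 * t) (Q (2 * t) u) - W s (2 * t) (Q (2 * t) u).
  rewrite /T /D !truncation_ds//.
  have := linear_scaleB (ds_lin QP (2 * t)) 1 (W S (2 * t) u) (W s (2 * t) u).
  by rewrite !scale1r.
have ipT u v : ip (T u) v = tail u v s (2 * t) - tail u v S (2 * t).
  rewrite TE (formBl ipF) !ip_truncation_ds//; ring.
have Tsym u v : ip (T u) v = ip u (T v).
  rewrite /T (ds_sym QP) Dsym; congr (ip u _).
  by rewrite -/(T v) TE /D.
have TF : semidefinite_form (fun u v => ip (T u) v).
  split=> [u v|u v z|b u z|u].
  - by rewrite Tsym (formC ipF).
  - by rewrite !Tsym (formDl ipF).
  - by rewrite !Tsym (formZl ipF).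
  - by rewrite ipT subr_ge0 (tail_nonincreasing ipP a0 QP).
have T1 u : ip (T u) u <= `|u| ^+ 2.
  rewrite ipT lerBlDr (le_trans (tail_le ipP a0 QP u s0 t2))// lerDl.
  exact: (tail_ge0 ipP a0 QP).
have Tn u : `|T u| <= `|u|.
  rewrite -(@ler_pXn2r _ 2)// ?nnegrE//.
  exact: (le_trans (norm_sqr_le_form ipP TF T1 u)).
(* The bound T <= I for [ip] has to be carried over to the form (D u, v), for which T is symmetric
   as well; iterating Cauchy-Schwarz does this, since |T^n g| <= |g| keeps the iterates bounded. *)
have := @form_contraction _ _ (fun u v => ip (D u) v) T g (`|g| * `|D g|) bF.
have -> : ip (D (T g)) g = `|Q t (D g)| ^+ 2.
  by rewrite Dsym /T ds_double// (ds_sym QP) (ip_norm ipP).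
rewrite DE; apply.
  by move=> v w; rewrite Dsym /T (ds_sym QP).
move=> n; rewrite Dsym (le_trans (ip_le ipP _ _))// ler_wpM2r//.
by elim: n => //= n; exact: le_trans.
Qed.

Theorem range_of_truncation_bounded t g C : 0 <= t ->
  (forall N : nat, ip (W N%:R (2 * t) g) g <= C) -> exists f, Q t f = g.
Proof.
move=> t0 bnd; have t2 : 0 <= 2 * t by rewrite mulr_ge0.
pose u (n : nat) := ip (W n%:R (2 * t) g) g.
have u_nd : nondecreasing_seq u.
  by move=> n m nm; apply: truncation_nondecreasing => //; rewrite ler_nat.
have cu : cvgn u.
  by apply: nondecreasing_is_cvgn => //; exists C => _ [n _ <-]; exact: bnd.
pose l := limn u; have ul n : u n <= l by exact: nondecreasing_cvgn_le.
pose k (n : nat) := Q t (W n%:R (2 * t) g).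
have ksub n m : k m - k n = Q t (W m%:R (2 * t) g - W n%:R (2 * t) g).
  have := linear_scaleB (ds_lin QP t) 1 (W m%:R (2 * t) g) (W n%:R (2 * t) g).
  by rewrite !scale1r => ->.
(* By the increment estimate |k m - k n|^2 <= u m - u n <= l - u n, so that a bounded monotone real
   sequence yields a Cauchy sequence of vectors. *)
pose e n := Num.sqrt (l - u n).
have ke n m : (n <= m)%N -> `|k m - k n| <= e n.
  move=> nm; rewrite -(@ler_pXn2r _ 2)// ?nnegrE ?sqrtr_ge0//.
  rewrite sqr_sqrtr ?subr_ge0// ksub.
  have nm' : n%:R <= m%:R :> R by rewrite ler_nat.
  apply: (le_trans (norm_truncation_increment_le g (ler0n _ n) nm' t0)).
  by rewrite lerD2r; exact: ul.
have e0 : e n @[n --> \oo] --> 0.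
  rewrite -sqrtr0; apply: continuous_cvg; first exact: sqrt_continuous.
  by rewrite -(subrr l); apply: cvgB; [exact: cvg_cst|exact: cu].
have /cvg_ex[f kf] : cvgn k.
  apply: (cvgn_dist_le (N := 0%N) e0) => n m _ _.
  have [nm|/ltnW mn] := leqP n m.
    by rewrite (le_trans (ke _ _ nm))// lerDr sqrtr_ge0.
  by rewrite distrC (le_trans (ke _ _ mn))// lerDl sqrtr_ge0.
exists f.
have c1 : Q t (k n) @[n --> \oo] --> Q t f.
  apply/cvgrPdist_le => r r0; move/cvgrPdist_le : kf => /(_ r r0).
  apply: filterS => n; apply: le_trans.
  have := linear_scaleB (ds_lin QP t) 1 f (k n).
  by rewrite !scale1r => <-; exact: norm_ds_le.
have c2 : Q t (k n) @[n --> \oo] --> g.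
  have -> : (fun n => Q t (k n)) = (fun n : nat => W n%:R (2 * t) (Q (2 * t) g)).
    by apply/funext => n; rewrite /k truncation_ds// ds_double.
  apply: (@cvg_comp _ _ _ (fun n : nat => n%:R : R) (fun N => W N (2 * t) (Q (2 * t) g)) _ (pinfty_nbhs R)).
    exact: cvgr_idn.
  exact: cvg_truncation.
exact: (cvg_unique _ c1 c2).
Qed.

End inversion.

(** * The space L^2 *)

Section L2_theory.
Context d (T : measurableType d) (R : realType) (mu : {measure set T -> \bar R}).
Implicit Types (u v w : L2 mu).
Local Notation Lf := (LfunType mu (lee1n 2)).

Lemma L2_fun_toL2 (f : Lf) : {ae mu, forall x, L2_fun (toL2 f) x = f x}.
Proof.
have /ae_nullP h : (repr (toL2 f) : Lf) - f \in @ae_null _ T R mu.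
  by rewrite toL2_eq /toL2 reprK.
by apply: filterS h => x /(_ I) /= /eqP; rewrite subr_eq0 => /eqP.
Qed.

Lemma measurable_L2_fun u : measurable_fun setT (L2_fun u).
Proof. by []. Qed.
Hint Resolve measurable_L2_fun : core.

Lemma L2_funD u v : {ae mu, forall x, L2_fun (u + v) x = L2_fun u x + L2_fun v x}.
Proof.
have -> : u + v = toL2 ((repr u : Lf) + repr v) by rewrite toL2D /toL2 !reprK.
by apply: filterS (L2_fun_toL2 ((repr u : Lf) + repr v)) => x ->.
Qed.

Lemma L2_funZ a u : {ae mu, forall x, L2_fun (a *: u) x = a * L2_fun u x}.
Proof. by apply: filterS (L2_fun_toL2 (a *: (repr u : Lf))) => x e; exact: e. Qed.

Lemma L2_funB u v : {ae mu, forall x, L2_fun (u - v) x = L2_fun u x - L2_fun v x}.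
Proof.
have -> : u - v = u + (-1) *: v by rewrite scaleN1r.
by apply: filterS2 (L2_funD u ((-1) *: v)) (L2_funZ (-1) v) => x -> ->; rewrite mulN1r.
Qed.

Lemma integrable_L2_funM u v : mu.-integrable setT (EFin \o (fun x => L2_fun u x * L2_fun v x)).
Proof. by apply/Lfun1_integrable; apply: Lfun2_mul_Lfun1; exact: LfunP. Qed.

Lemma eq_L2_inner u v (h : T -> R) : measurable_fun setT h ->
  {ae mu, forall x, L2_fun u x * L2_fun v x = h x} -> L2_inner u v = \int[mu]_x h x.
Proof.
move=> mh e; congr fine; apply: ae_eq_integral => //.
- by apply/measurable_EFinP; exact: measurable_funM.
- exact/measurable_EFinP.
- by apply: filterS e => x -> _.
Qed.

Lemma L2_form : semidefinite_form (@L2_inner _ T R mu).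
Proof.
split=> [u v|u v w|a u w|u].
- by rewrite /L2_inner; under eq_Rintegral do rewrite mulrC.
- rewrite -RintegralD//; [|exact: integrable_L2_funM..].
  apply: eq_L2_inner; first by apply: measurable_funD; exact: measurable_funM.
  by apply: filterS (L2_funD u v) => x ->; rewrite mulrDl.
- rewrite -RintegralZl//; last exact: integrable_L2_funM.
  apply: eq_L2_inner; first by apply: measurable_funM => //; exact: measurable_funM.
  by apply: filterS (L2_funZ a u) => x ->; rewrite mulrA.
- by apply: Rintegral_ge0 => x _; rewrite -expr2 sqr_ge0.
Qed.

Lemma L2_norm_sqrE u : (\int[mu]_x (L2_fun u x ^+ 2)%:E = (`|u| ^+ 2)%:E)%E.
Proof.
rewrite -[ `|u| ]/(L2_norm u) /L2_norm /L2_fun -powR_mulrn; last first.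
  by rewrite fine_ge0// Lnorm_ge0.
rewrite -poweR_EFin finite_norm_fine poweR_Lnorm//.
by apply: eq_integral => x _; rewrite /= powR_mulrn// -normrX ger0_norm ?sqr_ge0.
Qed.

Lemma L2_inner_product : inner_product (@L2_inner _ T R mu).
Proof.
split=> [|u]; first exact: L2_form.
by rewrite -[RHS]/(fine (`|u| ^+ 2)%:E) -L2_norm_sqrE.
Qed.

Lemma L2_of_fun (f : T -> R) : measurable_fun setT f ->
  (\int[mu]_x (f x ^+ 2)%:E < +oo)%E -> exists u, {ae mu, forall x, L2_fun u x = f x}.
Proof.
move=> mf If; have fP : f \in Lfun mu 2%:E.
  rewrite inE; apply/andP; split; rewrite inE//= /finite_norm unlock /Lnorm.
  apply: poweR_lty; apply: le_lt_trans If; rewrite le_eqVlt; apply/orP; left; apply/eqP.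
  by apply: eq_integral => x _; rewrite /= powR_mulrn// -normrX ger0_norm ?sqr_ge0.
by exists (toL2 (Lfun_Sub (lee1n 2) fP)); exact: L2_fun_toL2.
Qed.

End L2_theory.

(** A Cauchy filter contains balls of radius 4^-n / 2. Consecutive ones meet, so that their centres
    form a sequence as in the hypothesis, and the filter converges to its limit. *)
Lemma cvg_of_fast_sequences (R : realType) (V : normedModType R) :
  (forall u : V^nat, (forall n, `|u n.+1 - u n| <= (4^-1) ^+ n) -> cvgn u) ->
  forall F : set_system V, ProperFilter F -> cauchy F -> cvg F.
Proof.
move=> fast F FF /cauchyP cF.
have e0 n : 0 < (4^-1 : R) ^+ n / 2 by rewrite divr_gt0// exprn_gt0// invr_gt0.
have /choice[u Fu] : forall n, exists x, F (ball x ((4^-1) ^+ n / 2)) by move=> n; exact: cF.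
have /cvg_ex[l ul] : cvgn u.
  apply: fast => n.
  have /filter_ex[x [h1 h2]] : F (ball (u n) ((4^-1) ^+ n / 2) `&`
      ball (u n.+1) ((4^-1) ^+ n.+1 / 2)) by apply: filterI.
  move: h1 h2; rewrite -!ball_normE /= => h1 h2.
  have -> : u n.+1 - u n = (u n.+1 - x) - (u n - x).
    by rewrite opprB subrKA.
  apply: (le_trans (ler_normB _ _)); apply: (le_trans (lerD (ltW h2) (ltW h1))).
  rewrite exprS; have : 0 <= (4^-1 : R) ^+ n by rewrite exprn_ge0// invr_ge0.
  move: ((4^-1 : R) ^+ n) => c c0; lra.
apply/cvg_ex; exists l; apply/cvgrPdist_lt => e e_gt0.
have e2 : 0 < e / 2 by rewrite divr_gt0.
have c4 : (4^-1 : R) ^+ n @[n --> \oo] --> 0.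
  by apply: cvg_expr; rewrite ger0_norm ?invr_ge0// invf_lt1// ltr1n.
near \oo => n.
have h : F (ball (u n) ((4^-1) ^+ n / 2)) by exact: Fu.
apply: filterS h => x; rewrite -ball_normE /= => h.
have -> : l - x = (l - u n) + (u n - x) by rewrite addrA subrK.
apply: (le_lt_trans (ler_normD _ _)); rewrite [e]splitr; apply: ltrD.
  by near: n; move/cvgrPdist_lt : ul; apply.
apply: (lt_trans h).
have : `|0 - (4^-1 : R) ^+ n| < e by near: n; move/cvgrPdist_lt : c4; apply.
rewrite sub0r normrN ger0_norm ?exprn_ge0 ?invr_ge0// => h4.
by rewrite ltr_pM2r.
Unshelve. all: by end_near. Qed.

Lemma cvg_geometric_steps (R : realType) (u : R^nat) c :
  (forall n, `|u n.+1 - u n| <= c * (2^-1) ^+ n) ->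
  cvgn u /\ forall n, `|limn u - u n| <= 2 * c * (2^-1) ^+ n.
Proof.
move=> h.
have e0 n : 0 <= (2^-1 : R) ^+ n by rewrite exprn_ge0// invr_ge0.
have c0 : 0 <= c by have := le_trans (normr_ge0 _) (h 0%N); rewrite expr0 mulr1.
have step n k : `|u (n + k)%N - u n| <= 2 * c * (2^-1) ^+ n - 2 * c * (2^-1) ^+ (n + k)%N.
  elim: k => [|k IH]; first by rewrite addn0 !subrr normr0.
  have -> : u (n + k.+1)%N - u n = (u (n + k).+1 - u (n + k)%N) + (u (n + k)%N - u n).
    by rewrite addnS addrA subrK.
  apply: (le_trans (ler_normD _ _)); apply: (le_trans (lerD (h _) IH)).
  by rewrite addnS exprS; lra.
have e1 : 2 * c * (2^-1) ^+ n @[n --> \oo] --> (0 : R).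
  rewrite -[X in _ --> X](mulr0 (2 * c)); apply: cvgMl_tmp.
  by apply: cvg_expr; rewrite ger0_norm ?invr_ge0// invf_lt1// ltr1n.
have dist n m : (n <= m)%N -> `|u m - u n| <= 2 * c * (2^-1) ^+ n.
  move=> nm; have := step n (m - n)%N; rewrite subnKC// => s; apply: (le_trans s).
  by rewrite gerBl mulr_ge0// mulr_ge0.
have cu : cvgn u.
  apply: (cvgn_dist_le (N := 0%N) e1) => n m _ _.
  have [nm|/ltnW mn] := leqP n m.
    by rewrite (le_trans (dist _ _ nm))// lerDr mulr_ge0// mulr_ge0.
  by rewrite distrC (le_trans (dist _ _ mn))// lerDl mulr_ge0// mulr_ge0.
split=> // n.
have c1 : `|u m - u n| @[m --> \oo] --> `|limn u - u n|.
  by apply: cvg_norm; apply: cvgB => //; exact: cvg_cst.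
apply: (cvgr_to_le c1).
by near=> m; apply: dist; near: m; exact: nbhs_infty_ge.
Unshelve. all: by end_near. Qed.

(** * Completeness of L^2 *)

Section L2_complete.
Context d (T : measurableType d) (R : realType) (mu : {measure set T -> \bar R}).

(* On the set where S = sum_n 4^n |u_{n+1} - u_n|^2 is finite, the steps of u are
   at most sqrt S / 2^n, so that u converges pointwise with |u - u_n| <= 2 sqrt S / 2^n. *)
Lemma L2_cvg_fast (u : (L2 mu)^nat) :
  (forall n, `|u n.+1 - u n| <= (4^-1) ^+ n) -> cvgn u.
Proof.
move=> fast.
pose g n x : R := 4 ^+ n * (L2_fun (u n.+1) x - L2_fun (u n) x) ^+ 2.
have g0 n x : 0 <= g n x by rewrite mulr_ge0// ?sqr_ge0// exprn_ge0.
have mg n : measurable_fun setT (g n).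
  by apply: measurable_funM => //; apply: measurable_funX; exact: measurable_funB.
have Ig n : (\int[mu]_x (g n x)%:E <= (2 / (2 ^ (n + 1))%:R)%:E)%E.
  have -> : (2 / (2 ^ (n + 1))%:R : R) = (2^-1) ^+ n.
    by rewrite addn1 natrX exprS invfM mulrA divff// mul1r exprVn.
  have -> : (\int[mu]_x (g n x)%:E = (4 ^+ n * `|u n.+1 - u n| ^+ 2)%:E)%E.
    rewrite EFinM -L2_norm_sqrE -ge0_integralZl//; last 2 first.
    - by apply/measurable_EFinP; exact: measurable_funX.
    - by move=> x _; rewrite lee_fin sqr_ge0.
    apply: ae_eq_integral => //; first exact/measurable_EFinP.
      by apply/measurable_EFinP; apply: measurable_funM => //; exact: measurable_funX.
    by apply: filterS (L2_funB (u n.+1) (u n)) => x -> _; rewrite -EFinM.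
  rewrite lee_fin; have h4 : 0 <= (4 : R) ^+ n by rewrite exprn_ge0.
  (* The steps are small enough for 4^n (4^-n)^2 = 4^-n to remain summable in spite of the weight
     4^n. *)
  apply: (@le_trans _ _ (4 ^+ n * ((4^-1) ^+ n) ^+ 2)).
    by apply: ler_wpM2l => //; rewrite lerXn2r// ?nnegrE ?exprn_ge0 ?invr_ge0//; exact: fast.
  rewrite expr2 mulrA -exprMn divff// expr1n mul1r lerXn2r ?nnegrE ?invr_ge0//.
  by rewrite lef_pV2 ?posrE// ler_nat.
pose S x := (\sum_(n <oo) (g n x)%:E)%E.
have S0 x : (0 <= S x)%E by apply: nneseries_ge0 => n _ _; rewrite lee_fin.
have mS : measurable_fun setT S.
  by apply: ge0_emeasurable_sum => // [n x _ _|n _]; [rewrite lee_fin|exact/measurable_EFinP].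
have IS : (\int[mu]_x S x <= 2%:E)%E.
  rewrite integral_nneseries//; last 2 first.
  - by move=> n; exact/measurable_EFinP.
  - by move=> n x _; rewrite lee_fin.
  apply: (@le_trans _ _ (\sum_(n <oo) (2 / (2 ^ (n + 1))%:R)%:E)%E).
    by apply: lee_nneseries => // n _ _; apply: integral_ge0 => x _; rewrite lee_fin.
  have := @cvg_geometric_eseries_half R 2 0.
  by rewrite expr0 divr1 => h; rewrite (cvg_lim _ h).
pose A := [set x | S x \is a fin_num].
have mA : measurable A by rewrite -[A]setTI; exact: emeasurable_fin_num.
have aeA : {ae mu, forall x, A x}.
  have iS : mu.-integrable setT S.
    apply/integrableP; split=> //; under eq_integral => x _ do rewrite gee0_abs//.
    exact: le_lt_trans IS (ltry _).
  by apply: filterS (integrable_ae measurableT iS) => x /(_ I).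
(* Cut off to A, the sequence converges at every point and not only almost everywhere, so that its
   pointwise limit is measurable. *)
pose v n x := L2_fun (u n) x * \1_A x.
have mv n : measurable_fun setT (v n) by apply: measurable_funM.
pose c x := Num.sqrt (fine (S x)).
have step x n : `|v n.+1 x - v n x| <= c x * (2^-1) ^+ n.
  rewrite -mulrBl indicE; have [Ax|_] := boolP (x \in A); last first.
    by rewrite mulr0 normr0 mulr_ge0 ?sqrtr_ge0// exprn_ge0// invr_ge0.
  rewrite inE in Ax; rewrite mulr1 -sqrtr_sqr.
  have h2 : 0 <= (2^-1 : R) ^+ n by rewrite exprn_ge0// invr_ge0.
  rewrite -[X in _ * X](ger0_norm h2) -[X in _ * X]sqrtr_sqr -sqrtrM ?fine_ge0//.
  apply: ler_wsqrtr; have : g n x <= fine (S x).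
    rewrite -lee_fin fineK//; apply: le_trans (nneseries_lim_ge n.+1 _); last first.
      by move=> k _ _; rewrite lee_fin.
    by rewrite big_nat_recr//= leeDr// sume_ge0// => k _; rewrite lee_fin.
  have p4 : 0 < (4 : R) ^+ n by rewrite exprn_gt0.
  rewrite /g -ler_pdivlMl// => /le_trans; apply.
  by rewrite mulrC exprAC (_ : (2^-1 : R) ^+ 2 = 4^-1) ?exprVn//; field.
have lim x := cvg_geometric_steps (step x).
pose f x := limn (v ^~ x).
have mf : measurable_fun setT f.
  by apply: (measurable_fun_cvg mv) => x _; exact: (lim x).1.
(* The square of 2 sqrt S / 2^n is 4 S / 4^n, and S has integral at most 2; hence the constant 8. *)
have If n : (\int[mu]_x ((f x - v n x) ^+ 2)%:E <= (8 * (4^-1) ^+ n)%:E)%E.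
  apply: (@le_trans _ _ (\int[mu]_x ((4 * (4^-1) ^+ n)%:E * S x))%E).
    apply: ge0_le_integral => //.
    - by move=> x _; rewrite lee_fin sqr_ge0.
    - by apply/measurable_EFinP; apply: measurable_funX; exact: measurable_funB.
    - by apply: measurable_funeM.
    - move=> x _; apply: (@le_trans _ _ ((4 * (4^-1) ^+ n)%:E * (fine (S x))%:E)%E).
        rewrite -EFinM lee_fin -real_normK ?num_real//.
        have : `|f x - v n x| <= 2 * c x * (2^-1) ^+ n by exact: (lim x).2.
        move=> /(lerXn2r 2 (normr_ge0 _)) => /(_ _)/le_trans; apply.
          by rewrite nnegrE mulr_ge0 ?exprn_ge0 ?invr_ge0// mulr_ge0// sqrtr_ge0.
        rewrite !exprMn sqr_sqrtr ?fine_ge0// exprAC (_ : (2^-1 : R) ^+ 2 = 4^-1); last by field.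
        rewrite -natrX mulrAC; exact: lexx.
      apply: lee_wpmul2l; first by rewrite lee_fin mulr_ge0// exprn_ge0// invr_ge0.
      by have := S0 x; case: (S x) => [r| |]//= _; exact: leey.
  rewrite ge0_integralZl//.
  apply: (@le_trans _ _ ((4 * (4^-1) ^+ n)%:E * 2%:E)%E).
    by apply: lee_wpmul2l => //; rewrite lee_fin mulr_ge0// exprn_ge0// invr_ge0.
  by rewrite -EFinM lee_fin; lra.
(* Square integrability is known for f - v 0 rather than for f, so that the limit is built as u 0
   plus this difference. *)
have [w wE] : exists w : L2 mu, {ae mu, forall x, L2_fun w x = f x - v 0%N x}.
  apply: L2_of_fun; first exact: measurable_funB.
  exact: le_lt_trans (If 0%N) (ltry _).
pose l := u 0%N + w.
have lE n : {ae mu, forall x, L2_fun (l - u n) x = f x - v n x}.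
  near=> x.
  have -> : L2_fun (l - u n) x = L2_fun l x - L2_fun (u n) x by near: x; exact: L2_funB.
  have -> : L2_fun l x = L2_fun (u 0%N) x + L2_fun w x by near: x; exact: L2_funD.
  have -> : L2_fun w x = f x - v 0%N x by near: x.
  have Ax : A x by near: x.
  by rewrite /v indicE mem_set// !mulr1; ring.
apply/cvg_ex; exists l.
have nl n : `|l - u n| <= 4 * (2^-1) ^+ n.
  rewrite -(@ler_pXn2r _ 2) ?nnegrE ?mulr_ge0 ?exprn_ge0 ?invr_ge0//.
  rewrite -lee_fin -L2_norm_sqrE.
  have -> : (\int[mu]_x (L2_fun (l - u n) x ^+ 2)%:E = \int[mu]_x ((f x - v n x) ^+ 2)%:E)%E.
    apply: ae_eq_integral => //.
    - by apply/measurable_EFinP; apply: measurable_funX; exact: measurable_L2_fun.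
    - by apply/measurable_EFinP; apply: measurable_funX; exact: measurable_funB.
    - by apply: filterS (lE n) => x -> _.
  apply: (le_trans (If n)); rewrite lee_fin exprMn exprAC (_ : (2^-1 : R) ^+ 2 = 4^-1); last by field.
  apply: ler_wpM2r; first by rewrite exprn_ge0// invr_ge0.
  by rewrite -natrX ler_nat.
have c0 : 4 * (2^-1) ^+ n @[n --> \oo] --> (0 : R).
  rewrite -[X in _ --> X](mulr0 4); apply: cvgMl_tmp.
  by apply: cvg_expr; rewrite ger0_norm ?invr_ge0// invf_lt1// ltr1n.
apply/cvgrPdist_le => e e0; near=> n; apply: (le_trans (nl n)).
have : `|0 - 4 * (2^-1 : R) ^+ n| <= e by near: n; move/cvgrPdist_le : c0; apply.
by rewrite sub0r normrN ger0_norm// mulr_ge0// exprn_ge0// invr_ge0.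
Unshelve. all: by end_near. Qed.

End L2_complete.

HB.instance Definition _ d (T : measurableType d) (R : realType)
    (mu : {measure set T -> \bar R}) :=
  Uniform_isComplete.Build (L2 mu) (cvg_of_fast_sequences (@L2_cvg_fast _ T R mu)).

(** * Density of differences of integrable [0, 1]-valued functions *)

Section L2_density.
Context d (T : measurableType d) (R : realType) (mu : {measure set T -> \bar R}).
Implicit Types (u v w : L2 mu).

(** For two such functions u and v the sub-Markov property gives 0 <= (P_s u, v) <= int v, uniformly
    in s. *)
Definition unit_valued u : Prop :=
  {ae mu, forall x, 0 <= L2_fun u x <= 1} /\ mu.-integrable setT (EFin \o L2_fun u).

(** On the band the upper cut makes |f| / (n+1) at most 1, and the lower cut makes it at most f^2,
    hence integrable. *)
Let band n (f : T -> R) : set T := [set x | n.+1%:R^-1 <= `|f x| <= n.+1%:R].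

Let measurable_band n f : measurable_fun setT f -> measurable (band n f).
Proof.
move=> mf; rewrite -[band n f]setTI.
have m : measurable_fun setT (fun x => `|f x|) by exact: measurableT_comp.
apply: (_ : measurable (setT `&` (fun x => `|f x|) @^-1` `[n.+1%:R^-1, n.+1%:R])) => //.
by apply: m => //.
Qed.

Let unit_valued_band n (f : T -> R) : measurable_fun setT f ->
  mu.-integrable setT (EFin \o (fun x => f x ^+ 2)) ->
  exists u, unit_valued u /\
    {ae mu, forall x, L2_fun u x = Num.max (f x) 0 * \1_(band n f) x / n.+1%:R}.
Proof.
move=> mf If; pose h x := Num.max (f x) 0 * \1_(band n f) x / n.+1%:R.
have n0 : 0 < n.+1%:R :> R by rewrite ltr0n.
have mh : measurable_fun setT h.
  apply: measurable_funM => //; apply: measurable_funM.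
    by apply: measurable_maxr => //.
  by apply: measurable_indic; exact: measurable_band.
have h01 x : 0 <= h x <= 1.
  rewrite /h indicE; have [|_] := boolP (x \in band n f); last by rewrite mulr0 mul0r lexx ler01.
  rewrite inE mulr1 => /andP[h1 h2]; rewrite divr_ge0 ?le_max ?lexx ?orbT ?(ltW n0)//=.
  rewrite ler_pdivrMr// mul1r ge_max (ltW n0) andbT.
  exact: le_trans (ler_norm _) h2.
have hf x : h x <= f x ^+ 2.
  rewrite /h indicE; have [|_] := boolP (x \in band n f); last by rewrite mulr0 mul0r sqr_ge0.
  rewrite inE mulr1 => /andP[h1 h2]; rewrite -real_normK ?num_real// expr2.
  by rewrite ler_pM ?le_max ?lexx ?orbT ?invr_ge0 ?(ltW n0)// ge_max normr_ge0 ler_norm.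
have Ih : mu.-integrable setT (EFin \o h).
  apply: le_integrable If => //; first exact/measurable_EFinP.
  move=> x _ /=; rewrite lee_fin ger0_norm; last by case/andP: (h01 x).
  by rewrite ger0_norm ?sqr_ge0.
have [|u uE] := @L2_of_fun _ _ _ mu h mh.
  apply: le_lt_trans (integrable_lty _ Ih) => //; apply: ge0_le_integral => //.
  - by move=> x _; rewrite lee_fin sqr_ge0.
  - by apply/measurable_EFinP; exact: measurable_funX.
  - exact/measurable_EFinP.
  - move=> x _; rewrite lee_fin expr2; have /andP[h0 h1] := h01 x.
    by rewrite ler_piMl.
exists u; split=> //; split; first by apply: filterS uE => x ->.
apply/integrableP; split; first by apply/measurable_EFinP; exact: measurable_L2_fun.
case/integrableP : Ih => mh' Ih; apply: le_lt_trans Ih; rewrite le_eqVlt; apply/orP; left; apply/eqP.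
apply: ae_eq_integral => //.
- apply: measurableT_comp => //; apply/measurable_EFinP; exact: measurable_L2_fun.
- exact: measurableT_comp.
- by apply: filterS uE => x /= ->.
Qed.

(** The functions v and w are the positive and negative parts of f, cut to the band and divided by n
    + 1. The squared error is the integral of f^2 off the band, which vanishes in the limit by
    domination by f^2. *)
Lemma unit_valued_dense (f : L2 mu) : exists (v w : (L2 mu)^nat),
  [/\ forall n, unit_valued (v n), forall n, unit_valued (w n) &
      n.+1%:R *: (v n - w n) @[n --> \oo] --> f].
Proof.
have mf : measurable_fun setT (L2_fun f) by exact: measurable_L2_fun.
have mNf : measurable_fun setT (fun x => - L2_fun f x) by exact: measurableT_comp.
have If : mu.-integrable setT (EFin \o (fun x => L2_fun f x ^+ 2)).
  by apply: eq_integrable (integrable_L2_funM f f) => //.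
have INf : mu.-integrable setT (EFin \o (fun x => (- L2_fun f x) ^+ 2)).
  by apply: eq_integrable If => // x _ /=; rewrite sqrrN.
have /choice[v vE] := fun n => unit_valued_band n mf If.
have /choice[w wE] := fun n => unit_valued_band n mNf INf.
exists v, w; split=> [n|n|]; [by case: (vE n)|by case: (wE n)|].
pose g n x := L2_fun f x ^+ 2 * \1_(~` band n (L2_fun f)) x.
have mb n : measurable (~` band n (L2_fun f)) by apply: measurableC; exact: measurable_band.
have mg n : measurable_fun setT (g n).
  by apply: measurable_funM; [exact: measurable_funX|exact: measurable_indic].
have distE n : (`|f - n.+1%:R *: (v n - w n)| ^+ 2 = \int[mu]_x (g n x)).
  rewrite -[LHS]/(fine (`|f - n.+1%:R *: (v n - w n)| ^+ 2)%:E) -L2_norm_sqrE; congr fine.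
  apply: ae_eq_integral => //.
  - by apply/measurable_EFinP; apply: measurable_funX; exact: measurable_L2_fun.
  - exact/measurable_EFinP.
  near=> x => _; congr EFin.
  have -> : L2_fun (f - n.+1%:R *: (v n - w n)) x =
      L2_fun f x - L2_fun (n.+1%:R *: (v n - w n)) x by near: x; exact: L2_funB.
  have -> : L2_fun (n.+1%:R *: (v n - w n)) x = n.+1%:R * L2_fun (v n - w n) x.
    by near: x; exact: L2_funZ.
  have -> : L2_fun (v n - w n) x = L2_fun (v n) x - L2_fun (w n) x by near: x; exact: L2_funB.
  have -> : L2_fun (v n) x = Num.max (L2_fun f x) 0 * \1_(band n (L2_fun f)) x / n.+1%:R.
    by near: x; exact: (vE n).2.
  have -> : L2_fun (w n) x =
      Num.max (- L2_fun f x) 0 * \1_(band n (fun x => - L2_fun f x)) x / n.+1%:R.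
    by near: x; exact: (wE n).2.
  have -> : band n (fun x => - L2_fun f x) = band n (L2_fun f).
    by apply/seteqP; split=> y; rewrite /band/= normrN.
  rewrite /g !indicE in_setC -mulrBl mulrC divfK ?pnatr_eq0// -mulrBl.
  have -> : Num.max (L2_fun f x) 0 - Num.max (- L2_fun f x) 0 = L2_fun f x.
    have -> : Num.max (- L2_fun f x) 0 = - Num.min (L2_fun f x) 0 by rewrite oppr_min oppr0.
    by rewrite opprK addr_max_min addr0.
  by case: (x \in _) => /=; rewrite ?mulr1 ?mulr0 ?subrr ?subr0 ?expr0n.
have cg x : (g n x)%:E @[n --> \oo] --> 0%E.
  apply: cvg_near_cst; have [fx0|fx0] := eqVneq (L2_fun f x) 0.
    by apply: nearW => n; rewrite /g fx0 expr0n mul0r.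
  have fx : 0 < `|L2_fun f x| by rewrite normr_gt0.
  near=> n; rewrite /g indicE in_setC mem_set ?mulr0//.
  apply/andP; split; last first.
    apply: (@le_trans _ _ n%:R); last by rewrite ler_nat.
    by near: n; exact: nbhs_infty_ger.
  apply: ltW; rewrite invf_plt ?posrE//; apply: (@le_lt_trans _ _ n%:R); last by rewrite ltr_nat.
  by near: n; exact: nbhs_infty_ger.
have [_ _] : [/\ mu.-integrable setT (cst 0 : T -> \bar R),
    [sequence \int[mu]_x `|(g n x)%:E - 0|%E]_n @ \oo --> 0%E &
    [sequence \int[mu]_x (g n x)%:E]_n @ \oo --> \int[mu]_x (cst 0%E x)]%E.
  apply: (dominated_convergence measurableT) If _ => //.
  - by move=> n; exact/measurable_EFinP.
  - by apply: nearW => x _; exact: cg.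
  - apply: nearW => x n _; rewrite lee_fin ger0_norm.
      rewrite /g indicE; case: (x \in _); rewrite ?mulr1// mulr0.
      exact: sqr_ge0.
    by rewrite mulr_ge0// sqr_ge0.
rewrite integral0 => /fine_cvg c0.
apply/cvgrPdist_le => e e0; have e2 : 0 < e ^+ 2 by rewrite exprn_gt0.
near=> n; rewrite -(@ler_pXn2r _ 2) ?nnegrE ?(ltW e0)// distE.
apply: (le_trans (ler_norm _)); rewrite -normrN -[X in `|X|]add0r.
by near: n; move/cvgrPdist_le : c0; apply.
Unshelve. all: by end_near. Qed.

End L2_density.

(** * Symmetric sub-Markovian semigroups *)

Section submarkov.
Context d (T : measurableType d) (R : realType) (mu : {measure set T -> \bar R}).
Variable P : R -> L2 mu -> L2 mu.
Hypothesis PP : symmetric_submarkov_semigroup P.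
Implicit Types (u v w f g : L2 mu).
Local Notation ip := (@L2_inner _ T R mu).
Let ipP := L2_inner_product mu.
Let ipF := ip_form ipP.

Let linP t : 0 <= t -> forall b f g, P t (b *: f + g) = b *: P t f + P t g.
Proof. by move=> t0 b f g; rewrite (sg_linear PP t0). Qed.

Let P0 t : 0 <= t -> P t 0 = 0.
Proof. by move=> t0; have := linear_scaleB (linP t0) 1 0 0; rewrite scaler0 subrr scale1r subrr. Qed.

Lemma semigroupZ t b f : 0 <= t -> P t (b *: f) = b *: P t f.
Proof. by move=> t0; rewrite -[b *: f]addr0 linP// P0// addr0. Qed.

Lemma semigroupB t f g : 0 <= t -> P t (f - g) = P t f - P t g.
Proof. by move=> t0; have := linear_scaleB (linP t0) 1 f g; rewrite !scale1r. Qed.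

Lemma iter_semigroup t n f : 0 <= t -> iter n (P t) f = P (n%:R * t) f.
Proof.
move=> t0; elim: n => [|n IH]; first by rewrite mul0r (sg_id PP).
by rewrite iterS IH -[P t _]/((P t \o P (n%:R * t)) f) -(sg_add PP) ?mulr_ge0// -nat1r mulrDl mul1r.
Qed.

Let inner_unit_valued u v : {ae mu, forall x, 0 <= L2_fun u x <= 1} -> unit_valued v ->
  0 <= ip u v <= \int[mu]_x L2_fun v x.
Proof.
move=> u01 [v01 Iv]; pose h x : R := `|L2_fun u x * L2_fun v x|.
have mu_ : measurable_fun setT (L2_fun u) by exact: measurable_L2_fun.
have mv : measurable_fun setT (L2_fun v) by exact: measurable_L2_fun.
have mh : measurable_fun setT h by apply: measurableT_comp => //; exact: measurable_funM.
have -> : ip u v = \int[mu]_x h x.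
  apply: eq_L2_inner => //; apply: filterS2 u01 v01 => x /andP[u0 _] /andP[v0 _].
  by rewrite /h ger0_norm ?mulr_ge0.
have -> : \int[mu]_x L2_fun v x = \int[mu]_x `|L2_fun v x|.
  congr fine; apply: ae_eq_integral => //; first exact/measurable_EFinP.
    by apply/measurable_EFinP; exact: measurableT_comp.
  by apply: filterS v01 => x /andP[v0 _] _; rewrite ger0_norm.
apply/andP; split; [by apply: Rintegral_ge0 => x _; rewrite /h|apply: fine_le].
- have := integrable_abse (integrable_L2_funM u v).
  exact: integrable_fin_num.
- exact: integrable_fin_num (integrable_abse Iv).
apply: ae_ge0_le_integral => //.
- by move=> x _; rewrite lee_fin /h.
- exact/measurable_EFinP.
- by apply/measurable_EFinP; exact: measurableT_comp.
apply: filterS u01 => x /andP[u0 u1] _.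
by rewrite lee_fin /h normrM ger0_norm// ler_piMl.
Qed.

(** Of the four terms of the expansion, the cross terms are nonpositive and each diagonal term is at
    most an integral in which t does not occur. *)
Let form_bounded u v w t : 0 <= t -> unit_valued v -> unit_valued w ->
  ip (P t (v - w)) (v - w) <= \int[mu]_x L2_fun v x + \int[mu]_x L2_fun w x.
Proof.
move=> t0 hv hw; have Pv := sg_submarkov PP t0 hv.1; have Pw := sg_submarkov PP t0 hw.1.
rewrite semigroupB// !(formBr ipF) !(formBl ipF).
have /andP[a1 b1] := inner_unit_valued Pv hv; have /andP[a2 b2] := inner_unit_valued Pv hw.
have /andP[a3 b3] := inner_unit_valued Pw hv; have /andP[a4 b4] := inner_unit_valued Pw hw.
lra.
Qed.

Lemma semigroup_contraction t f : 0 <= t -> `|P t f| <= `|f|.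
Proof.
move=> t0; have [v [w [vP wP cf]]] := unit_valued_dense f.
pose a n := n.+1%:R *: (v n - w n) : L2 mu.
have le_a n : `|P t (a n)| <= `|a n|.
  rewrite /a semigroupZ// !normrZ ler_wpM2l//.
  rewrite -(@ler_pXn2r _ 2) ?nnegrE// -!(ip_norm ipP) (sg_symmetric PP _ _ t0).
  (* Here |P_t x|^2 = (P_2t x, x), and the iterates of P_2t stay in the semigroup, where the uniform
     bound applies. *)
  rewrite -[P t (P t _)]/((P t \o P t) _) -(sg_add PP)// (formC ipF).
  apply: (form_contraction ipF (C := _)) => [x y|n0].
    exact: (sg_symmetric PP _ _ (addr_ge0 t0 t0)).
  rewrite iter_semigroup ?addr_ge0//; apply: form_bounded => //.
  by rewrite mulr_ge0// addr_ge0.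
have c1 : `|P t (a n)| @[n --> \oo] --> `|P t f|.
  by apply: cvg_norm; apply: continuous_cvg => //; exact: (sg_bounded PP t0).
have c2 : `|a n| @[n --> \oo] --> `|f| by apply: cvg_norm.
by apply: (ler_cvg_to c1 c2); apply: nearW.
Qed.

(** The contraction P_t with the smaller time factors out of the difference, so that continuity at
    0^+ propagates to all times. *)
Lemma semigroup_dist_le s t f : 0 <= s -> 0 <= t -> `|P s f - P t f| <= `|P `|s - t| f - f|.
Proof.
wlog st : s t / t <= s => [h s0 t0|s0 t0].
  have [|/ltW] := leP t s; first by move=> ts; exact: h.
  by move=> ts; rewrite distrC (distrC s) h.
have d0 : 0 <= s - t by rewrite subr_ge0.
have -> : P s f = P t (P (s - t) f).
  by rewrite -[RHS]/((P t \o P (s - t)) f) -(sg_add PP)// addrC subrK.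
rewrite -semigroupB// ger0_norm//.
exact: semigroup_contraction.
Qed.

Lemma continuous_semigroup f : continuous (fun r : R => P `|r| f).
Proof.
move=> r; apply/cvgrPdist_le => e e0.
have [D /= D0 hD] : \forall h \near 0^'+, `|f - P h f| <= e.
  by have /cvgrPdist_le := @sg_strongly_continuous _ _ _ _ _ PP f; apply.
exists D => //= x; rewrite /ball /= => rx.
apply: (le_trans (semigroup_dist_le _ (normr_ge0 _) (normr_ge0 _))).
(* The limit at 0^+ says nothing about h = 0. *)
set h := `| `|r| - `|x| |; have [->|h0] := eqVneq h 0.
  by rewrite (sg_id PP) subrr normr0 ltW.
rewrite distrC; apply: hD; last by rewrite lt_def h0 /h normr_ge0.
by rewrite /= sub0r normrN /h normr_id (le_lt_trans (ler_dist_dist _ _)).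
Qed.

Lemma decaying_semigroup_expR a : 0 < a ->
  decaying_semigroup ip a (fun r f => expR (- (a * `|r|)) *: P `|r| f).
Proof.
move=> a0; split.
- by move=> r b f g; rewrite linP// scalerDr !scalerA mulrC.
- by move=> r f g; rewrite (formZl ipF) (formZr ipF) (sg_symmetric PP).
- move=> r f; rewrite normrZ ger0_norm ?expR_ge0// ler_wpM2l ?expR_ge0//.
  exact: semigroup_contraction.
- move=> f r; apply: cvgZ; last exact: continuous_semigroup.
  apply: continuous_cvg; first exact: continuous_expR.
  by apply: cvgN; apply: cvgM; [exact: cvg_cst|exact: cvg_norm].
- move=> r s f r0 s0; rewrite !ger0_norm ?addr_ge0//.
  by rewrite (sg_add PP)//= semigroupZ// scalerA -expRD -opprD -mulrDr.
- by move=> f; rewrite normr0 mulr0 oppr0 expR0 scale1r (sg_id PP).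
- by move=> r f; rewrite normr_id.
Qed.

End submarkov.

Lemma bessel_I0E (R : realType) (z : R) : 0 <= z -> bessel_I0 (2 * Num.sqrt z) = besselH z.
Proof.
move=> z0; rewrite besselHE /bessel_I0 /psum; congr (limn (series _)).
apply/funext => k; rewrite /bessel_coeff /= [2 * _]mulrC mulfK ?pnatr_eq0//.
by rewrite exprM sqr_sqrtr// div1r.
Qed.

Lemma bessel_J0E (R : realType) (z : R) : 0 <= z -> bessel_J0 (2 * Num.sqrt z) = besselH (- z).
Proof.
move=> z0; rewrite besselHE /bessel_J0 /psum; congr (limn (series _)).
apply/funext => k; rewrite /bessel_coeff /= [2 * _]mulrC mulfK ?pnatr_eq0//.
by rewrite exprM sqr_sqrtr// [in RHS]exprNn mulrAC mulrA mulrC mulrA.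
Qed.

(** Monotone convergence along [0, N]; it turns finiteness of the integral in the criterion into
    boundedness of the forms (W_N(2t) g, g). *)
Lemma integral_0y_lt_pinfty (R : realType) (f : R -> R) : continuous f ->
  (forall s, 0 <= s -> 0 <= f s) ->
  (\int[@lebesgue_measure R]_(s in `[0%R, +oo[) (f s)%:E < +oo)%E <->
  exists C, forall N : nat, \int[@lebesgue_measure R]_(s in `[0, N%:R]) f s <= C.
Proof.
move=> cf f0.
have mf D : measurable_fun D (EFin \o f).
  by apply/measurable_EFinP; apply: measurable_funS (continuous_measurable_fun cf).
pose F (N : nat) : set R := `[0, N%:R]%classic.
have UF : \bigcup_N F N = `[0, +oo[%classic.
  apply/seteqP; split=> x /=; rewrite in_itv/= andbT.
    by move=> [N _]; rewrite /F/= in_itv/= => /andP[].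
  move=> x0; near \oo => N; exists N => //; rewrite /F/= in_itv/= x0/=.
  by near: N; exact: nbhs_infty_ger.
have ndF : nondecreasing_seq F.
  move=> n m nm; apply/subsetPset => x; rewrite /F/= !in_itv/= => /andP[-> h]/=.
  by rewrite (le_trans h)// ler_nat.
have F0 N x : F N x -> (0 <= (f x)%:E)%E.
  by rewrite /F/= in_itv/= lee_fin => /andP[/f0].
have IFE N : (\int[@lebesgue_measure R]_(s in F N) (f s)%:E)%E =
    (\int[@lebesgue_measure R]_(s in F N) f s)%:E.
  rewrite fineK//; exact: (integrable_fin_num _ (continuous_integrable _ _ cf)).
have c := @ge0_nondecreasing_set_cvg_integral _ (measurableTypeR R) _ F (EFin \o f)
  (@lebesgue_measure R) ndF (fun=> measurable_itv _) (fun=> mf _) F0.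
rewrite UF in c; split=> [fin|[C h]].
- exists (fine (\int[@lebesgue_measure R]_(s in `[0%R, +oo[) (f s)%:E)%E) => N.
  rewrite -lee_fin -IFE fineK.
    apply: ge0_subset_integral => //.
    - exact: measurable_itv.
    - exact: mf.
    - by move=> x /=; rewrite in_itv/= andbT lee_fin => /f0.
    - by rewrite -UF; exact: (bigcup_sup (i := N)).
  rewrite ge0_fin_numE//; apply: integral_ge0 => x /=.
  by rewrite in_itv/= andbT lee_fin => /f0.
- apply: (@le_lt_trans _ _ C%:E); last exact: ltry.
  apply: (cvge_to_le c); apply: nearW => N.
  by rewrite IFE lee_fin; exact: h.
Unshelve. all: by end_near. Qed.


(** * Transfer from Q back to P *)

Section resolvent_calculus.
Context d (T : measurableType d) (R : realType) (mu : {measure set T -> \bar R}).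
Variables (P : R -> L2 mu -> L2 mu) (alpha : R).
Hypotheses (PP : symmetric_submarkov_semigroup P) (alpha0 : 0 < alpha).
Let Q (r : R) (f : L2 mu) := expR (- (alpha * `|r|)) *: P `|r| f.
Let ipP := L2_inner_product mu.
Let QP : decaying_semigroup (@L2_inner _ T R mu) alpha Q := decaying_semigroup_expR PP alpha0.

Lemma calJE s f : 0 <= s -> calJ P alpha s f = resolvent Q (rexp alpha Q s f).
Proof.
move=> s0; apply: (etrans _ (besselJE ipP alpha0 QP f s0)).
have h r : `[0, +oo[%classic r ->
    (bessel_J0 (2 * Num.sqrt (s * r)) * expR (- (alpha * r))) *: P r f =
    besselH (- (s * r)) *: Q r f.
  rewrite /= in_itv/= andbT => r0.
  by rewrite bessel_J0E ?mulr_ge0// /Q ger0_norm// scalerA.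
have [_ e] := @eq_bochner _ _ R (L2 mu) (@lebesgue_measure R) _ _ _ h.
rewrite /besselJ -e.
reflexivity.
Qed.

(** Source of the factor exp(- alpha t) in the inversion formula, which is obtained for Q first. *)
Lemma semigroup_unshift t f : 0 <= t -> P t f = Q t (expR (alpha * t) *: f).
Proof.
move=> t0; rewrite /Q ger0_norm// (semigroupZ PP)// scalerA -expRD.
by rewrite addrC subrr expR0 scale1r.
Qed.

Lemma integrandE c g s : 0 <= c -> 0 <= s ->
  bessel_I0 (2 * Num.sqrt (c * s)) *: calJ P alpha s g =
  besselH (s * c) *: resolvent Q (rexp alpha Q s g).
Proof. by move=> c0 s0; rewrite bessel_I0E ?mulr_ge0// calJE// mulrC. Qed.

(** The partial integrals are W_N(t) Q_t (exp(alpha t) f), whose limit is exp(alpha t) f. *)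
Lemma improper_truncation t f : 0 <= t ->
  let F s := bessel_I0 (2 * Num.sqrt (t * s)) *: calJ P alpha s (P t f) in
  improper_bochner_integrable F /\
  improper_bochner_integral F = expR (alpha * t) *: f.
Proof.
move=> t0 F.
have FE N s : `[0, N]%classic s ->
    besselH (s * t) *: resolvent Q (rexp alpha Q s (P t f)) = F s.
  by rewrite /= in_itv/= => /andP[s0 _]; rewrite /F integrandE.
have WE N : bochner_integral (@lebesgue_measure R) `[0, N] F =
    truncation alpha Q N t (Q t (expR (alpha * t) *: f)).
  have [_ e] := @eq_bochner _ _ R (L2 mu) (@lebesgue_measure R) _ _ _ (FE N).
  have <- := semigroup_unshift f t0.
  rewrite /truncation locked_withE e.
  reflexivity.
have c : bochner_integral (@lebesgue_measure R) `[0, N] F @[N --> +oo] -->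
    expR (alpha * t) *: f.
  by under eq_cvg do rewrite WE; exact: (cvg_truncation ipP alpha0 QP).
split; last exact: cvg_lim c.
split; last by apply/cvg_ex; eexists; exact: c.
move=> N N0.
have [h _] := @eq_bochner _ _ R (L2 mu) (@lebesgue_measure R) _ _ _ (FE N).
apply: h; exact: (truncation_integrable ipP alpha0 QP).
Qed.

(** The inversion formula recovers exp(alpha t) f from P_t f. *)
Lemma semigroup_inj t : 0 <= t -> injective (P t).
Proof.
move=> t0 f g fg; have [_ hf] := improper_truncation f t0.
have [_ hg] := improper_truncation g t0.
have : expR (alpha * t) *: f = expR (alpha * t) *: g by rewrite -hf -hg fg.
by apply: scalerI; rewrite gt_eqF ?expR_gt0.
Qed.

Lemma inv_domain_integral t g : 0 <= t ->
  inv_domain P t g <->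
  (\int[@lebesgue_measure R]_(s in `[0%R, +oo[)
     (bessel_I0 (2 * Num.sqrt (2 * t * s)) * L2_inner (calJ P alpha s g) g)%:E < +oo)%E.
Proof.
move=> t0; have t2 : 0 <= 2 * t by rewrite mulr_ge0.
pose k (s : R) : R := besselH (s * (2 * t)) * L2_inner (resolvent Q (rexp alpha Q s g)) g.
have -> : (\int[@lebesgue_measure R]_(s in `[0%R, +oo[)
     (bessel_I0 (2 * Num.sqrt (2 * t * s)) * L2_inner (calJ P alpha s g) g)%:E =
   \int[@lebesgue_measure R]_(s in `[0%R, +oo[) (k s)%:E)%E.
  apply: eq_integral => s; rewrite inE/= in_itv/= andbT => s0.
  by rewrite bessel_I0E ?mulr_ge0// calJE// [_ * s]mulrC.
have ck : continuous k.
  have -> : k = fun s => besselH (2 * t * s) * L2_inner (resolvent Q (rexp alpha Q s g)) g.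
    by apply/funext => s; rewrite /k mulrC [in RHS]mulrC [s * _]mulrC.
  apply: continuous_mul; first exact: continuous_besselHr.
  apply: (continuous_ip ipP).
  exact: (continuous_resolvent_rexp ipP alpha0 QP).
have k0 s : 0 <= s -> 0 <= k s.
  move=> s0; rewrite mulr_ge0 ?besselH_ge0 ?mulr_ge0//.
  exact: (resolvent_rexp_ge0 ipP alpha0 QP).
have kE (N : nat) : \int[@lebesgue_measure R]_(s in `[0, N%:R]) k s =
    L2_inner (truncation alpha Q N%:R (2 * t) g) g.
  exact/esym/(ip_truncation ipP alpha0 QP).
rewrite integral_0y_lt_pinfty//; split=> [[f _ fg]|[C hC]].
  exists (`|expR (alpha * t) *: f| ^+ 2) => N; rewrite kE -fg semigroup_unshift//.
  exact: (truncation_range_le ipP alpha0 QP).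
have [N|f fg] := @range_of_truncation_bounded _ _ _ ipP _ _ alpha0 QP t g C t0.
  by rewrite -kE; exact: hC.
exists (expR (- (alpha * t)) *: f) => //.
by rewrite semigroup_unshift// scalerA -expRD subrr expR0 scale1r.
Qed.

End resolvent_calculus.

Theorem theorem2p2 (R : realType) (E : pmetricType R)
    (m : {measure set (borel E) -> \bar R})
    (E_locally_compact : locally_compact [set: E])
    (E_separable : separable E)
    (m_sigma_finite : sigma_finite setT m)
    (m_full_support : full_support m)
    (m_separable : separable_measure m)
    (dO : measure_display) (Om : measurableType dO)
    (X : R -> Om -> one_point_compactification E)
    (theta : R -> Om -> Om)
    (Pr : one_point_compactification E -> probability Om R)
    (X_right_process : borel_right_process X theta Pr)
    (P : R -> L2 m -> L2 m)
    (P_semigroup : symmetric_submarkov_semigroup P)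
    (P_extends : extends_transition X Pr P)
    (alpha t : R) (alpha_gt0 : 0 < alpha) (t_gt0 : 0 < t) (g : L2 m) :
  (inv_domain P t g <->
   (\int[@lebesgue_measure R]_(s in `[0%R, +oo[)
      (bessel_I0 (2 * Num.sqrt (2 * t * s)) *
       L2_inner (calJ P alpha s g) g)%:E < +oo)%E) /\
  (inv_domain P t g ->
   let F := fun s : R => bessel_I0 (2 * Num.sqrt (t * s)) *: calJ P alpha s g in
   improper_bochner_integrable F /\
   inv_semigroup P t g =
     expR (- (alpha * t)) *: improper_bochner_integral F).
Proof.
have a0 := alpha_gt0; have t0 := ltW t_gt0.
split; first exact: inv_domain_integral.
move=> [f _ <-] F; have [hF eF] := improper_truncation P_semigroup a0 f t0.
split=> //; rewrite eF scalerA -expRD addrC subrr expR0 scale1r.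
(* [inv_semigroup] picks some preimage of P_t f; injectivity identifies it with f. *)
apply: (semigroup_inj P_semigroup a0 t0).
exact: (@xgetPex _ 0 [set h | P t h = P t f] (ex_intro _ f erefl)).
Qed.
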